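(* Let $2<p<\infty$, $r=p/2$, $1/r+1/r'=1$, and let $\mathcal L$, $\mu$, $\nu$, $b$ and the two weight paraproduct $\pi_b^{\mu,\nu}$ be as in the context. There is a finite constant $A$ such that $$\|\pi_b^{\mu,\nu} f\|_{L^p(\nu)}^p\le A^p\|f\|_{L^p(\mu)}^p\qquad\text{for all } f\in L^p(\mu)$$ if and only if there are finite constants $B$, $B_*$ such that for all $J\in\mathcal L$ both $$\int_J\Bigl|\sum_{I\in\mathcal L(J)}\Delta_I^\nu b\Bigr|^p\,d\nu\le B^p\mu(J)$$ and $$\int_J\Bigl[\sum_{I\in\mathcal L(J)}\frac{\nu(I)}{\mu(I)}\,\mathbb E_I^\nu\bigl(|\Delta_I^\nu b|^2\bigr)\Bigr]^{r'}d\mu\le B_*^{r'}\nu(J)$$ hold. Moreover, the best constants satisfy $c(p)\max\{B,B_*^{1/2}\}\le A\le C(p)\max\{B,B_*^{1/2}\}$, where $0<c(p)\le C(p)<\infty$ depend only on $p$.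
   Context: Setup. $(\mathcal X,\mathfrak S)$ is a measurable space carrying a $\sigma$-finite measure $\mu$ and a filtration, i.e. an increasing sequence of $\sigma$-algebras $\mathfrak S_n\subset\mathfrak S_{n+1}\subset\mathfrak S$, $n\in\mathbb Z$. Each $\mathfrak S_n$ is atomic: there is a countable collection $\mathcal L_n$ of disjoint sets of finite measure (atoms, also called intervals) such that each $A\in\mathfrak S_n$ is a union of sets from $\mathcal L_n$; thus each $I\in\mathcal L_n$ is an at most countable union of elements of $\mathcal L_{n+1}$. Put $\mathcal L=\bigcup_{n\in\mathbb Z}\mathcal L_n$. An atom may belong to several, even infinitely many, $\mathcal L_n$, but not to all of them. $\mu,\nu$ are measures on $(\mathcal X,\mathfrak S)$ that are locally finite, i.e. finite on every $I\in\mathcal L$. For $I\in\mathcal L$, $\operatorname{rk} I=\sup\{n: I\in\mathcal L_n\}\in\mathbb Z\cup\{+\infty\}$. If $\operatorname{rk} I=n<\infty$, the children of $I$ are $\operatorname{ch}(I)=\{I'\in\mathcal L_{n+1}: I'\subset I\}$; if $\operatorname{rk} I=\infty$, $\operatorname{ch}(I)=\{I\}$. For $J\in\mathcal L$, $\mathcal L(J)=\{I\in\mathcal L: I\subset J\}$. For a locally finite measure $\sigma$, $\langle f\rangle_{I,\sigma}=\sigma(I)^{-1}\int_I f\,d\sigma$ (and $\langle f\rangle_{I,\sigma}=0$ if $\sigma(I)=0$), $\mathbb E_I^\sigma f=\langle f\rangle_{I,\sigma}\mathbf 1_I$, and $\Delta_I^\sigma f=\sum_{I'\in\operatorname{ch}(I)}\mathbb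 E_{I'}^\sigma f-\mathbb E_I^\sigma f$. In integrals with respect to $\mu$, terms containing $\frac{\nu(I)}{\mu(I)}\mathbb E_I^\nu(\cdot)$ with $\mu(I)=0$ are read as $0$ (they are supported on a $\mu$-null set). The symbol $b$ is a function $\nu$-integrable on each $I\in\mathcal L$; more generally $b$ may be just a collection $\{b_I\}_{I\in\mathcal L}$ of ''martingale differences'', where each $b_I$ is $\nu$-integrable, supported on $I$, constant on each child of $I$ and satisfies $\int_I b_I\,d\nu=0$, in which case $\Delta_I^\nu b$ denotes $b_I$. The two weight paraproduct is $$\pi_b^{\mu,\nu}f=\sum_{I\in\mathcal L}(\mathbb E_I^\mu f)(\Delta_I^\nu b),$$ each atom $I$ being counted once. Infinite sums of martingale differences are understood as unconditionally convergent in $L^p(\nu)$, convergence being part of the assertion that an inequality involving such a sum holds.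
   Formalization: In the first testing condition the sum over I in L(J) is restricted to atoms with μ(I) ≠ 0; with all atoms the necessity fails (e.g. μ = 0 gives π_b f = 0 and A = 0 for every b, but the literal condition forces every Δ_I b = 0 ν-a.e.). *)

(* Defs.v *)
From HB Require Import structures.
From mathcomp Require Import all_boot all_order all_algebra.
From mathcomp Require Import all_classical all_reals all_analysis.

Set Implicit Arguments.
Unset Strict Implicit.
Unset Printing Implicit Defensive.

Import Order.TTheory GRing.Theory Num.Theory.
Import numFieldNormedType.Exports.

Local Open Scope classical_set_scope.
Local Open Scope ring_scope.

(** Atomic filtrations *)

Record atomic_filtration d (T : measurableType d)
    (S L : int -> set (set T)) : Prop := AtomicFiltration {
  af_sigma_algebra : forall n, sigma_algebra [set: T] (S n) ;
  af_measurable : forall n, S n `<=` measurable ;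
  af_increasing : forall n, S n `<=` S (n + 1) ;
  af_countable : forall n, countable (L n) ;
  af_atom : forall n, L n `<=` S n ;
  af_nonempty : forall n, ~ L n set0 ;
  af_disjoint : forall n, trivIset (L n) id ;
  af_union : forall n A, S n A ->
    exists2 C : set (set T), C `<=` L n & A = \bigcup_(I in C) I ;
  af_not_all : forall m I, L m I -> exists n, ~ L n I
}.

Definition atoms {T : Type} (L : int -> set (set T)) : set (set T) :=
  \bigcup_n L n.

Definition subatoms {T : Type} (L : int -> set (set T)) (J : set T) :
    set (set T) :=
  [set I | atoms L I /\ I `<=` J].

Definition locally_finite d (T : measurableType d) (R : realType)
    (L : int -> set (set T)) (sigma : {measure set T -> \bar R}) : Prop :=
  forall I, atoms L I -> (sigma I < +oo)%E.

Definition rk (R : realType) {T : Type} (L : int -> set (set T)) (I : set T) :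
    \bar R :=
  ereal_sup [set (n%:~R)%:E | n in [set n | L n I]].

Definition children (R : realType) {T : Type} (L : int -> set (set T))
    (I : set T) : set (set T) :=
  [set I' | (exists n : int, [/\ rk R L I = (n%:~R)%:E, L (n + 1) I' & I' `<=` I])
            \/ (rk R L I = +oo%E /\ I' = I)].

(** Averages and martingale differences *)

(* Since [0^-1 = 0] in [R] and [0 * +oo = 0] in [\bar R], this is [0] when
   [sigma I = 0]. *)
Definition eaverage d (T : measurableType d) (R : realType)
    (sigma : {measure set T -> \bar R}) (f : T -> \bar R) (I : set T) : \bar R :=
  (((fine (sigma I))^-1)%:E * \int[sigma]_(x in I) f x)%E.

Definition average d (T : measurableType d) (R : realType)
    (sigma : {measure set T -> \bar R}) (f : T -> R) (I : set T) : R :=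
  fine (eaverage sigma (EFin \o f) I).

Definition expect d (T : measurableType d) (R : realType)
    (sigma : {measure set T -> \bar R}) (I : set T) (f : T -> R) (x : T) : R :=
  average sigma f I * \1_I x.

(* For nonnegative functions, whose average may be [+oo]. *)
Definition eexpect d (T : measurableType d) (R : realType)
    (sigma : {measure set T -> \bar R}) (I : set T) (f : T -> \bar R) (x : T) :
    \bar R :=
  (eaverage sigma f I * (\1_I x)%:E)%E.

(* The children of [I] are disjoint, so that at each [x] at most one term of
   the sum over [children R L I] is nonzero. *)
Definition mdiff d (T : measurableType d) (R : realType)
    (L : int -> set (set T)) (sigma : {measure set T -> \bar R})
    (f : T -> R) (I : set T) (x : T) : R :=
  \sum_(I' \in children R L I) expect sigma I' f x - expect sigma I f x.

Inductive symbol (T : Type) (R : Type) :=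
| SymbolFun of (T -> R)
| SymbolDiff of (set T -> T -> R).

Definition symbol_diff d (T : measurableType d) (R : realType)
    (L : int -> set (set T)) (nu : {measure set T -> \bar R})
    (b : symbol T R) (I : set T) : T -> R :=
  match b with
  | SymbolFun f => mdiff L nu f I
  | SymbolDiff D => D I
  end.

Definition is_symbol d (T : measurableType d) (R : realType)
    (L : int -> set (set T)) (nu : {measure set T -> \bar R})
    (b : symbol T R) : Prop :=
  match b with
  | SymbolFun f => forall I, atoms L I -> nu.-integrable I (EFin \o f)
  | SymbolDiff D => forall I, atoms L I ->
      [/\ nu.-integrable [set: T] (EFin \o D I),
          forall x, ~ I x -> D I x = 0,
          forall I', children R L I I' ->
            forall x y, I' x -> I' y -> D I x = D I y
        & (\int[nu]_(x in I) (D I x)%:E = 0)%E]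
  end.

(** Unconditional convergence in [L^p(nu)], as convergence of the net of
    finite partial sums *)

Definition Lp_sum d (T : measurableType d) (R : realType)
    (nu : {measure set T -> \bar R}) (p : R) (D : set (set T))
    (F : set T -> T -> R) (g : T -> R) : Prop :=
  [/\ forall I, D I -> F I \in Lfun nu p%:E,
      g \in Lfun nu p%:E
    & forall e : R, 0 < e ->
        exists2 K0, fsets D K0 & forall K, fsets D K -> K0 `<=` K ->
          ('N[nu]_(p%:E)[EFin \o (fun x => \sum_(I \in K) F I x - g x)%R]
             < e%:E)%E].

(** The paraproduct and the three inequalities *)

Definition is_paraproduct d (T : measurableType d) (R : realType)
    (L : int -> set (set T)) (mu nu : {measure set T -> \bar R}) (p : R)
    (b : symbol T R) (f g : T -> R) : Prop :=
  Lp_sum nu p (atoms L)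
    (fun I x => expect mu I f x * symbol_diff L nu b I x) g.

Definition paraproduct_bound d (T : measurableType d) (R : realType)
    (L : int -> set (set T)) (mu nu : {measure set T -> \bar R}) (p : R)
    (b : symbol T R) (A : R) : Prop :=
  forall f : T -> R, f \in Lfun mu p%:E ->
    exists2 g : T -> R, is_paraproduct L mu nu p b f g
      & ('N[nu]_(p%:E)[EFin \o g] `^ p
           <= (A `^ p)%:E * 'N[mu]_(p%:E)[EFin \o f] `^ p)%E.

(* The terms with [mu I = 0], which do not occur in the paraproduct because
   [expect mu I f = 0], are left out of the sum here too: the paraproduct gives
   no control over them (if [mu = 0], it vanishes for every [b]). *)
Definition symbol_testing d (T : measurableType d) (R : realType)
    (L : int -> set (set T)) (mu nu : {measure set T -> \bar R}) (p : R)
    (b : symbol T R) (B : R) : Prop :=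
  forall J, atoms L J ->
    exists2 g : T -> R,
      Lp_sum nu p (subatoms L J `&` [set I | mu I != 0%E])
        (symbol_diff L nu b) g
      & (\int[nu]_(x in J) (`|g x| `^ p)%:E <= (B `^ p)%:E * mu J)%E.

(* The factor [nu I / mu I] is [0] when [mu I = 0]. *)
Definition square_testing d (T : measurableType d) (R : realType)
    (L : int -> set (set T)) (mu nu : {measure set T -> \bar R}) (r' : R)
    (b : symbol T R) (B : R) : Prop :=
  forall J, atoms L J ->
    (\int[mu]_(x in J)
       (\esum_(I in subatoms L J)
          ((fine (nu I) / fine (mu I))%:E
           * eexpect nu I (fun y => (`|symbol_diff L nu b I y| ^+ 2)%:E) x))
         `^ r'
     <= (B `^ r')%:E * nu J)%E.

(* [+oo] if there is no admissible constant *)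
Definition best_constant (R : realType) (P : R -> Prop) : \bar R :=
  ereal_inf [set c%:E | c in [set c | 0 <= c /\ P c]].

(* Main.v *)
Require Import Defs.
From HB Require Import structures.
From mathcomp Require Import all_boot all_order all_algebra.
From mathcomp Require Import all_classical all_reals all_analysis.
From mathcomp Require Import measurable_realfun.
From mathcomp Require Import ring lra zify.

(** The terms [average mu f I * symbol_diff L nu b I] of the paraproduct are
    martingale differences with respect to [nu]. For [p > 2], Burkholder's
    inequality makes the [L^p] norm of a sum of such differences comparable to the
    norm of its square function. The signs disappear, and boundedness becomes the
    inequality

      \int (\sum_I (average mu f I)^2 |Delta_I b|^2)^r d nu <= C \int (f^2)^r d mu,

    which concerns the positive operator that takes the average of [f ^+ 2] over [I],
    multiplies it by the fixed nonnegative function [|Delta_I b|^2], and sums. For an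
    operator of this kind from [L^r(mu)] to [L^r(nu)], it is enough to test the
    operator and its adjoint on indicators of atoms. The operator tested on [\1_J] is
    the square function of the part of the symbol in [J], which gives the first
    condition (through Burkholder's inequality once more); the adjoint tested on
    [\1_J] is the sum of the conditional means of [|Delta_I b|^2], which gives the
    second one.

    Sufficiency is [bound_of_testing], from [positive_testing]: with two families of
    stopping atoms, one for the averages of [f ^+ 2] and one for the powers of the
    partial sums, the operator splits into pieces in which these quantities are
    essentially constant and to which the testing conditions apply; the constants sum
    up by the doubling of stopping values and by Doob's maximal inequality. Jensen's
    inequality passes from the squared average of [f] to the average of [f ^+ 2].

    The first condition is necessary by applying the paraproduct to [\1_J]
    ([symbol_testing_of_bound]). For the second one ([square_testing_of_bound]),
    Jensen's inequality goes in the wrong direction; but for the extremal function of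
    the dual problem, a power of the sum [Y] to be estimated, the average over an
    atom is bounded from below by the value of the partial sum of [Y] on that atom,
    and this is all that is needed.

    The estimates are made for finite families of atoms, listed so that smaller atoms
    come later: partial sums are then martingales in discrete time, the quantities to
    be estimated are finite and can be absorbed, and the constants depend on [p]
    only. The passage to infinite sums uses that the square functions of disjoint
    families add up: since [t `^ (p / 2)] is superadditive, bounded square functions
    force the net of partial sums to be Cauchy ([Lp_sum_exists]). *)

Set Implicit Arguments.
Unset Strict Implicit.
Unset Printing Implicit Defensive.

Import Order.TTheory GRing.Theory Num.Theory.
Import numFieldNormedType.Exports.

Local Open Scope classical_set_scope.
Local Open Scope ring_scope.

(** * Inequalities for real powers *)

Section powR_inequalities.
Context {R : realType}.
Implicit Types (a b s p q x y : R).

Lemma conj_exponent p q : 1 < p -> p^-1 + q^-1 = 1 ->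
  [/\ 1 < q, (p - 1) * q = p & (q - 1) * p = q].
Proof.
move=> p1 pq.
have p0 : p != 0 by rewrite gt_eqF//; lra.
have p10 : p - 1 != 0 by rewrite gt_eqF//; lra.
have qE : q = p / (p - 1).
  apply: invr_inj; rewrite invfM invrK.
  have -> : q^-1 = 1 - p^-1 by lra.
  by field; rewrite p0.
rewrite qE; split.
- by rewrite ltr_pdivlMr; lra.
- by field.
- by field.
Qed.

(** Several statements have one exponent only; their proofs use this conjugate. *)
Lemma conj_exponent_def p : 1 < p -> p^-1 + (p / (p - 1))^-1 = 1.
Proof.
move=> p1; have p0 : p != 0 by rewrite gt_eqF//; lra.
rewrite invfM invrK.
by field.
Qed.

(** Young's inequality for [s * x] and [s^-1 * y]. The free parameter [s] makes one
    of the two constants small, which is what every absorption argument below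
    requires; the factors [p^-1] and [q^-1] are bounded by [1]. *)
Lemma young_scaled p q s x y : 1 < p -> p^-1 + q^-1 = 1 -> 0 < s ->
  0 <= x -> 0 <= y -> x * y <= s `^ p * x `^ p + s `^ (- q) * y `^ q.
Proof.
move=> p1 pq s0 x0 y0; have [q1 _ _] := conj_exponent p1 pq.
have -> : x * y = (s * x) * (s^-1 * y).
  by rewrite mulrACA mulfV ?gt_eqF// mul1r.
have sx0 : 0 <= s * x by rewrite mulr_ge0// ltW.
have sy0 : 0 <= s^-1 * y by rewrite mulr_ge0// invr_ge0 ltW.
have /le_trans -> // := conjugate_powR sx0 sy0 (lt_trans ltr01 p1) (lt_trans ltr01 q1) pq.
have -> : s `^ (- q) = s^-1 `^ q.
  by rewrite -powR_inv1 ?ltW// -powRrM mulN1r.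
rewrite !powRM ?invr_ge0 ?(ltW s0)// lerD//.
  by rewrite ler_piMr ?mulr_ge0 ?powR_ge0// invf_le1; lra.
by rewrite ler_piMr ?mulr_ge0 ?powR_ge0// invf_le1; lra.
Qed.

Lemma powRB1M p b : 1 < p -> 0 <= b -> b `^ (p - 1) * b = b `^ p.
Proof. by move=> p1 b0; rewrite mulrC mulr_powRB1//; lra. Qed.

(** Young's inequality with the second factor [b `^ (p - 1)]; it says that the
    convex function [t `^ p] lies above its tangent at [b]. *)
Lemma powR_tangent p a b : 1 < p -> 0 <= a -> 0 <= b ->
  p * b `^ (p - 1) * a <= a `^ p + (p - 1) * b `^ p.
Proof.
move=> p1 a0 b0.
have pq := conj_exponent_def p1; have [q1 e1 e2] := conj_exponent p1 pq.
have p0 : 0 < p by lra.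
have := conjugate_powR a0 (powR_ge0 b (p - 1)) p0 (lt_trans ltr01 q1) pq.
rewrite -powRrM e1 => H.
have := ler_wpM2l (ltW p0) H.
have -> : p * (a `^ p / p + b `^ p / (p / (p - 1))) = a `^ p + (p - 1) * b `^ p.
  by field; rewrite !gt_eqF//; lra.
by rewrite mulrA mulrAC.
Qed.

Lemma powR_sub_le p a b : 1 < p -> 0 <= a -> 0 <= b ->
  b `^ p - a `^ p <= p * b `^ (p - 1) * (b - a).
Proof.
move=> p1 a0 b0; have := powR_tangent p1 a0 b0.
rewrite mulrBr -[p * _ * b]mulrA powRB1M//; lra.
Qed.

(** The tangent inequality at the smaller value, arranged as an Abel summation: for
    the successive values [a <= b] of a running maximum it compares the increment
    of the [p]-th power with that of the [(p - 1)]-st power. *)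
Lemma powR_doob_step p a b : 1 < p -> 0 <= a -> 0 <= b ->
  (p - 1) * (b `^ p - a `^ p) <= p * ((b `^ (p - 1) - a `^ (p - 1)) * b).
Proof.
move=> p1 a0 b0; have := powR_tangent p1 b0 a0.
rewrite (mulrBl b (b `^ (p - 1))) powRB1M//; lra.
Qed.

Lemma powRD_le s x y : 0 <= s -> 0 <= x -> 0 <= y ->
  (x + y) `^ s <= 2 `^ s * (x `^ s + y `^ s).
Proof.
move=> s0 x0 y0; wlog xy : x y x0 y0 / x <= y.
  move=> H; have [|/ltW] := leP x y; first exact: H.
  by rewrite addrC [X in _ <= _ * X]addrC; exact: H.
apply: (@le_trans _ _ ((2 * y) `^ s)).
  by apply: ge0_ler_powR => //; rewrite ?nnegrE; lra.
by rewrite powRM// ler_wpM2l ?powR_ge0// lerDr powR_ge0.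
Qed.

(** The source of all the summability below: pieces with disjoint index sets have
    additive square functions, so that the [s]-th powers of the pieces add up to
    at most the [s]-th power of the whole. *)
Lemma powR_superadd s x y : 1 <= s -> 0 <= x -> 0 <= y ->
  x `^ s + y `^ s <= (x + y) `^ s.
Proof.
move=> s1 x0 y0.
have H z : 0 <= z -> z <= x + y -> z `^ s <= z * (x + y) `^ (s - 1).
  move=> z0 zxy; rewrite -(@mulr_powRB1 _ z) //; last by lra.
  rewrite ler_wpM2l// ge0_ler_powR// ?nnegrE; lra.
rewrite -[X in _ <= X]mulr_powRB1; [|lra|lra].
by rewrite mulrDl lerD// H//; lra.
Qed.

Lemma powR_superadd_sum s n (x : 'I_n -> R) : 1 <= s -> (forall i, 0 <= x i) ->
  \sum_i x i `^ s <= (\sum_i x i) `^ s.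
Proof.
move=> s1; elim: n x => [|n IH] x x0; first by rewrite !big_ord0 powR_ge0.
rewrite !big_ord_recr /=; apply: le_trans (powR_superadd s1 _ (x0 _)); last first.
  by apply: sumr_ge0.
by rewrite lerD// IH.
Qed.

(** The function [p * spow (p - 1)] is the derivative of [`|t| `^ p]. *)
Definition spow s a := Num.sg a * `|a| `^ s.

Lemma ge0_spow s a : 0 <= a -> s != 0 -> spow s a = a `^ s.
Proof.
rewrite /spow le_eqVlt => /orP[/eqP<- s0|a0 _]; first by rewrite normr0 powR0 ?mulr0.
by rewrite gtr0_sg// mul1r gtr0_norm.
Qed.

Lemma spowN s a : spow s (- a) = - spow s a.
Proof. by rewrite /spow sgrN normrN mulNr. Qed.

Lemma norm_spow s a : s != 0 -> `|spow s a| = `|a| `^ s.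
Proof.
move=> s0; rewrite /spow normrM normr_sg (ger0_norm (powR_ge0 _ _)).
by case: eqVneq => [->|_]; rewrite ?normr0 ?powR0 ?mulr0 ?mul1r.
Qed.

Lemma spow_mul p b : 1 < p -> spow (p - 1) b * b = `|b| `^ p.
Proof.
move=> p1; rewrite /spow mulrAC -[X in _ * X * _](mulr_sg_norm b).
have [->|b0] := eqVneq b 0; first by rewrite sgr0 !mul0r normr0 powR0//; lra.
by rewrite mulrA -expr2 sqr_sg b0 mul1r mulrC powRB1M.
Qed.

Lemma spow_tangent p a b : 1 < p ->
  p * spow (p - 1) b * a <= `|a| `^ p + (p - 1) * `|b| `^ p.
Proof.
move=> p1; have H := powR_tangent p1 (normr_ge0 a) (normr_ge0 b).
apply: le_trans H.
have E : `|spow (p - 1) b| = `|b| `^ (p - 1) by apply: norm_spow; rewrite gt_eqF//; lra.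
rewrite -E -(mulrA _ `|_|) -normrM -mulrA; apply: ler_wpM2l; first lra.
exact: ler_norm.
Qed.

(** The increment of [spow s] is at most its derivative at the larger of the two
    points times [b - a]; that point is at most [`|a| + `|b - a|]. Arguments of
    opposite signs are controlled by [b - a] alone, and the two remaining sign
    patterns follow by symmetry. *)
Lemma spow_monotone_bound s : 1 < s -> exists2 K, 0 < K & forall a b,
  (spow s b - spow s a) * (b - a) <=
  K * ((`|a| `^ (s - 1) + `|b - a| `^ (s - 1)) * (b - a) ^+ 2).
Proof.
move=> s1; have s0 : s != 0 by rewrite gt_eqF//; lra.
have c0 : 0 <= s * 2 `^ (s - 1) by rewrite mulr_ge0 ?powR_ge0//; lra.
exists (s * 2 `^ (s - 1) + 2); first lra.
have pos a b : 0 <= a -> 0 <= b -> (spow s b - spow s a) * (b - a) <=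
  (s * 2 `^ (s - 1)) * ((`|a| `^ (s - 1) + `|b - a| `^ (s - 1)) * (b - a) ^+ 2).
  move=> a0 b0; rewrite !ge0_spow//.
  have key x y : 0 <= x -> x <= y -> (y `^ s - x `^ s) * (y - x) <=
      s * y `^ (s - 1) * (y - x) ^+ 2.
    move=> x0 xy; rewrite expr2 mulrA ler_wpM2r//; first lra.
    by apply: powR_sub_le => //; lra.
  have [ab|/ltW ba] := leP a b.
    rewrite (le_trans (key _ _ a0 ab))// mulrA ler_wpM2r ?sqr_ge0//.
    rewrite -mulrA ler_wpM2l//; first lra.
    have -> : b `^ (s - 1) = (`|a| + `|b - a|) `^ (s - 1).
      by rewrite !ger0_norm//; [congr (_ `^ _); ring|lra].
    by apply: powRD_le => //; lra.
  have -> : (b `^ s - a `^ s) * (b - a) = (a `^ s - b `^ s) * (a - b) by ring.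
  rewrite (le_trans (key _ _ b0 ba))// mulrA.
  have -> : (a - b) ^+ 2 = (b - a) ^+ 2 by ring.
  rewrite ler_wpM2r ?sqr_ge0//.
  rewrite -mulrA ler_wpM2l//; first lra.
  apply: (@le_trans _ _ (`|a| `^ (s - 1) + `|b - a| `^ (s - 1))).
    by rewrite (ger0_norm a0) lerDl powR_ge0.
  rewrite ler_peMl ?addr_ge0 ?powR_ge0// -[leLHS](powRr0 2).
  by apply: ler_powR; lra.
have posW a b : 0 <= a -> 0 <= b -> (spow s b - spow s a) * (b - a) <=
  (s * 2 `^ (s - 1) + 2) * ((`|a| `^ (s - 1) + `|b - a| `^ (s - 1)) * (b - a) ^+ 2).
  move=> a0 b0; rewrite (le_trans (pos _ _ a0 b0))// ler_wpM2r//; last lra.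
  by rewrite mulr_ge0 ?sqr_ge0// addr_ge0 ?powR_ge0.
have opp a b : a <= 0 -> 0 <= b -> (spow s b - spow s a) * (b - a) <=
  (s * 2 `^ (s - 1) + 2) * ((`|a| `^ (s - 1) + `|b - a| `^ (s - 1)) * (b - a) ^+ 2).
  move=> a0 b0.
  (* Both [spow s b] and [- spow s a] are nonnegative and at most [`|b - a| `^ s]. *)
  apply: (@le_trans _ _ (2 * (`|b - a| `^ (s - 1) * (b - a) ^+ 2))); last first.
    apply: ler_pM; [lra|by rewrite mulr_ge0 ?powR_ge0 ?sqr_ge0|lra|].
    by apply: ler_wpM2r; rewrite ?sqr_ge0// lerDr powR_ge0.
  rewrite expr2 2!mulrA ler_wpM2r//; first lra.
  have -> : spow s a = - spow s (- a) by rewrite spowN opprK.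
  rewrite opprK !ge0_spow//; last lra.
  have -> : 2 * (`|b - a| `^ (s - 1)) * (b - a) = (b - a) `^ s + (b - a) `^ s.
    rewrite ger0_norm; last lra.
    by rewrite -mulrA powRB1M//; [ring|lra].
  by rewrite lerD// ge0_ler_powR// ?nnegrE; lra.
move=> a b.
have [a0|/ltW a0] := leP 0 a; have [b0|/ltW b0] := leP 0 b.
- exact: posW.
- have := @opp (- a) (- b); rewrite !spowN normrN.
  have -> : - b - - a = - (b - a) by ring.
  rewrite sqrrN normrN => H; apply: le_trans (H _ _); [|lra|lra].
  by rewrite le_eqVlt; apply/orP; left; apply/eqP; ring.
- exact: opp.
- have := @posW (- a) (- b); rewrite !spowN normrN.
  have -> : - b - - a = - (b - a) by ring.
  rewrite sqrrN normrN => H; apply: le_trans (H _ _); [|lra|lra].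
  by rewrite le_eqVlt; apply/orP; left; apply/eqP; ring.
Qed.

Lemma powR2 a : 0 <= a -> a `^ 2 = a ^+ 2.
Proof. by move=> a0; rewrite -[2]/(2%:R) powR_mulrn. Qed.

Lemma powR_addXn2 s a : 0 < s -> `|a| `^ s * a ^+ 2 = `|a| `^ (s + 2).
Proof.
move=> s0; rewrite powRD ?powR2// ?real_normK ?num_real//.
by apply/implyP => /eqP; lra.
Qed.

(** Second order Taylor expansion of [`|t| `^ p] with remainder. Convexity gives the
    linear term at [a + d]; moving it to [a] costs an increment of the derivative,
    and [p > 2] makes that increment locally Lipschitz. *)
Lemma powR_taylor2 p : 2 < p -> exists2 C, 0 < C & forall a d,
  `|a + d| `^ p <= `|a| `^ p + p * spow (p - 1) a * d +
                   C * (`|a| `^ (p - 2) * d ^+ 2 + `|d| `^ p).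
Proof.
move=> p2; have p1 : 1 < p by lra.
have s1 : 1 < p - 1 by lra.
have [K K0 HK] := spow_monotone_bound s1.
exists (p * K); first by rewrite mulr_gt0//; lra.
move=> a d; have := spow_tangent a (a + d) p1; rewrite -mulrA => H1.
have := HK a (a + d); rewrite addrAC subrr add0r => H2.
have E : `|d| `^ p = `|d| `^ (p - 1 - 1) * d ^+ 2.
  by rewrite powR_addXn2; [congr (_ `^ _); ring|lra].
rewrite E -mulrDl; have -> : p - 2 = p - 1 - 1 by lra.
have H3 := spow_mul (a + d) p1.
have := ler_wpM2l (ltW (lt_trans ltr01 p1)) H2.
nra.
Qed.

End powR_inequalities.

(** Telescoping the tangent inequality along the partial sums: the discrete form of
    the chain rule [d (S `^ s) = s * S `^ (s - 1) * d S]. *)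
Lemma psum_powR_le (T : Type) (R : realType) (s : R) (X : nat -> T -> R) (N : nat) (x : T) :
  1 < s -> (forall k, 0 <= X k x) ->
  (\sum_(k < N) X k x) `^ s <= s * \sum_(k < N) X k x * (\sum_(j < k.+1) X j x) `^ (s - 1).
Proof.
move=> s1 X0; elim: N => [|n IH]; first by rewrite !big_ord0 powR0 ?mulr0// gt_eqF//; lra.
have Y0 m : 0 <= \sum_(j < m) X j x by exact: sumr_ge0.
have h := powR_sub_le s1 (Y0 n) (Y0 n.+1); move: h IH.
have -> : \sum_(k < n.+1) X k x * (\sum_(j < k.+1) X j x) `^ (s - 1) =
   \sum_(k < n) X k x * (\sum_(j < k.+1) X j x) `^ (s - 1) +
   X n x * (\sum_(j < n.+1) X j x) `^ (s - 1) by rewrite big_ord_recr.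
have -> : \sum_(k < n.+1) X k x - \sum_(k < n) X k x = X n x.
  by rewrite big_ord_recr /= addrAC subrr add0r.
set U := \sum_(k < n) _ * _; set V := (\sum_(k < n.+1) _) `^ s.
set W := (\sum_(k < n.+1) _) `^ (s - 1).
have -> : s * (U + X n x * W) = s * U + s * W * X n x by ring.
by lra.
Qed.

(** * Measurability and integrals of nonnegative functions *)

Section measurability.
Context d (T : measurableType d) (R : realType).
Implicit Types f g : T -> R.
Notation mf := (measurable_fun [set: T]).

Lemma mfD f g : mf f -> mf g -> mf (fun x => f x + g x).
Proof. exact: measurable_funD. Qed.
Lemma mfM f g : mf f -> mf g -> mf (fun x => f x * g x).
Proof. exact: measurable_funM. Qed.
Lemma mfN f : mf f -> mf (fun x => - f x).
Proof. exact: measurable_funN. Qed.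
Lemma mfX f n : mf f -> mf (fun x => f x ^+ n).
Proof. exact: measurable_funX. Qed.
Lemma mf_max f g : mf f -> mf g -> mf (fun x => Num.max (f x) (g x)).
Proof. exact: measurable_maxr. Qed.
Lemma mf_powR f s : mf f -> mf (fun x => f x `^ s).
Proof. by move=> ?; apply: (measurableT_comp (measurable_powR _)). Qed.
Lemma mf_norm f : mf f -> mf (fun x => `|f x|).
Proof. by move=> ?; apply: (measurableT_comp (@normr_measurable _ _)). Qed.
Lemma mf_cst (c : R) : mf (fun=> c).
Proof. exact: measurable_cst. Qed.
Lemma mf_indic (A : set T) : measurable A -> mf (fun x => \1_A x : R).
Proof. by move=> ?; apply: measurable_indic. Qed.
Lemma mf_sum I (s : seq I) (P : pred I) (h : I -> T -> R) :
  (forall i, mf (h i)) -> mf (fun x => \sum_(i <- s | P i) h i x).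
Proof.
move=> mh; under eq_fun do rewrite big_mkcond.
apply: measurable_sum => i; by case: (P i) => //; exact: mf_cst.
Qed.
End measurability.

(** Measurability of an expression, by recursion on its shape. *)
Ltac mes_rec :=
  lazymatch goal with
  | H : measurable_fun ?D ?f |- measurable_fun ?D ?f => exact H
  | |- measurable_fun _ (fun _ => ?c) => exact: mf_cst
  | |- measurable_fun _ (fun x => (@?f x) + (@?g x)) => apply: mfD; mes_rec
  | |- measurable_fun _ (fun x => - (@?f x)) => apply: mfN; mes_rec
  | |- measurable_fun _ (fun x => (@?f x) * (@?g x)) => apply: mfM; mes_rec
  | |- measurable_fun _ (fun x => (@?f x) ^+ ?n) => apply: mfX; mes_rec
  | |- measurable_fun _ (fun x => (@?f x) `^ ?s) => apply: mf_powR; mes_rec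
  | |- measurable_fun _ (fun x => `|@?f x|) => apply: mf_norm; mes_rec
  | |- measurable_fun _ (fun x => Num.max (@?f x) (@?g x)) => apply: mf_max; mes_rec
  | |- measurable_fun _ (fun x => \sum_(i <- _ | _) (@?f i x)) =>
      apply: mf_sum; intros; mes_rec
  | _ => first
    [ match goal with H : measurable_fun _ _ |- _ => exact H end
    | match goal with H : forall _, measurable_fun _ _ |- _ => simple apply H end
    | apply: mf_indic; first [assumption
        | match goal with H : forall _, measurable _ |- _ => simple apply H end]
    | done ]
  end.

Ltac mes := repeat match goal with |- forall _, _ => intro end; solve [mes_rec].

(** Nonnegativity of an expression, by recursion on its shape. *)
Ltac nneg_base := first
  [ match goal with H : is_true (0 <= _) |- _ => exact H end
  | match goal with H : is_true (0 < _) |- _ => exact (ltW H) end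
  | match goal with H : forall _, is_true (0 <= _) |- _ => simple apply H end
  | match goal with H : forall _ _, is_true (0 <= _) |- _ => simple apply H end
  | done | match goal with |- is_true (0 <= _)%R => lra end ].

Ltac nneg_rec :=
  lazymatch goal with
  | |- is_true (0 <= _ `^ _) => exact: powR_ge0
  | |- is_true (0 <= `|_|) => exact: normr_ge0
  | |- is_true (0 <= _ ^+ 2) => exact: sqr_ge0
  | |- is_true (0 <= \sum_(_ <- _ | _) _) => apply: sumr_ge0; intros; nneg_rec
  | |- is_true (0 <= _ * _) => first [apply: mulr_ge0; nneg_rec | nneg_base]
  | |- is_true (0 <= _ + _) => first [apply: addr_ge0; nneg_rec | nneg_base]
  | _ => nneg_base
  end.

Ltac nneg := repeat match goal with |- forall _, _ => intro end; solve [nneg_rec].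

(** The side conditions of the linearity lemmas for integrals. *)
Ltac side := try solve [ mes | nneg | rewrite lee_fin; nneg
  | apply: integral_ge0 => ? _; rewrite lee_fin; nneg ].

Section rint.
Context d (T : measurableType d) (R : realType).
Variable mu : {measure set T -> \bar R}.
Notation mf := (measurable_fun [set: T]).
Implicit Types (f g A B : T -> R).

(** Integrals of nonnegative real functions over the whole space. A local integral
    is written with the indicator inside, so that every estimate is a pointwise
    inequality between real numbers, and may take the value [+oo]. *)
Definition rint f : \bar R := \int[mu]_x (f x)%:E.

Lemma rint_ge0 f : (forall x, 0 <= f x) -> (0 <= rint f)%E.
Proof. by move=> f0; apply: integral_ge0 => x _; rewrite lee_fin. Qed.

Lemma rint_le f g : mf f -> mf g -> (forall x, 0 <= f x) ->
  (forall x, f x <= g x) -> (rint f <= rint g)%E.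
Proof.
move=> mff mg f0 fg; apply: ge0_le_integral => //.
- by move=> x _; rewrite lee_fin.
- exact/measurable_EFinP.
- exact/measurable_EFinP.
- by move=> x _; rewrite lee_fin.
Qed.

Lemma rintD f g : mf f -> mf g -> (forall x, 0 <= f x) -> (forall x, 0 <= g x) ->
  rint (fun x => f x + g x) = (rint f + rint g)%E.
Proof.
move=> mff mg f0 g0; rewrite /rint -ge0_integralD//.
- by move=> x _; rewrite lee_fin.
- exact/measurable_EFinP.
- by move=> x _; rewrite lee_fin.
- exact/measurable_EFinP.
Qed.

Lemma rintZ (c : R) f : mf f -> (forall x, 0 <= f x) -> 0 <= c ->
  rint (fun x => c * f x) = (c%:E * rint f)%E.
Proof.
move=> mff f0 c0; rewrite /rint -ge0_integralZl_EFin//.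
- by move=> x _; rewrite lee_fin.
- exact/measurable_EFinP.
Qed.

Lemma rint_sum I (s : seq I) (P : pred I) (F : I -> T -> R) :
  (forall i, mf (F i)) -> (forall i x, 0 <= F i x) ->
  rint (fun x => \sum_(i <- s | P i) F i x) = (\sum_(i <- s | P i) rint (F i))%E.
Proof.
move=> mF F0; rewrite /rint big_mkcond /=.
under eq_integral do rewrite big_mkcond -sumEFin.
rewrite ge0_integral_sum//.
- by apply: eq_bigr => i _; case: (P i) => //; rewrite integral0.
- move=> i; apply/measurable_EFinP; case: (P i) => //; exact: mf_cst.
- by move=> i x _; rewrite lee_fin; case: (P i).
Qed.

Lemma rint_indic (c : R) (D : set T) : measurable D -> 0 <= c ->
  rint (fun x => c * \1_D x) = (c%:E * mu D)%E.
Proof.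
move=> mD c0; rewrite rintZ//.
by rewrite /rint integral_indic// setIT.
Qed.

Lemma eq_rint f g : f =1 g -> rint f = rint g.
Proof. by move=> fg; rewrite /rint; apply: eq_integral => x _; rewrite fg. Qed.

Lemma rint_restrict f (D : set T) : measurable D ->
  rint (fun x => f x * \1_D x) = (\int[mu]_(x in D) (f x)%:E)%E.
Proof.
move=> mD; rewrite /rint [RHS]integral_mkcond; apply: eq_integral => x _.
rewrite patchE indicE; case: (x \in D); first by rewrite mulr1.
by rewrite mulr0.
Qed.

(** Integrating [A + e <= B] without knowing that [A] or [B] is integrable: the
    positive and negative parts of [e] have equal finite integrals, and the
    inequality is integrated in the form [A + e^+ <= B + e^-]. All the cancellation
    of martingale differences enters the proof through this lemma. *)
Lemma le_rint_mean0 A B (e : T -> R) : mf A -> mf B ->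
  (forall x, 0 <= A x) -> (forall x, 0 <= B x) ->
  mu.-integrable setT (EFin \o e) -> (\int[mu]_x (e x)%:E = 0)%E ->
  (forall x, A x + e x <= B x) -> (rint A <= rint B)%E.
Proof.
move=> mA mB A0 B0 ie e0 AB.
have me : mf e by have /integrableP[/measurable_EFinP] := ie.
pose ep x := Num.max (e x) 0; pose en x := Num.max (- e x) 0.
have Ep : rint ep = (\int[mu]_x (EFin \o e)^\+ x)%E.
  by apply: eq_integral => x _; rewrite funeposE /= EFin_max.
have En : rint en = (\int[mu]_x (EFin \o e)^\- x)%E.
  by apply: eq_integral => x _; rewrite funenegE /= EFin_max.
have fp := integrable_pos_fin_num measurableT ie.
have fn := integrable_neg_fin_num measurableT ie.
have eqpn : rint ep = rint en.
  have sub0 (P N : \bar R) : P \is a fin_num -> N \is a fin_num ->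
      (P - N = 0)%E -> P = N.
    by case: P N => [P| |] [N| |]// _ _ [] /eqP; rewrite subr_eq0 => /eqP ->.
  by rewrite Ep En; apply: sub0 => //; rewrite -integralE.
have ep0 x : 0 <= ep x by rewrite le_max lexx orbT.
have en0 x : 0 <= en x by rewrite le_max lexx orbT.
have mep : mf ep by rewrite /ep; mes.
have men : mf en by rewrite /en; mes.
rewrite -(@leeD2rE _ (rint en)); last by rewrite En.
rewrite -{1}eqpn -!rintD//; apply: rint_le; [mes|mes|by move=> x; rewrite addr_ge0|].
move=> x; have : ep x - en x = e x.
  by rewrite /ep /en; case: (leP (e x) 0) => h; case: (leP (- e x) 0) => h'; lra.
have := AB x; lra.
Qed.

(** The finiteness of [X] is essential; this is why the estimates below are proved for
    finite sums first. *)
Lemma ereal_absorb (X Y : \bar R) : (X < +oo)%E -> (0 <= X)%E ->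
  (X <= 2^-1%:E * X + Y)%E -> (X <= 2%:E * Y)%E.
Proof.
case: X => // x _ x0; case: Y => [y| |].
- by rewrite -!EFinM -EFinD !lee_fin; lra.
- by rewrite gt0_muley ?lte_fin// leey.
- by rewrite -EFinM //= leeNy_eq.
Qed.

End rint.

Notation "\rint[ mu ]_ x F" := (rint mu (fun x => F%R))
  (at level 36, mu at level 10, x name, F at level 36).

(** * Doob's maximal inequality *)

(** Finite families of atoms are listed from the larger to the smaller ones and
    extended by the empty set, so that [nat] indexes them and the sums over
    initial segments form a martingale. *)
Definition tree_ordered (T : Type) (I : nat -> set T) := forall j k, (j < k)%N ->
  I k `<=` I j \/ (forall x, I k x -> ~ I j x).

Section running_maximum.
Context d (T : measurableType d) (R : realType).

Lemma tree_ordered_indic (I : nat -> set T) j k x y : tree_ordered I ->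
  (j < k)%N -> I k x -> I k y -> \1_(I j) x = \1_(I j) y :> R.
Proof.
move=> tI /tI[sub|dis] Ix Iy.
  by rewrite !indicE !mem_set//; exact: sub.
by rewrite !indicE !memNset//; exact: dis.
Qed.

(** The maximal function of the averages [q], restricted to the first [n] sets. *)
Fixpoint runmax (I : nat -> set T) (q : nat -> R) (n : nat) (x : T) : R :=
  if n is n'.+1 then Num.max (runmax I q n' x) (q n' * \1_(I n') x) else 0.

Variables (I : nat -> set T) (q : nat -> R).
Hypotheses (mI : forall k, measurable (I k)) (q0 : forall k, 0 <= q k).

Lemma runmax_ge0 n x : 0 <= runmax I q n x.
Proof. by elim: n => //= n IH; rewrite le_max IH. Qed.

Lemma runmax_le n m x : (n <= m)%N -> runmax I q n x <= runmax I q m x.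
Proof.
move=> nm; rewrite -(subnKC nm); elim: (m - n)%N => [|k IH]; first by rewrite addn0.
by rewrite addnS /= le_max IH.
Qed.

Lemma runmax_ge n k x : (k < n)%N -> I k x -> q k <= runmax I q n x.
Proof.
move=> kn Ix; apply: le_trans (runmax_le x kn) => /=.
by rewrite le_max indicE mem_set// mulr1 lexx orbT.
Qed.

Lemma runmax_sum s n x : 0 < s ->
  runmax I q n x `^ s <= \sum_(k < n) q k `^ s * \1_(I k) x.
Proof.
move=> s0; elim: n => [|n IH]; first by rewrite big_ord0 /= powR0// gt_eqF.
rewrite big_ord_recr /=.
have h0 : 0 <= \sum_(i < n) q i `^ s * \1_(I i) x.
  by apply: sumr_ge0 => i _; rewrite mulr_ge0 ?powR_ge0.
have [_|_] := leP (runmax I q n x) (q n * \1_(I n) x).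
  rewrite powRM//; rewrite (_ : \1_(I n) x `^ s = \1_(I n) x); first lra.
  by rewrite indicE; case: (_ \in _); rewrite ?powR1// powR0// gt_eqF.
rewrite (le_trans IH)// lerDl mulr_ge0 ?powR_ge0//.
Qed.

Lemma mf_runmax n : measurable_fun [set: T] (runmax I q n).
Proof. by elim: n => [|n IH] /=; mes. Qed.

Lemma runmax_adapted n k x y : tree_ordered I -> (n <= k)%N -> I k x -> I k y ->
  runmax I q n x = runmax I q n y.
Proof.
move=> tI + Ix Iy; elim: n => //= n IH nk; rewrite IH//; last exact: ltnW.
by rewrite (tree_ordered_indic tI nk Ix Iy).
Qed.

End running_maximum.

(** The default value [u] covers the empty set, at which the hypothesis says
    nothing. *)
Lemma const_on (T U : Type) (A : set T) (h : T -> U) (u : U) :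
  (forall x y, A x -> A y -> h x = h y) -> exists c, forall x, A x -> h x = c.
Proof.
move=> H; have [[x Ax]|nA] := pselect (exists x, A x).
  by exists (h x) => y Ay; exact: H.
by exists u => x Ax; exfalso; apply: nA; exists x.
Qed.

Lemma powR_choose (R : realType) (c q : R) : 0 < c -> 0 < q ->
  exists2 s, 0 < s & s `^ (- q) = c.
Proof.
move=> c0 q0; exists (c `^ (- q^-1)); first by rewrite powR_gt0.
by rewrite -powRrM mulNr mulrN opprK mulVf ?gt_eqF// powRr1// ltW.
Qed.

(** Young's inequality with an arbitrarily small constant in front of [y `^ q]. *)
Lemma young_small (R : realType) (p q e : R) : 1 < p -> p^-1 + q^-1 = 1 -> 0 < e ->
  exists2 K, 0 < K & forall x y, 0 <= x -> 0 <= y ->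
    x * y <= K * x `^ p + e * y `^ q.
Proof.
move=> p1 pq e0; have [q1 _ _] := conj_exponent p1 pq.
have [s s0 <-] := powR_choose e0 (lt_trans ltr01 q1).
exists (s `^ p); first by rewrite powR_gt0.
by move=> x y x0 y0; exact: young_scaled.
Qed.

(** Doob's maximal inequality. The increment of [M `^ (p - 1)] at step [n] is constant
    on [I n] and lives where the maximum is [q n], so that there the maximum may be
    replaced by [g] under the integral. Summing the increments bounds the integral
    of [M `^ p] by that of [M `^ (p - 1) * g], and Young's inequality absorbs. *)
Lemma doob_maximal (R : realType) (p : R) : 1 < p -> exists2 C : R, 0 < C &
  forall d (T : measurableType d) (mu : {measure set T -> \bar R})
    (I : nat -> set T) (q : nat -> R) (g : T -> R) (N : nat),
  tree_ordered I -> (forall k, measurable (I k)) ->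
  (forall k, (mu (I k) < +oo)%E) -> (forall k, 0 <= q k) ->
  measurable_fun setT g -> (forall x, 0 <= g x) ->
  (forall k, (k < N)%N ->
     ((q k)%:E * mu (I k) <= \rint[mu]_x (g x * \1_(I k) x))%E) ->
  (\rint[mu]_x (runmax I q N x `^ p) <= C%:E * \rint[mu]_x (g x `^ p))%E.
Proof.
move=> p1; have pq := conj_exponent_def p1.
have [q'1 e1 e2] := conj_exponent p1 pq; set q' := p / (p - 1) in pq q'1 e1 e2.
have p10 : 0 < p - 1 by lra.
have pn0 : p != 0 by rewrite gt_eqF//; lra.
have e0 : 0 < (p - 1) / p / 2 by rewrite !divr_gt0//; lra.
have [K K0 HK] := young_small p1 pq e0.
exists (2 * (p / (p - 1) * K)).
  by rewrite !mulr_gt0// ?invr_gt0//; lra.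
move=> d T mu I q g N tI mI fI q0 mg g0 Hq.
pose M n := runmax I q n; pose D n x := M n.+1 x `^ (p - 1) - M n x `^ (p - 1).
have mM n : measurable_fun setT (M n) by exact: mf_runmax.
have M0 n x : 0 <= M n x by exact: runmax_ge0.
have D0 n x : 0 <= D n x.
  rewrite subr_ge0 ge0_ler_powR// ?nnegrE//; first lra.
  exact: runmax_le.
have mD n : measurable_fun setT (D n) by rewrite /D; mes.
have Dsupp n x : ~ I n x -> D n x = 0.
  move=> nI; rewrite /D /M /= indicE memNset// mulr0.
  by rewrite (max_idPl _) ?subrr// M0.
(* Where the increment [D n] is nonzero, the running maximum has just become [q n]. *)
have DI n : (n < N)%N ->
    (\rint[mu]_x (D n x * M n.+1 x) <= \rint[mu]_x (D n x * g x))%E.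
  move=> nN.
  have [c Hc] : exists c, forall x, I n x -> D n x = c.
    apply: (const_on 0) => x y Ix Iy; rewrite /D /M /=.
    rewrite (runmax_adapted _ tI (leqnn n) Ix Iy).
    by rewrite !indicE !mem_set.
  have [c0|c0] := leP 0 c; last first.
    have H x : D n x = 0.
      have [Ix|/Dsupp//] := pselect (I n x).
      by have := D0 n x; rewrite (Hc x Ix); lra.
    by rewrite (@eq_rint _ _ _ _ _ (fun x => D n x * g x))// => x; rewrite !H !mul0r.
  have -> : rint mu (fun x => D n x * M n.+1 x) = (c%:E * ((q n)%:E * mu (I n)))%E.
    rewrite muleA -EFinM -rint_indic ?mulr_ge0//; apply: eq_rint => x.
    have [Ix|nIx] := pselect (I n x); last first.
      by rewrite Dsupp// mul0r indicE memNset// mulr0.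
    rewrite indicE mem_set// mulr1.
    have := Hc x Ix; rewrite {1}/D /M /= indicE mem_set// mulr1.
    have [_|_ ] := leP (runmax I q n x) (q n); first by rewrite Hc.
    by rewrite subrr => c0E; rewrite (Hc x Ix) -c0E !mul0r.
  have -> : rint mu (fun x => D n x * g x) =
            (c%:E * \rint[mu]_x (g x * \1_(I n) x))%E.
    rewrite -rintZ//; [|mes|by move=> x; rewrite mulr_ge0].
    apply: eq_rint => x; have [Ix|nIx] := pselect (I n x).
      by rewrite Hc// indicE mem_set// mulr1.
    by rewrite Dsupp// indicE memNset// mulr0 mulr0 mul0r.
  by apply: lee_wpmul2l; [rewrite lee_fin|exact: Hq].
have MM x : (p - 1) * M N x `^ p <= p * \sum_(n < N) D n x * M n.+1 x.
  elim: (N) => [|n IH]; first by rewrite big_ord0 /M /= (powR0 pn0) !mulr0.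
  have -> : \sum_(i < n.+1) D i x * M i.+1 x =
    \sum_(i < n) D i x * M i.+1 x + D n x * M n.+1 x by rewrite big_ord_recr.
  rewrite mulrDr.
  by have := powR_doob_step p1 (M0 n x) (M0 n.+1 x); rewrite -/(D n x) mulrBr; lra.
have telD x : \sum_(n < N) D n x = M N x `^ (p - 1).
  elim: (N) => [|n IH]; first by rewrite big_ord0 /M /= powR0// gt_eqF.
  have -> : \sum_(i < n.+1) D i x = \sum_(i < n) D i x + D n x by rewrite big_ord_recr.
  by rewrite IH /D addrC subrK.
have step : (\rint[mu]_x (M N x `^ p) <=
    (p / (p - 1))%:E * \rint[mu]_x (M N x `^ (p - 1) * g x))%E.
  apply: (@le_trans _ _ (\rint[mu]_x (p / (p - 1) * \sum_(n < N) D n x * M n.+1 x))).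
    apply: rint_le; [by mes|by mes|by move=> x; rewrite powR_ge0|].
    move=> x; have := MM x; rewrite -ler_pdivlMl// => /le_trans; apply.
    by rewrite mulrA [_^-1 * p]mulrC.
  rewrite rintZ; [|by mes| |by rewrite divr_ge0//; lra]; last first.
    by move=> x; apply: sumr_ge0 => i _; rewrite mulr_ge0.
  apply: lee_wpmul2l; first by rewrite lee_fin divr_ge0//; lra.
  rewrite rint_sum; [|by mes|by move=> i x; rewrite mulr_ge0].
  have -> : \rint[mu]_x (M N x `^ (p - 1) * g x) =
            (\sum_(n < N) \rint[mu]_x (D n x * g x))%E.
    rewrite -rint_sum; [|by mes|by move=> i x; rewrite mulr_ge0].
    by apply: eq_rint => x; rewrite -telD mulr_suml.
  by apply: lee_sum => i _; exact: DI.
(* A crude bound by the sum instead of the maximum; absorption requires it. *)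
have fin : (\rint[mu]_x (M N x `^ p) < +oo)%E.
  apply: (@le_lt_trans _ _ (\rint[mu]_x (\sum_(k < N) q k `^ p * \1_(I k) x))).
    apply: rint_le; [by mes|by mes|by move=> x; rewrite powR_ge0|].
    by move=> x; apply: runmax_sum => //; lra.
  rewrite rint_sum; [|by mes|by move=> i x; rewrite mulr_ge0 ?powR_ge0].
  apply: lte_sum_pinfty => i _; rewrite rint_indic ?powR_ge0//.
  by rewrite lte_mul_pinfty// ?lee_fin ?powR_ge0.
have young : (\rint[mu]_x (M N x `^ (p - 1) * g x) <=
   K%:E * \rint[mu]_x (g x `^ p) + ((p - 1) / p / 2)%:E * \rint[mu]_x (M N x `^ p))%E.
  rewrite -!rintZ ?(ltW K0) ?(ltW e0)//; try (by mes); try (by move=> x; rewrite powR_ge0).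
  rewrite -rintD; try (by mes); try (by move=> x; rewrite mulr_ge0 ?powR_ge0// ltW).
  apply: rint_le; [by mes|by mes|by move=> x; rewrite mulr_ge0 ?powR_ge0|].
  move=> x; have := HK (g x) (M N x `^ (p - 1)) (g0 x) (powR_ge0 _ _).
  by rewrite mulrC -powRrM e1.
rewrite (EFinM 2 (p / (p - 1) * K)) -muleA; apply: ereal_absorb; first exact: fin.
  by apply: rint_ge0 => x; rewrite powR_ge0.
apply: (le_trans step).
apply: (@le_trans _ _ ((p / (p - 1))%:E * (K%:E * \rint[mu]_x (g x `^ p) + ((p - 1) / p / 2)%:E * \rint[mu]_x (M N x `^ p)))%E).
  by apply: lee_wpmul2l => //; rewrite lee_fin divr_ge0//; lra.
rewrite ge0_muleDr; last 2 first.
- by rewrite mule_ge0 ?lee_fin ?(ltW K0)//; apply: rint_ge0 => x; rewrite powR_ge0.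
- by rewrite mule_ge0 ?lee_fin ?(ltW e0)//; apply: rint_ge0 => x; rewrite powR_ge0.
have E : p / (p - 1) * ((p - 1) / p / 2) = 2^-1.
  by field; rewrite !gt_eqF//; lra.
rewrite addeC (muleA (p / (p - 1))%:E K%:E) -(EFinM (p / (p - 1)) K).
rewrite (muleA (p / (p - 1))%:E ((p - 1) / p / 2)%:E).
by rewrite -(EFinM (p / (p - 1)) ((p - 1) / p / 2)) E; exact: lexx.
Qed.

(** * Burkholder's inequalities *)

Section martingale_diffs.
Context d (T : measurableType d) (R : realType).
Notation mf := (measurable_fun [set: T]).

(** The field [md_adapted] is the constancy of a martingale difference on the children
    of its atom: a later set that meets the support of [dd j] lies in one child. *)
Record martingale_diffs (nu : {measure set T -> \bar R}) (p : R)
    (I : nat -> set T) (dd : nat -> T -> R) : Prop := MartingaleDiffs {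
  md_tree : tree_ordered I ;
  md_measurable : forall k, measurable (I k) ;
  md_finite : forall k, (nu (I k) < +oo)%E ;
  md_supp : forall k x, ~ I k x -> dd k x = 0 ;
  md_adapted : forall j k x y, (j < k)%N -> I k x -> I k y -> dd j x = dd j y ;
  md_integrable : forall k, nu.-integrable [set: T] (EFin \o dd k) ;
  md_mean : forall k, (\int[nu]_x (dd k x)%:E = 0)%E ;
  md_Lp : forall k, (\rint[nu]_x (`|dd k x| `^ p) < +oo)%E
}.

Definition psum (dd : nat -> T -> R) n x := \sum_(k < n) dd k x.

Lemma psum0 dd x : psum dd 0 x = 0. Proof. exact: big_ord0. Qed.
Lemma psumS dd n x : psum dd n.+1 x = psum dd n x + dd n x.
Proof. exact: big_ord_recr. Qed.

Lemma mf_psum dd n : (forall k, mf (dd k)) -> mf (psum dd n).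
Proof. by move=> ?; rewrite /psum; mes. Qed.

Lemma psum_ge0 dd n x : (forall k x, 0 <= dd k x) -> 0 <= psum dd n x.
Proof. by move=> d0; apply: sumr_ge0 => i _. Qed.

Lemma psum_mono dd n m x : (forall k x, 0 <= dd k x) -> (n <= m)%N ->
  psum dd n x <= psum dd m x.
Proof.
move=> d0 nm; rewrite -(subnKC nm); elim: (m - n)%N => [|k IH]; first by rewrite addn0.
by rewrite addnS psumS (le_trans IH)// lerDl.
Qed.

(** An a priori bound without any uniformity; its only purpose is the finiteness that
    absorption requires. *)
Lemma psum_Lp_fin (nu : {measure set T -> \bar R}) (dd : nat -> T -> R) s N :
  0 < s -> (forall k, mf (dd k)) ->
  (forall k, (\rint[nu]_x (`|dd k x| `^ s) < +oo)%E) ->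
  (\rint[nu]_x (`|psum dd N x| `^ s) < +oo)%E.
Proof.
move=> s0 md fin; have mp n := mf_psum n md.
elim: N => [|n IH].
  rewrite (@eq_rint _ _ _ _ _ (fun=> 0)).
    by rewrite /rint integral0.
  by move=> x; rewrite psum0 normr0 powR0// gt_eqF.
apply: (@le_lt_trans _ _ (\rint[nu]_x (2 `^ s * (`|psum dd n x| `^ s + `|dd n x| `^ s)))).
  apply: rint_le; [by mes|by mes|by move=> x; rewrite powR_ge0|] => x.
  apply: (@le_trans _ _ ((`|psum dd n x| + `|dd n x|) `^ s)).
    by apply: ge0_ler_powR; rewrite ?nnegrE ?(ltW s0) ?addr_ge0// psumS ler_normD.
  by apply: powRD_le; rewrite // ltW.
rewrite rintZ; side.
rewrite rintD; side.
apply: lte_mul_pinfty; [by rewrite lee_fin powR_ge0|by []|].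
apply: lte_add_pinfty; [exact: IH|exact: fin].
Qed.

Section facts.
Variables (nu : {measure set T -> \bar R}) (p : R) (I : nat -> set T) (dd : nat -> T -> R).
Hypothesis M : martingale_diffs nu p I dd.

Lemma md_mf k : mf (dd k).
Proof. by have /integrableP[/measurable_EFinP] := md_integrable M k. Qed.

Lemma psum_adapted n k x y : (n <= k)%N -> I k x -> I k y -> psum dd n x = psum dd n y.
Proof.
move=> nk Ix Iy; apply: eq_bigr => j _; apply: (md_adapted M _ Ix Iy).
exact: leq_trans (ltn_ord j) nk.
Qed.

(** A coefficient that is constant on the support of a martingale difference changes
    neither its integrability nor its mean. *)
Lemma md_transform n (g : T -> R) : (forall x y, I n x -> I n y -> g x = g y) ->
  nu.-integrable setT (EFin \o (fun x => g x * dd n x)) /\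
  (\int[nu]_x (g x * dd n x)%:E = 0)%E.
Proof.
move=> /(const_on 0)[c Hc].
have E x : g x * dd n x = c * dd n x.
  by have [/Hc->//|/(md_supp M)->] := pselect (I n x); rewrite !mulr0.
have E1 : (EFin \o (fun x => g x * dd n x)) = (fun x => c%:E * (dd n x)%:E)%E.
  by apply/funext => x; rewrite /= E EFinM.
have E2 : (fun x => (g x * dd n x)%:E) = (fun x => c%:E * (dd n x)%:E)%E by [].
rewrite [X in _ /\ (\int[_]_(x in _) X x = _)%E]E2 E1; split.
  by apply: integrableZl => //; exact: md_integrable M n.
by rewrite integralZl ?(md_mean M) ?mule0//; exact: md_integrable M n.
Qed.

Lemma le_rint_transform n (g A B : T -> R) :
  (forall x y, I n x -> I n y -> g x = g y) -> mf A -> mf B ->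
  (forall x, 0 <= A x) -> (forall x, 0 <= B x) ->
  (forall x, A x + g x * dd n x <= B x) -> (rint nu A <= rint nu B)%E.
Proof.
by move=> /md_transform[ie e0] mA mB A0 B0 AB; exact: (le_rint_mean0 mA mB A0 B0 ie e0 AB).
Qed.

(** The absolute value of a martingale is a submartingale. When [n] grows from [k] to
    [N], the increment is compared with its product by the sign of the previous
    partial sum, which has mean zero. *)
Lemma psum_doob c N k : (forall j x, I j x -> psum dd j x = c j) -> (k < N)%N ->
  (`|c k|%:E * nu (I k) <= \rint[nu]_x (`|psum dd N x| * \1_(I k) x))%E.
Proof.
move=> Hc kN; have mI := md_measurable M; have md := md_mf.
have mp n := mf_psum n md.
rewrite -(subnKC (ltnW kN)); elim: (N - k)%N => [|n IH].
  rewrite addn0 -rint_indic//; apply: rint_le; [by mes|by mes|by move=> x; rewrite mulr_ge0|].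
  move=> x; rewrite indicE; have [xI|] := boolP (x \in I k); last by rewrite !mulr0.
  by rewrite (Hc k x)// -[I k x]in_setE.
apply: (le_trans IH); rewrite addnS.
(* The sign of the sum, restricted to [I k], is constant on [I (k + n)]. *)
apply: (@le_rint_transform (k + n)
   (fun x => Num.sg (psum dd (k + n) x) * \1_(I k) x)); [|by mes|by mes| | |].
- move=> x y Ix Iy; rewrite (psum_adapted (leqnn _) Ix Iy); congr (_ * _).
  have [n0|n0] := posnP n; last first.
    by apply: (tree_ordered_indic _ (md_tree M) _ Ix Iy); rewrite -addn1 leq_add2l.
  by move: Ix Iy; rewrite n0 addn0 => Ix Iy; rewrite !indicE !mem_set.
- by move=> x; rewrite mulr_ge0.
- by move=> x; rewrite mulr_ge0.
move=> x; rewrite mulrAC -mulrDl ler_wpM2r// psumS.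
set a := psum _ _ _; set e := dd _ _.
rewrite {1}(normrEsg a) -mulrDr (le_trans (ler_norm _))// normrM normr_sg.
by rewrite ler_piMl//; case: (a != 0).
Qed.

Lemma psum_const : exists c, forall j x, I j x -> psum dd j x = c j.
Proof.
have H j : exists c, forall x, I j x -> psum dd j x = c.
  by apply: (const_on 0) => x y; exact: psum_adapted.
by have [c] := choice H; exists c.
Qed.

(** A partial sum at [x] changes only at the sets containing [x], and before such a
    set its value is one of the [c j]; a partial sum after the last such set is the
    final one. *)
Lemma psum_le_max c N x k : (forall j x, I j x -> psum dd j x = c j) -> (k <= N)%N ->
  `|psum dd k x| <= runmax I (fun k => `|c k|) N x + `|psum dd N x|.
Proof.
move=> Hc kN; rewrite -{1}(subKn kN).
have : (N - k <= N)%N by rewrite leq_subr.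
have M0 := @runmax_ge0 _ T R I (fun k => `|c k|) N x.
elim: (N - k)%N => [|n IH] nN; first by rewrite subn0 lerDr.
have E : (N - n = (N - n.+1).+1)%N by rewrite subnSK.
have [Ix|nIx] := pselect (I (N - n.+1)%N x); last first.
  have := IH (ltnW nN); rewrite E psumS (md_supp M nIx) addr0 => /le_trans; exact.
rewrite (Hc _ _ Ix); apply: (@le_trans _ _ (runmax I (fun k => `|c k|) N x)).
  apply: (@runmax_ge _ T R I (fun k => `|c k|) N (N - n.+1) x) => //.
  by rewrite -subn_gt0 subKn.
by rewrite lerDl.
Qed.

End facts.
End martingale_diffs.

Lemma powR_half (R : realType) (p : R) (x : R) : (x ^+ 2) `^ (p / 2) = `|x| `^ p.
Proof.
rewrite -real_normK ?num_real// -powR2// -powRrM.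
by have -> : 2 * (p / 2) = p by field.
Qed.

(** Burkholder's inequality for [p > 2]. Taylor's formula is summed over the steps: the
    first order terms have mean zero, and the second order terms are bounded by
    [m `^ (p - 2)] times the square function plus a power of the square function,
    [m] being the maximal function. Doob's inequality and Young's inequality absorb
    the factor [m]. *)
Lemma burkholder_upper (R : realType) (p : R) : 2 < p -> exists2 C : R, 0 < C &
  forall d (T : measurableType d) (nu : {measure set T -> \bar R})
    (I : nat -> set T) (dd : nat -> T -> R) (N : nat),
  martingale_diffs nu p I dd ->
  (\rint[nu]_x (`|psum dd N x| `^ p) <=
   C%:E * \rint[nu]_x (psum (fun k x => dd k x ^+ 2) N x `^ (p / 2)))%E.
Proof.
move=> p2; have p1 : 1 < p by lra.
have p0 : 0 < p by lra.
have r1 : 1 < p / 2 by lra.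
have rr := conj_exponent_def r1; set r' := p / 2 / (p / 2 - 1) in rr.
have [C1 C10 HT] := powR_taylor2 p2.
have [Cd Cd0 HD] := doob_maximal p1.
have e0 : 0 < (2 * C1 * Cd)^-1 by rewrite invr_gt0 !mulr_gt0.
have [K K0 HK] := young_small r1 rr e0.
exists (2 * (C1 * (K + 1))); first by rewrite !mulr_gt0// addr_gt0.
move=> d T nu I dd N M.
have mI := md_measurable M; have md := md_mf M; have mp n := mf_psum n md.
pose s n := psum (fun k x => dd k x ^+ 2) n.
have ms n : measurable_fun setT (s n) by apply: mf_psum => k; mes.
have s0 n x : 0 <= s n x by apply: psum_ge0 => ? ?; rewrite sqr_ge0.
have [c Hc] := psum_const M.
pose q k := `|c k|; have q0 k : 0 <= q k by rewrite normr_ge0.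
pose m := runmax I q N.
have mm : measurable_fun setT m by exact: mf_runmax.
have m0 x : 0 <= m x by exact: runmax_ge0.
pose rem n x := `|psum dd n x| `^ (p - 2) * dd n x ^+ 2 + `|dd n x| `^ p.
have rem0 n x : 0 <= rem n x by rewrite /rem; nneg.
have mrem n : measurable_fun setT (rem n) by rewrite /rem; mes.
have step n : (\rint[nu]_x (`|psum dd n x| `^ p) <= C1%:E * \rint[nu]_x (\sum_(k < n) rem k x))%E.
  elim: n => [|n IH].
    rewrite (@eq_rint _ _ _ _ _ (fun=> 0)).
      rewrite /rint integral0 mule_ge0 ?lee_fin ?(ltW C10)//.
      by apply: integral_ge0 => x _; rewrite big_ord0.
    by move=> x; rewrite psum0 normr0 powR0// gt_eqF.
  apply: (@le_trans _ _ (\rint[nu]_x (`|psum dd n x| `^ p + C1 * rem n x))).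
    apply: (@le_rint_transform _ _ _ _ _ _ _ M n
      (fun x => - (p * spow (p - 1) (psum dd n x)))); [ |by mes|by mes| | |].
    - by move=> x y Ix Iy; rewrite (psum_adapted M (leqnn _) Ix Iy).
    - by move=> x; rewrite powR_ge0.
    - by move=> x; rewrite addr_ge0 ?powR_ge0// mulr_ge0// ltW.
    - by move=> x; rewrite psumS; have := HT (psum dd n x) (dd n x); rewrite -/(rem n x); lra.
  rewrite rintD; side.
  have -> : \rint[nu]_x (\sum_(k < n.+1) rem k x) =
     (\rint[nu]_x (\sum_(k < n) rem k x) + rint nu (rem n))%E.
    rewrite -rintD; side.
    by apply: eq_rint => x; rewrite big_ord_recr.
  rewrite ge0_muleDr; [|by apply: rint_ge0 => x; exact: sumr_ge0|exact: rint_ge0].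
  by rewrite leeD// rintZ; side.
have HM : (\rint[nu]_x (m x `^ p) <= Cd%:E * \rint[nu]_x (`|psum dd N x| `^ p))%E.
  apply: HD => //; [exact: md_tree M|exact: md_finite M|by mes|].
  by move=> k kN; exact: (psum_doob M).
have remle x : \sum_(k < N) rem k x <=
    (K + 1) * s N x `^ (p / 2) + (2 * C1 * Cd)^-1 * m x `^ p.
  apply: (@le_trans _ _ (s N x * m x `^ (p - 2) + s N x `^ (p / 2))).
    rewrite big_split /= lerD//.
      rewrite /s /psum mulr_suml ler_sum// => k _; rewrite mulrC.
      have [Ix|nIx] := pselect (I k x); last by rewrite (md_supp M nIx) expr2 !mul0r.
      rewrite ler_wpM2l ?sqr_ge0//; apply: ge0_ler_powR; rewrite ?nnegrE//; first lra.
      by rewrite -/(psum dd k x) (Hc _ _ Ix); exact: (runmax_ge _ (ltn_ord k)).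
    under eq_bigr do rewrite -powR_half.
    by apply: (powR_superadd_sum (ltW r1)) => i; rewrite sqr_ge0.
  have := HK (s N x) (m x `^ (p - 2)) (s0 _ _) (powR_ge0 _ _).
  rewrite -[in X in _ <= X -> _]powRrM.
  have -> : (p - 2) * r' = p by rewrite /r'; field; rewrite gt_eqF//; lra.
  by lra.
rewrite EFinM -muleA; apply: ereal_absorb.
- by apply: psum_Lp_fin => //; exact: md_Lp M.
- by apply: rint_ge0 => x; exact: powR_ge0.
apply: (le_trans (step N)).
apply: (@le_trans _ _ (C1%:E * ((K + 1)%:E * \rint[nu]_x (s N x `^ (p / 2)) +
   (2 * C1 * Cd)^-1%:E * \rint[nu]_x (m x `^ p)))%E).
  apply: lee_wpmul2l; first by rewrite lee_fin ltW.
  rewrite -!rintZ; side.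
  rewrite -rintD; side.
  apply: rint_le; [by mes|by mes|by move=> x; exact: sumr_ge0|exact: remle].
rewrite ge0_muleDr; last 2 first.
- by rewrite mule_ge0 ?lee_fin ?rint_ge0//; [lra|move=> x; rewrite powR_ge0].
- by rewrite mule_ge0 ?lee_fin ?rint_ge0// ?ltW//; move=> x; rewrite powR_ge0.
rewrite addeC EFinM -muleA; apply: leeD => //.
rewrite muleA -EFinM.
apply: (@le_trans _ _ ((C1 * (2 * C1 * Cd)^-1)%:E * (Cd%:E * \rint[nu]_x (`|psum dd N x| `^ p)))%E).
  by apply: lee_wpmul2l => //; rewrite lee_fin mulr_ge0 ?ltW.
rewrite muleA -EFinM.
have -> // : C1 * (2 * C1 * Cd)^-1 * Cd = 2^-1.
by field; rewrite !gt_eqF.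
Qed.

(** The converse inequality. By the chain rule the [p / 2]-th power of the square
    function [s] is a sum of [b k.+1 * dd k ^+ 2] with [b k] the power
    [p / 2 - 1] of the [k]-th partial square function. If the weight were the
    predictable [b k], orthogonality would turn this sum into [b N * psum N ^+ 2];
    the error [b k.+1 - b k] telescopes against the bound of [dd k] by the maximal
    function. Young's inequality absorbs [b N]. *)
Lemma burkholder_lower (R : realType) (p : R) : 2 < p -> exists2 C : R, 0 < C &
  forall d (T : measurableType d) (nu : {measure set T -> \bar R})
    (I : nat -> set T) (dd : nat -> T -> R) (N : nat),
  martingale_diffs nu p I dd ->
  (\rint[nu]_x (psum (fun k x => dd k x ^+ 2) N x `^ (p / 2)) <=
   C%:E * \rint[nu]_x (`|psum dd N x| `^ p))%E.
Proof.
move=> p2; have p1 : 1 < p by lra.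
have p0 : 0 < p by lra.
have r1 : 1 < p / 2 by lra.
have r0 : 0 < p / 2 by lra.
have r10 : 0 < p / 2 - 1 by lra.
have rr := conj_exponent_def r1; set r' := p / 2 / (p / 2 - 1) in rr.
have [r'1 re _] := conj_exponent r1 rr.
have [Cd Cd0 HD] := doob_maximal p1.
have c0 : 0 < 5 * (p / 2) by lra.
have e0 : 0 < (2 * (5 * (p / 2)))^-1 by rewrite invr_gt0 mulr_gt0.
have [K K0 HK] := young_small r1 rr e0.
have tp0 : 0 < 2 `^ p :> R by rewrite powR_gt0.
exists (2 * (5 * (p / 2) * (K * (2 `^ p * (Cd + 1))))).
  by rewrite !(mulr_gt0, addr_gt0).
move=> d T nu I dd N M.
have mI := md_measurable M; have md := md_mf M; have mp n := mf_psum n md.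
pose s n := psum (fun k x => dd k x ^+ 2) n.
have ms n : measurable_fun setT (s n) by apply: mf_psum => k; mes.
have s0 n x : 0 <= s n x by apply: psum_ge0 => ? ?; rewrite sqr_ge0.
pose b n x := s n x `^ (p / 2 - 1).
have b0 n x : 0 <= b n x by exact: powR_ge0.
have mb n : measurable_fun setT (b n) by rewrite /b; mes.
have bS n x : b n x <= b n.+1 x.
  apply: ge0_ler_powR; rewrite ?nnegrE ?(ltW r10)//.
  by rewrite /s psumS lerDl sqr_ge0.
have [c Hc] := psum_const M.
pose m := runmax I (fun k => `|c k|) N.
have mm : measurable_fun setT m by exact: mf_runmax.
have m0 x : 0 <= m x by exact: runmax_ge0.
pose fs x := m x + `|psum dd N x|.
have fs0 x : 0 <= fs x by rewrite /fs; nneg.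
have mfs : measurable_fun setT fs by rewrite /fs; mes.
have Hfs k x : (k <= N)%N -> `|psum dd k x| <= fs x.
  by move=> kN; exact: (psum_le_max M).
have HM : (\rint[nu]_x (m x `^ p) <= Cd%:E * \rint[nu]_x (`|psum dd N x| `^ p))%E.
  apply: HD => //; [exact: md_tree M|exact: md_finite M|by mes|].
  by move=> k kN; exact: (psum_doob M).
have finS : (\rint[nu]_x (s N x `^ (p / 2)) < +oo)%E.
  have := @psum_Lp_fin _ T R nu (fun k x => dd k x ^+ 2) (p / 2) N r0.
  have E x : `|psum (fun k x => dd k x ^+ 2) N x| = s N x by rewrite ger0_norm.
  rewrite (@eq_rint _ _ _ _ _ (fun x => s N x `^ (p / 2))); last by move=> x; rewrite E.
  apply; first by move=> k; mes.
  move=> k; under eq_rint do rewrite ger0_norm ?sqr_ge0// powR_half.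
  exact: md_Lp M k.
(* Orthogonality of the increments with a predictable increasing weight: the cross
   term has mean zero, and replacing [b n] by [b n.+1] only helps. *)
have orth n : (\rint[nu]_x (\sum_(k < n) b k x * dd k x ^+ 2) <=
               \rint[nu]_x (b n x * psum dd n x ^+ 2))%E.
  elim: n => [|n IH].
    apply: rint_le; [by mes|by mes|by move=> x; rewrite big_ord0|].
    by move=> x; rewrite big_ord0; nneg.
  have -> : \rint[nu]_x (\sum_(k < n.+1) b k x * dd k x ^+ 2) =
     (\rint[nu]_x (\sum_(k < n) b k x * dd k x ^+ 2) +
      \rint[nu]_x (b n x * dd n x ^+ 2))%E.
    rewrite -rintD; side.
    by apply: eq_rint => x; rewrite big_ord_recr.
  apply: (@le_trans _ _ (\rint[nu]_x (b n x * psum dd n x ^+ 2 + b n x * dd n x ^+ 2))).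
    by rewrite rintD; side; rewrite leeD2r.
  apply: (@le_rint_transform _ _ _ _ _ _ _ M n
      (fun x => 2 * b n x * psum dd n x)); [ |by mes|by mes|by nneg|by nneg|].
    move=> x y Ix Iy; rewrite (psum_adapted M (leqnn _) Ix Iy) /b /s /psum.
    congr (_ * _ `^ _ * _); apply: eq_bigr => j _.
    by rewrite (md_adapted M (ltn_ord j) Ix Iy).
  move=> x; apply: (@le_trans _ _ (b n x * psum dd n.+1 x ^+ 2)).
    by rewrite psumS le_eqVlt; apply/orP; left; apply/eqP; ring.
  by rewrite ler_wpM2r ?sqr_ge0.
have bsum x : \sum_(k < N) (b k.+1 x - b k x) = b N x.
  rewrite -(big_mkord xpredT (fun k => b k.+1 x - b k x)) telescope_sumr//.
  by rewrite /b /s psum0 powR0 ?subr0// gt_eqF.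
(* The constant 4 comes from [`|dd k| <= 2 * fs], the difference of two partial
   sums. *)
have bfin x : \sum_(k < N) b k.+1 x * dd k x ^+ 2 <=
    \sum_(k < N) b k x * dd k x ^+ 2 + 4 * (b N x * fs x ^+ 2).
  rewrite -lerBlDl -sumrB.
  have -> : 4 * (b N x * fs x ^+ 2) = \sum_(k < N) (b k.+1 x - b k x) * (4 * fs x ^+ 2).
    by rewrite -mulr_suml bsum; ring.
  apply: ler_sum => k _; rewrite -mulrBl ler_wpM2l ?subr_ge0//.
  have h1 := Hfs k x (ltnW (ltn_ord k)); have h2 := Hfs k.+1 x (ltn_ord k).
  have -> : dd k x = psum dd k.+1 x - psum dd k x by rewrite psumS addrAC subrr add0r.
  rewrite -real_normK ?num_real//.
  have h3 := ler_normB (psum dd k.+1 x) (psum dd k x).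
  have h4 := normr_ge0 (psum dd k.+1 x - psum dd k x).
  have -> : 4 * fs x ^+ 2 = (2 * fs x) ^+ 2 by ring.
  by rewrite ler_sqr ?nnegrE//; have := fs0 x; lra.
have powle x : s N x `^ (p / 2) <= p / 2 * \sum_(k < N) b k.+1 x * dd k x ^+ 2.
  apply: (le_trans (psum_powR_le N r1 (fun k => sqr_ge0 (dd k x)))).
  by rewrite ler_wpM2l ?(ltW r0)//; apply: ler_sum => k _; rewrite mulrC.
have main : (\rint[nu]_x (s N x `^ (p / 2)) <=
    (5 * (p / 2))%:E * \rint[nu]_x (b N x * fs x ^+ 2))%E.
  apply: (@le_trans _ _ (\rint[nu]_x (p / 2 * (\sum_(k < N) b k x * dd k x ^+ 2 +
      4 * (b N x * fs x ^+ 2))))).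
    apply: rint_le; [by mes|by mes|by nneg|] => x.
    by rewrite (le_trans (powle x))// ler_wpM2l ?(ltW r0).
  rewrite rintZ; side.
  have -> : 5 * (p / 2) = p / 2 * 5 by ring.
  rewrite (EFinM (p / 2) 5) -muleA; apply: lee_wpmul2l; first by rewrite lee_fin ltW.
  rewrite rintD; side. rewrite rintZ; side.
  have -> : (5%:E = 1 + 4%:E :> \bar R)%E by rewrite -EFinD; congr EFin; ring.
  rewrite ge0_muleDl ?mul1e ?lee_fin//; apply: leeD => //.
  apply: (le_trans (orth N)); apply: rint_le; [by mes|by mes|by nneg|] => x.
  rewrite ler_wpM2l// -[X in X <= _]real_normK ?num_real// ler_sqr ?nnegrE//.
  exact: Hfs.
have fsle : (\rint[nu]_x (fs x `^ p) <=
    (2 `^ p * (Cd + 1))%:E * \rint[nu]_x (`|psum dd N x| `^ p))%E.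
  apply: (@le_trans _ _ (\rint[nu]_x (2 `^ p * (m x `^ p + `|psum dd N x| `^ p)))).
    apply: rint_le; [by mes|by mes|by nneg|] => x; apply: powRD_le => //; exact: ltW.
  rewrite rintZ; side. rewrite rintD; side.
  rewrite EFinM -muleA; apply: lee_wpmul2l; first by rewrite lee_fin ltW.
  rewrite EFinD ge0_muleDl ?mul1e ?lee_fin ?(ltW Cd0)//; exact: leeD.
rewrite EFinM -muleA; apply: ereal_absorb => //; first by apply: rint_ge0 => x; nneg.
apply: (le_trans main).
apply: (@le_trans _ _ ((5 * (p / 2))%:E * (K%:E * \rint[nu]_x (fs x `^ p) +
   (2 * (5 * (p / 2)))^-1%:E * \rint[nu]_x (s N x `^ (p / 2))))%E).
  apply: lee_wpmul2l; first by rewrite lee_fin ltW.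
  rewrite -!rintZ; side. rewrite -rintD; side.
  apply: rint_le; [by mes|by mes|by nneg|] => x.
  have := HK (fs x ^+ 2) (b N x) (sqr_ge0 _) (b0 _ _).
  by rewrite powR_half (ger0_norm (fs0 _)) -[in X in _ <= X -> _]powRrM re mulrC.
rewrite ge0_muleDr; last 2 first.
- by rewrite mule_ge0 ?lee_fin ?(ltW K0)//; apply: rint_ge0; nneg.
- by rewrite mule_ge0 ?lee_fin ?(ltW e0)//; apply: rint_ge0; nneg.
rewrite addeC; apply: leeD.
  rewrite muleA -EFinM.
  have E : 5 * (p / 2) * (2 * (5 * (p / 2)))^-1 = 2^-1.
    by field; rewrite gt_eqF.
  by rewrite E; exact: lexx.
rewrite [X in (_ <= X%:E * _)%E](_ : _ = 5 * (p / 2) * K * (2 `^ p * (Cd + 1))); last by ring.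
rewrite muleA -EFinM (EFinM (5 * (p / 2) * K)) -muleA; apply: lee_wpmul2l => //.
by rewrite lee_fin mulr_ge0// ltW.
Qed.

(** * Stopping families *)

Section stopping.
Context (T : Type) (R : realType).
Variables (I : nat -> set T) (q : nat -> R).

(** The smallest set of the family containing [I k] among those of index less than
    [n]; in a tree-ordered family the last one is the smallest one. *)
Fixpoint parent_below (n k : nat) : option nat :=
  if n is n'.+1 then if `[< I k `<=` I n' >] then Some n' else parent_below n' k
  else None.
Definition parent k := parent_below k k.

(** Stopping times of the values [q]: going down the tree, a new stopping set is chosen
    when [q] exceeds twice its value at the current stopping set. The set [stop k] is
    the stopping set in force at [k]. The fuel replaces the recursion along
    [parent], whose value is smaller than its argument. *)
Fixpoint stop_fuel (fuel k : nat) : nat :=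
  if fuel is f.+1 then
    if parent k is Some j then
      if q k <= 2 * q (stop_fuel f j) then stop_fuel f j else k
    else k
  else k.
Definition stop k := stop_fuel k.+1 k.

Lemma parent_some k j : parent k = Some j ->
  [/\ (j < k)%N, I k `<=` I j & forall i, (j < i < k)%N -> ~ (I k `<=` I i)].
Proof.
rewrite /parent => H.
suff : forall n, parent_below n k = Some j ->
   [/\ (j < n)%N, I k `<=` I j & forall i, (j < i < n)%N -> ~ (I k `<=` I i)] by apply.
elim=> //= n IH; case: asboolP => [kn [<-]|kn /IH[jn kj H1]].
  by split => // i /andP[ni]; rewrite ltnS leqNgt ni.
split=> //; first exact: ltnW.
move=> i /andP[ji]; rewrite ltnS leq_eqVlt => /predU1P[->//|i_n].
by apply: H1; rewrite ji.
Qed.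

Lemma parent_none k : parent k = None -> forall j, (j < k)%N -> ~ (I k `<=` I j).
Proof.
rewrite /parent => H.
suff : forall n, parent_below n k = None -> forall j, (j < n)%N -> ~ (I k `<=` I j) by apply.
elim=> //= n IH; case: asboolP => // kn /IH H1 j.
by rewrite ltnS leq_eqVlt => /predU1P[->//|/H1].
Qed.

Lemma stop_fuelE f k : (k < f)%N -> stop_fuel f k = stop k.
Proof.
suff H n : forall f g k, (k < n)%N -> (k < f)%N -> (k < g)%N ->
    stop_fuel f k = stop_fuel g k.
  by move=> kf; apply: (H k.+1).
elim: n => // n IH {}f g {}k; rewrite ltnS => kn; case: f => // f kf; case: g => // g kg /=.
case E : (parent k) => [j|//].
have [jk _ _] := parent_some E.
by rewrite (IH f g j) ?(leq_trans jk).
Qed.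

Lemma stopE k : stop k =
  if parent k is Some j then if q k <= 2 * q (stop j) then stop j else k else k.
Proof.
rewrite /stop /=; case E : (parent k) => [j|//].
by have [jk _ _] := parent_some E; rewrite stop_fuelE.
Qed.

Lemma stop_cases k : stop k = k \/
  exists j, [/\ parent k = Some j, stop k = stop j & q k <= 2 * q (stop j)].
Proof.
rewrite stopE; case E : (parent k) => [j|]; last by left.
by case: ifPn => h; [right; exists j|left].
Qed.

(** Induction along the part of the branch of [k] that lies below its stopping set. *)
Lemma stop_ind (P : nat -> Prop) :
  (forall k, stop k = k -> P k) ->
  (forall k j, parent k = Some j -> stop k = stop j -> P j -> P k) ->
  forall k, P k.
Proof.
move=> P0 PS; elim/ltn_ind => k IH.
have [/P0//|[j [kj e _]]] := stop_cases k.
by have [jk _ _] := parent_some kj; apply: (PS k j) => //; exact: IH.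
Qed.

Lemma stop_le k : (stop k <= k)%N.
Proof.
elim/stop_ind: k => [k ->//|k j /parent_some[jk _ _] -> /leq_trans]; apply.
exact: ltnW.
Qed.

Lemma stop_sub k : I k `<=` I (stop k).
Proof.
elim/stop_ind: k => [k ->//|k j /parent_some[_ kj _] -> ]; exact: subset_trans.
Qed.

Lemma stopK k : stop (stop k) = stop k.
Proof. by elim/stop_ind: k => [k e|k j _ ->//]; rewrite !e. Qed.

Hypothesis q0 : forall k, 0 <= q k.

Lemma stop_double k : q k <= 2 * q (stop k).
Proof.
have [->|[j [_ -> //]]] := stop_cases k.
by have := q0 k; lra.
Qed.

Hypothesis tI : tree_ordered I.

(** At the stopping sets through one point the values [q] at least double, so that
    their powers are dominated by a geometric series, that is by twice the largest
    one. The invariant of the induction records the last set containing [x], whose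
    stopping set carries this largest value. *)
Lemma stop_sum s n x (Y : R) : 1 <= s -> 0 <= Y ->
  (forall k, (k < n)%N -> I k x -> q k `^ s <= Y) ->
  \sum_(i < n | stop i == i :> nat) q i `^ s * \1_(I i) x <= 2 * Y.
Proof.
move=> s1 Y0 HY.
(* The invariant for the first [m] sets; [j] is the last of them that contains [x]. *)
suff H m : (forall j, (j < m)%N -> ~ I j x) /\
      \sum_(i < m | stop i == i :> nat) q i `^ s * \1_(I i) x = 0 \/
    exists j, [/\ (j < m)%N, I j x, forall i, (j < i < m)%N -> ~ I i x &
      \sum_(i < m | stop i == i :> nat) q i `^ s * \1_(I i) x <= 2 * q (stop j) `^ s].
  have [[_ ->]|[j [jn Ij _ /le_trans]]] := H n; first by rewrite mulr_ge0.
  apply; rewrite ler_wpM2l// HY//; first exact: leq_ltn_trans (stop_le j) jn.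
  exact: stop_sub Ij.
have notin i : ~ I i x -> q i `^ s * \1_(I i) x = 0.
  by move=> nI; rewrite indicE memNset// mulr0.
have isin i : I i x -> q i `^ s * \1_(I i) x = q i `^ s.
  by move=> Ix; rewrite indicE mem_set// mulr1.
elim: m => [|m IH]; first by left; rewrite big_ord0; split.
have [Ix|nIx] := pselect (I m x); last first.
  have -> : \sum_(i < m.+1 | stop i == i :> nat) q i `^ s * \1_(I i) x =
    \sum_(i < m | stop i == i :> nat) q i `^ s * \1_(I i) x.
    by rewrite big_mkcond big_ord_recr -big_mkcond /= notin// if_same addr0.
  case: IH => [[H1 H2]|[j [jm Ij Hj Hs]]]; [left|right; exists j]; split => //.
  - by move=> j; rewrite ltnS leq_eqVlt => /predU1P[->//|]; exact: H1.
  - exact: leq_trans jm (leqnSn m).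
  - move=> i /andP[ji]; rewrite ltnS leq_eqVlt => /predU1P[->//|im].
    by apply: Hj; rewrite ji.
right; exists m; split => //.
  by move=> i /andP[mi]; rewrite ltnS leqNgt mi.
have -> : \sum_(i < m.+1 | stop i == i :> nat) q i `^ s * \1_(I i) x =
    \sum_(i < m | stop i == i :> nat) q i `^ s * \1_(I i) x +
    (if stop m == m then q m `^ s else 0).
  by rewrite big_mkcond big_ord_recr -big_mkcond /= isin.
case: IH => [[H1 ->]|[j [jm Ij Hj Hs]]].
  rewrite add0r (stopE m); case E : (parent m) => [j|].
    by have [jm /(_ _ Ix) Ij _] := parent_some E; have := H1 _ jm.
  by rewrite eqxx; have := powR_ge0 (q m) s; lra.
(* The sets through [x] are nested, so that the last one before [m] is the parent. *)
have pm : parent m = Some j.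
  have sub : I m `<=` I j by case: (tI jm) => // /(_ x Ix).
  case E : (parent m) => [i|]; last by have := parent_none E jm.
  have [im /(_ x Ix) Iix Hi] := parent_some E.
  have [ij|ji|->//] := ltngtP i j.
    by exfalso; apply: (Hi j) => //; rewrite ij.
  by exfalso; apply: (Hj i) => //; rewrite ji.
rewrite (stopE m) pm; case: (leP (q m) (2 * q (stop j))) => h.
  have /negbTE-> : stop j != m.
    by rewrite neq_ltn (leq_ltn_trans (stop_le j) jm).
  by rewrite addr0.
rewrite eqxx; apply: (@le_trans _ _ (2 * q (stop j) `^ s + q m `^ s)).
  by rewrite lerD2r.
suff : 2 * q (stop j) `^ s <= q m `^ s by lra.
apply: (@le_trans _ _ ((2 * q (stop j)) `^ s)).
  by rewrite powRM// ler_wpM2r ?powR_ge0// le1r_powR//; lra.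
by apply: ge0_ler_powR; rewrite ?nnegrE ?mulr_ge0//; [lra|exact: ltW].
Qed.

End stopping.

(** A second stopping family, for values that depend only on the first stopping set,
    does not distinguish a set from its first stopping set. *)
Lemma stop_refine (T : Type) (R : realType) (I : nat -> set T) (q z : nat -> R) k :
  (forall k, 0 <= z k) ->
  let F := stop I q in let H := stop I (fun k => z (F k)) in H (F k) = H k.
Proof.
move=> z0 F H.
elim/(stop_ind (I := I) (q := q)): k => [k e|k j kj e IH]; first by rewrite /F e.
have FE : F k = F j by [].
rewrite FE IH /H [RHS]stopE kj -/H FE.
by have := @stop_double _ _ I (fun k => z (F k)) (fun k => z0 _) j; rewrite -/H => ->.
Qed.

(** * The positive operator *)

Lemma sum_by_stop (R : realType) (F : nat -> nat) (N : nat) (h : nat -> nat -> R) :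
  (forall k, (F k <= k)%N) -> (forall k, F (F k) = F k) ->
  \sum_(k < N) h (F k) k =
  \sum_(i < N | F i == i :> nat) \sum_(k < N | F k == i :> nat) h i k.
Proof.
move=> Fle FK; rewrite (exchange_big_dep xpredT) //=; apply: eq_bigr => k _.
have lt : (F k < N)%N := leq_ltn_trans (Fle k) (ltn_ord k).
rewrite (big_pred1 (Ordinal lt))// => i /=; apply/andP/eqP => [[_ /eqP e]|->].
  by apply/val_inj => /=.
by rewrite /= FK.
Qed.

Lemma ler_sum_pred (R : realType) (N : nat) (P Q : pred nat) (h : nat -> R) :
  (forall k, 0 <= h k) -> (forall k, P k -> Q k) ->
  \sum_(k < N | P k) h k <= \sum_(k < N | Q k) h k.
Proof.
move=> h0 PQ; rewrite big_mkcond [X in _ <= X]big_mkcond; apply: ler_sum => k _.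
by case: ifPn => [/PQ ->//|_]; case: ifPn.
Qed.

(** The two weight theorem for a positive dyadic operator, at the level of a finite
    family: the sums of the functions [w k] below a set need only be controlled in
    [L^r(nu)], and the sums of their densities [al k] in [L^r'(mu)].

    With [S] the partial sums of [q k * w k] and [Z] their [(r - 1)]-st powers, the
    chain rule bounds the left-hand side by the sum of [q k * w k * Z k.+1]. Let [F]
    be the stopping family of [q]. On [I k] the value [Z k.+1] is at most its value
    [ze k] on entering [F k] plus the increments [u] that occurred in the part of the
    tree attached to [F k], which splits the sum into two.

    For the increments the sums [W] of [w] attached to a stopping set come together:
    Young's inequality separates [W], to which the first testing condition applies,
    from [u], whose powers add up to at most the left-hand side. For the constants
    [ze k] nothing but [w k] depends on the point, so that [nu] can be replaced by
    [mu] at the cost of the factors [al k]; a second stopping family [H] for the values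
    [ze] then plays the role of [F], with the second testing condition. In both
    cases the stopping values are summable by the doubling property and the maximal
    inequality. What is left of the left-hand side is absorbed. *)
Lemma positive_testing (R : realType) (r r' : R) : 1 < r -> r^-1 + r'^-1 = 1 ->
  exists2 C : R, 0 < C &
  forall d (T : measurableType d) (mu nu : {measure set T -> \bar R})
    (I : nat -> set T) (w : nat -> T -> R) (f : T -> R) (q al : nat -> R)
    (D : R) (N : nat),
  tree_ordered I -> (forall k, measurable (I k)) ->
  (forall k, (mu (I k) < +oo)%E) -> (forall k, (nu (I k) < +oo)%E) ->
  (forall k, measurable_fun setT (w k)) -> (forall k x, 0 <= w k x) ->
  (forall k x, ~ I k x -> w k x = 0) ->
  (forall j k x y, (j < k)%N -> I k x -> I k y -> w j x = w j y) ->
  (forall k, (\rint[nu]_x (w k x `^ r) < +oo)%E) ->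
  measurable_fun setT f -> (forall x, 0 <= f x) -> (forall k, 0 <= q k) ->
  (forall k, (k < N)%N ->
     ((q k)%:E * mu (I k) <= \rint[mu]_x (f x * \1_(I k) x))%E) ->
  (forall k, 0 <= al k) -> (forall k, rint nu (w k) = ((al k)%:E * mu (I k))%E) ->
  0 < D ->
  (forall i, (i < N)%N ->
     (\rint[nu]_x ((\sum_(k < N | `[< I k `<=` I i >]) w k x) `^ r) <=
      (D `^ r)%:E * mu (I i))%E) ->
  (forall i, (i < N)%N ->
     (\rint[mu]_x ((\sum_(k < N | `[< I k `<=` I i >]) al k * \1_(I k) x) `^ r') <=
      (D `^ r')%:E * nu (I i))%E) ->
  (\rint[nu]_x (psum (fun k x => q k * w k x) N x `^ r) <=
   (C * D `^ r)%:E * \rint[mu]_x (f x `^ r))%E.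
Proof.
move=> r1 rr; have [r'1 re re'] := conj_exponent r1 rr.
have r0 : 0 < r by lra.
have r'0 : 0 < r' by lra.
have r10 : 0 < r - 1 by lra.
have [Cd Cd0 HD] := doob_maximal r1.
(* The term to be absorbed occurs with the factor [t] in the first part and [4 * t]
   in the second, after a multiplication by [2 * r]: [2 * r * (t + 4 * t) = 2^-1]. *)
have t0 : 0 < (20 * r)^-1 by rewrite invr_gt0 mulr_gt0.
have [s sp st] := powR_choose t0 r'0.
set t := (20 * r)^-1 in t0 st.
have spr : 0 < s `^ r by rewrite powR_gt0.
exists (24 * r * Cd * s `^ r); first by rewrite !mulr_gt0.
move=> d T mu nu I w f q al D N tI mI fmu fnu mw w0 wsupp wad wfin mf f0 q0 Hq al0 wal D0 T1 T2.
pose X k x := q k * w k x.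
have X0 k x : 0 <= X k x by rewrite /X; nneg.
have mX k : measurable_fun setT (X k) by rewrite /X; mes.
pose S n := psum X n.
have mS n : measurable_fun setT (S n) by exact: mf_psum.
have S0 n x : 0 <= S n x by exact: psum_ge0.
pose Z n x := S n x `^ (r - 1).
have mZ n : measurable_fun setT (Z n) by rewrite /Z; mes.
have Z0 n x : 0 <= Z n x by exact: powR_ge0.
have Zmono n m x : (n <= m)%N -> Z n x <= Z m x.
  move=> nm; apply: ge0_ler_powR; rewrite ?nnegrE ?(ltW r10)//.
  exact: psum_mono.
have Znil x : Z 0 x = 0 by rewrite /Z /S psum0 powR0// gt_eqF.
pose de k x := Z k.+1 x - Z k x.
have de0 k x : 0 <= de k x by rewrite subr_ge0 Zmono.
have mde k : measurable_fun setT (de k) by rewrite /de; mes.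
have desupp k x : ~ I k x -> de k x = 0.
  by move=> nI; rewrite /de /Z /S psumS /X (wsupp _ _ nI) mulr0 addr0 subrr.
have Zad n k x y : (n <= k)%N -> I k x -> I k y -> Z n x = Z n y.
  move=> nk Ix Iy; congr (_ `^ _); apply: eq_bigr => j _; rewrite /X.
  by rewrite (wad _ _ x y (leq_trans (ltn_ord j) nk)).
have [z z0 Hz] : exists2 z : nat -> R, (forall i, 0 <= z i) & forall i x, I i x -> Z i x = z i.
  have H i : exists c, forall x, I i x -> Z i x = c.
    by apply: (const_on 0) => x y; exact: Zad.
  have [c Hc] := choice H; exists (fun i => `|c i|) => [i|i x Ix]; first exact: normr_ge0.
  by rewrite -(Hc i x Ix) ger0_norm.
pose F := stop I q.
have FK k : F (F k) = F k by exact: stopK.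
have Fle k : (F k <= k)%N by exact: stop_le.
have Fsub k : I k `<=` I (F k) by exact: stop_sub.
pose ze k := z (F k).
have ze0 k : 0 <= ze k by exact: z0.
pose H := stop I ze.
have HK k : H (H k) = H k by exact: stopK.
have Hle k : (H k <= k)%N by exact: stop_le.
have Hsub k : I k `<=` I (H k) by exact: stop_sub.
have HF k : H (F k) = H k by exact: stop_refine.
pose u i x := \sum_(k < N | F k == i :> nat) de k x.
have u0 i x : 0 <= u i x by apply: sumr_ge0.
have mu_ i : measurable_fun setT (u i) by rewrite /u; mes.
(* All the sets between [F k] and [I k] have the stopping set [F k], so that the
   growth of [Z] since the entrance into [F k] is contained in [u (F k)]. *)
have Zu k x : (k < N)%N -> I k x -> Z k.+1 x <= ze k + u (F k) x.
  move=> kN Ix.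
  apply: (@le_trans _ _ (ze k + \sum_(i < k.+1 | F i == F k :> nat) de i x)); last first.
    rewrite lerD2l /u (big_ord_widen_cond N (fun i => F i == F k) (fun i => de i x))//.
    by apply: (@ler_sum_pred _ N (fun i => (F i == F k) && (i < k.+1)%N) (fun i => F i == F k)
      (fun i => de i x)) => // i /andP[].
  have E n i : \sum_(j < n.+1 | F j == i :> nat) de j x =
      \sum_(j < n | F j == i :> nat) de j x + (if F n == i then de n x else 0).
    by rewrite big_mkcond big_ord_recr -big_mkcond.
  rewrite E eqxx; have -> : Z k.+1 x = Z k x + de k x by rewrite /de addrC subrK.
  rewrite [leRHS]addrA lerD2r; clear kN.
  move: Ix; elim/(stop_ind (I := I) (q := q)): k => [k e|k j kj e IH] Ix.
    by rewrite /ze /F e (Hz k x Ix) lerDl sumr_ge0.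
  have [jk sub btw] := parent_some kj.
  have Fe : F k = F j by [].
  have ZE n : (j < n)%N -> (n <= k)%N -> Z n x = Z j.+1 x.
    elim: n => // n IHn; rewrite ltnS leq_eqVlt => /predU1P[->//|jn nk].
    rewrite -(IHn jn (ltnW nk)); have : de n x = 0; last by rewrite /de; lra.
    apply: desupp; case: (tI _ _ nk) => [sub'|]; last exact.
    by exfalso; apply: (btw n) => //; rewrite jn.
  rewrite (ZE k jk (leqnn k)).
  have Ij := sub _ Ix; have := IH Ij.
  have -> : Z j.+1 x = Z j x + de j x by rewrite /de addrC subrK.
  rewrite /ze Fe => IH'.
  have : \sum_(i < j.+1 | F i == F j :> nat) de i x <=
         \sum_(i < k | F i == F j :> nat) de i x.
    rewrite (big_ord_widen_cond k (fun i => F i == F j) (fun i => de i x))//.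
    by apply: (@ler_sum_pred _ k (fun i => (F i == F j) && (i < j.+1)%N) (fun i => F i == F j)
      (fun i => de i x)) => // i /andP[].
  by rewrite E eqxx; lra.
have uZ x : \sum_(i < N) u i x `^ r' <= S N x `^ r.
  have -> : S N x `^ r = Z N x `^ r' by rewrite /Z -powRrM re.
  apply: le_trans (powR_superadd_sum (ltW r'1) (fun i => u0 i x)) _.
  apply: ge0_ler_powR; rewrite ?nnegrE ?(ltW r'0)//; first by apply: sumr_ge0.
  have -> : Z N x = \sum_(k < N) de k x.
    rewrite -(big_mkord xpredT (fun k => de k x)) telescope_sumr//.
    by rewrite Znil subr0.
  rewrite (sum_by_stop (F := F) N (fun _ k => de k x))// [leRHS]big_mkcond.
  apply: ler_sum => i _; case: ifPn => // Fi; rewrite /u big_pred0// => k.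
  by apply/negbTE; apply: contra Fi => /eqP <-; rewrite FK.
pose G := \rint[nu]_x (S N x `^ r).
pose E := \rint[mu]_x (f x `^ r).
have Gfin : (G < +oo)%E.
  rewrite /G (@eq_rint _ _ _ _ _ (fun x => `|S N x| `^ r)); last by move=> x; rewrite ger0_norm.
  apply: psum_Lp_fin; [exact: r0|exact: mX|] => k.
  rewrite (@eq_rint _ _ _ _ _ (fun x => q k `^ r * w k x `^ r)); last first.
    by move=> x; rewrite ger0_norm// powRM.
  rewrite rintZ; [|by mes|by nneg|exact: powR_ge0].
  by apply: lte_mul_pinfty; [rewrite lee_fin powR_ge0| |exact: wfin].
(* The stopping values double along a branch, so that their powers are dominated by
   the maximal function of the averages. *)
have carlF : (\rint[mu]_x (\sum_(i < N | F i == i :> nat) q i `^ r * \1_(I i) x) <=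
    (2 * Cd)%:E * E)%E.
  pose m := runmax I q N.
  have mm : measurable_fun setT m by exact: mf_runmax.
  have m0 x : 0 <= m x by exact: runmax_ge0.
  apply: (@le_trans _ _ (\rint[mu]_x (2 * m x `^ r))).
    apply: rint_le; [by mes|by mes|by nneg|] => x.
    apply: (stop_sum q0 tI (ltW r1)); first exact: powR_ge0.
    move=> k kN Ix; apply: ge0_ler_powR; rewrite ?nnegrE ?(ltW r0)//.
    exact: runmax_ge.
  rewrite rintZ; [|by mes|by nneg|by []].
  rewrite EFinM -muleA; apply: lee_wpmul2l; first by rewrite lee_fin.
  exact: HD.
(* The same for the stopping values of [ze], which are at most [Z N]. *)
have carlH : (\rint[nu]_x (\sum_(i < N | H i == i :> nat) ze i `^ r' * \1_(I i) x) <=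
    2%:E * G)%E.
  rewrite -rintZ; side.
  apply: rint_le; [by mes|by mes|by nneg|] => x.
  apply: (stop_sum ze0 tI (ltW r'1)); first exact: powR_ge0.
  move=> k kN Ix; have -> : S N x `^ r = Z N x `^ r' by rewrite /Z -powRrM re.
  apply: ge0_ler_powR; rewrite ?nnegrE ?(ltW r'0)//.
  rewrite /ze -(Hz _ x (Fsub k x Ix)); apply: Zmono.
  exact: leq_trans (Fle k) (ltnW kN).
pose W i x := \sum_(k < N | F k == i :> nat) w k x.
have W0 i x : 0 <= W i x by apply: sumr_ge0.
have mW i : measurable_fun setT (W i) by rewrite /W; mes.
pose A1 x := \sum_(k < N) q (F k) * (w k x * u (F k) x).
pose A2 x := \sum_(k < N) q (F k) * ze k * w k x.
have A10 x : 0 <= A1 x by rewrite /A1; nneg.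
have A20 x : 0 <= A2 x by rewrite /A2; nneg.
have mA1 : measurable_fun setT A1 by rewrite /A1; mes.
have mA2 : measurable_fun setT A2 by rewrite /A2; mes.
have split_S x : S N x `^ r <= 2 * r * (A1 x + A2 x).
  apply: (@le_trans _ _ (r * \sum_(k < N) X k x * Z k.+1 x)).
    exact: (psum_powR_le N r1 (fun k => X0 k x)).
  rewrite [2 * r]mulrC -mulrA ler_wpM2l ?(ltW r0)// mulrDr /A1 /A2 !mulr_sumr -big_split /=.
  apply: ler_sum => k _.
  have [Ix|nIx] := pselect (I k x); last first.
    by rewrite /X (wsupp _ _ nIx) !(mulr0, mul0r) addr0.
  have h1 := Zu k x (ltn_ord k) Ix.
  have h2 : q k <= 2 * q (F k) by exact: stop_double.
  have h3 : X k x * Z k.+1 x <= (2 * q (F k) * w k x) * (ze k + u (F k) x).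
    by apply: ler_pM => //; rewrite /X ler_wpM2r.
  by apply: (le_trans h3); rewrite le_eqVlt; apply/orP; left; apply/eqP; ring.
(* The set [I i] contains all the sets attached to it, so that [W i] is at most the
   sum in the first testing condition. *)
have part1 : (rint nu A1 <= (s `^ r * D `^ r * (2 * Cd))%:E * E + t%:E * G)%E.
  have A1le x : A1 x <= \sum_(i < N | F i == i :> nat) s `^ r * q i `^ r * W i x `^ r +
      t * S N x `^ r.
    have -> : A1 x = \sum_(i < N | F i == i :> nat) q i * W i x * u i x.
      rewrite /A1 (sum_by_stop (F := F) N (fun i k => q i * (w k x * u i x)))//.
      apply: eq_bigr => i _.
      have -> : q i * W i x * u i x = (u i x * q i) * W i x by ring.
      by rewrite [RHS]mulr_sumr; apply: eq_bigr => k _; ring.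
    apply: (@le_trans _ _ (\sum_(i < N | F i == i :> nat) (s `^ r * q i `^ r * W i x `^ r +
        t * u i x `^ r'))).
      apply: ler_sum => i _.
      have := young_scaled r1 rr sp (mulr_ge0 (q0 i) (W0 i x)) (u0 i x).
      by rewrite st powRM// mulrA.
    rewrite big_split lerD2l -mulr_sumr ler_wpM2l ?(ltW t0)//.
    apply: le_trans (uZ x).
    by apply: (@ler_sum_pred _ N (fun i => F i == i) xpredT (fun i => u i x `^ r')) => // i; exact: powR_ge0.
  apply: (@le_trans _ _ (\rint[nu]_x (\sum_(i < N | F i == i :> nat) s `^ r * q i `^ r * W i x `^ r +
      t * S N x `^ r))).
    by apply: rint_le; [by mes|by mes|by []|].
  rewrite rintD; side. rewrite [X in (_ + X)%E]rintZ; side.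
  apply: leeD => //.
  rewrite rint_sum; side.
  apply: (@le_trans _ _ ((s `^ r * D `^ r)%:E *
     \rint[mu]_x (\sum_(i < N | F i == i :> nat) q i `^ r * \1_(I i) x))%E); last first.
    rewrite (EFinM (s `^ r * D `^ r)) -muleA; apply: lee_wpmul2l => //.
    by rewrite lee_fin; nneg.
  rewrite [X in (_ <= _ * X)%E]rint_sum; side.
  rewrite ge0_sume_distrr; last by move=> i _; apply: rint_ge0; nneg.
  apply: lee_sum => i _; rewrite rintZ; side.
  rewrite rint_indic ?powR_ge0//.
  apply: (@le_trans _ _ ((s `^ r * q i `^ r)%:E * ((D `^ r)%:E * mu (I i)))%E).
    apply: lee_wpmul2l; first by rewrite lee_fin; nneg.
    apply: le_trans (T1 i (ltn_ord i)).
    apply: rint_le; [by mes|by mes|by nneg|] => x.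
    apply: ge0_ler_powR; rewrite ?nnegrE ?(ltW r0)//; first exact: sumr_ge0.
    apply: (@ler_sum_pred _ N (fun k => F k == i) (fun k => `[< I k `<=` I i >]) (fun k => w k x)) => //.
    by move=> k /eqP <-; apply/asboolP; exact: Fsub.
  by rewrite !muleA -!EFinM mulrAC.
(* A set [k] is attached to [F k], which is attached to [H k]. The stopping values
   [q i] attached to [m] enter through [Ph m], the sum of their [r]-th powers; it
   majorizes [q (F k) `^ r] on [I k]. *)
have part2 : (rint nu A2 <= (s `^ r * D `^ r * (4 * Cd))%:E * E + (4 * t)%:E * G)%E.
  pose Y m x := \sum_(k < N | H k == m :> nat) al k * \1_(I k) x.
  have Y0 m x : 0 <= Y m x by apply: sumr_ge0 => k _; rewrite mulr_ge0.
  have mY m : measurable_fun setT (Y m) by rewrite /Y; mes.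
  pose Ph m x := \sum_(i < N | (F i == i :> nat) && (H i == m :> nat)) q i `^ r * \1_(I i) x.
  have Ph0 m x : 0 <= Ph m x by apply: sumr_ge0 => k _; rewrite mulr_ge0 ?powR_ge0.
  have mPh m : measurable_fun setT (Ph m) by rewrite /Ph; mes.
  have A2E : rint nu A2 = \rint[mu]_x (\sum_(k < N) q (F k) * ze k * al k * \1_(I k) x).
    rewrite /A2 !rint_sum; side. apply: eq_bigr => k _.
    by rewrite rintZ ?wal ?rint_indic; side; rewrite muleA.
  rewrite A2E.
  have A2le x : \sum_(k < N) q (F k) * ze k * al k * \1_(I k) x <=
     2 * (s `^ r * D `^ r * \sum_(i < N | F i == i :> nat) q i `^ r * \1_(I i) x +
       t * D `^ (- r') * \sum_(m < N | H m == m :> nat) ze m `^ r' * Y m x `^ r').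
    apply: (@le_trans _ _ (2 * \sum_(m < N | H m == m :> nat) Ph m x `^ r^-1 * (ze m * Y m x))).
      have -> : \sum_(m < N | H m == m :> nat) Ph m x `^ r^-1 * (ze m * Y m x) =
         \sum_(k < N) Ph (H k) x `^ r^-1 * (ze (H k) * (al k * \1_(I k) x)).
        rewrite (sum_by_stop (F := H) N
          (fun m k => Ph m x `^ r^-1 * (ze m * (al k * \1_(I k) x))))//.
        by apply: eq_bigr => m _; rewrite /Y !mulr_sumr.
      rewrite mulr_sumr; apply: ler_sum => k _.
      have [Ix|nIx] := pselect (I k x); last by rewrite indicE memNset// !mulr0.
      rewrite indicE mem_set// !mulr1.
      have h1 : ze k <= 2 * ze (H k) by exact: stop_double.
      have h2 : q (F k) <= Ph (H k) x `^ r^-1.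
        have -> : q (F k) = (q (F k) `^ r) `^ r^-1.
          by rewrite -powRrM mulfV ?gt_eqF// powRr1.
        apply: ge0_ler_powR; rewrite ?nnegrE ?invr_ge0 ?powR_ge0 ?(ltW r0)//.
        have lt := leq_ltn_trans (Fle k) (ltn_ord k).
        rewrite /Ph (bigD1 (Ordinal lt)) /=; last by rewrite FK HF !eqxx.
        rewrite indicE mem_set; last exact: Fsub.
        by rewrite mulr1 lerDl sumr_ge0// => i _; rewrite mulr_ge0 ?powR_ge0.
      have h3 : q (F k) * ze k <= Ph (H k) x `^ r^-1 * (2 * ze (H k)) by exact: ler_pM.
      rewrite (le_trans (ler_wpM2r (al0 k) h3))// le_eqVlt; apply/orP; left; apply/eqP; ring.
    rewrite ler_wpM2l//.
    have -> : \sum_(i < N | F i == i :> nat) q i `^ r * \1_(I i) x =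
       \sum_(m < N | H m == m :> nat) Ph m x.
      rewrite (exchange_big_dep (fun i : 'I_N => F i == i :> nat)) /=; last by move=> ? ? _ /andP[].
      apply: eq_bigr => i /= Fi.
      have lt := leq_ltn_trans (Hle i) (ltn_ord i).
      rewrite (big_pred1 (Ordinal lt))// => m /=; apply/andP/eqP => [[_ /andP[_ /eqP e]]|->].
        by apply/val_inj => /=.
      by rewrite /= HK Fi !eqxx.
    rewrite !mulr_sumr -big_split; apply: ler_sum => m _ /=.
    have sD0 : 0 < s * D by exact: mulr_gt0.
    have := young_scaled r1 rr sD0 (powR_ge0 (Ph m x) r^-1) (mulr_ge0 (ze0 m) (Y0 m x)).
    rewrite -[(_ `^ r^-1) `^ r]powRrM mulVf ?gt_eqF// powRr1//.
    rewrite (powRM _ (ze0 m) (Y0 m x)) (powRM r (ltW sp) (ltW D0)).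
    by rewrite (powRM (- r') (ltW sp) (ltW D0)) st.
  apply: (@le_trans _ _ (\rint[mu]_x (2 * (s `^ r * D `^ r * \sum_(i < N | F i == i :> nat) q i `^ r * \1_(I i) x +
       t * D `^ (- r') * \sum_(m < N | H m == m :> nat) ze m `^ r' * Y m x `^ r')))).
    by apply: rint_le; [by mes|by mes|by nneg|].
  rewrite rintZ; side. rewrite rintD; side.
  rewrite [X in (_ * (X + _))%E]rintZ; side. rewrite [X in (_ * (_ + X))%E]rintZ; side.
  have b1 : (\rint[mu]_x (\sum_(m < N | H m == m :> nat) ze m `^ r' * Y m x `^ r') <=
      (2 * D `^ r')%:E * G)%E.
    apply: (@le_trans _ _ ((D `^ r')%:E *
        \rint[nu]_x (\sum_(i < N | H i == i :> nat) ze i `^ r' * \1_(I i) x))%E); last first.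
      by rewrite mulrC EFinM -muleA; apply: lee_wpmul2l; rewrite ?lee_fin ?powR_ge0.
    rewrite rint_sum; side. rewrite rint_sum; side.
    rewrite ge0_sume_distrr; last by move=> i _; apply: rint_ge0; nneg.
    apply: lee_sum => m _; rewrite rintZ; side. rewrite rint_indic ?powR_ge0//.
    rewrite muleCA; apply: lee_wpmul2l; first by rewrite lee_fin powR_ge0.
    apply: le_trans (T2 m (ltn_ord m)).
    apply: rint_le; [by mes|by mes|by nneg|] => x.
    apply: ge0_ler_powR; rewrite ?nnegrE ?(ltW r'0)//; first by apply: sumr_ge0 => k _; rewrite mulr_ge0.
    apply: (@ler_sum_pred _ N (fun k => H k == m) (fun k => `[< I k `<=` I m >])
      (fun k => al k * \1_(I k) x)).
      by move=> k; rewrite mulr_ge0.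
    by move=> k /eqP <-; apply/asboolP; exact: Hsub.
  have Ege0 : (0 <= E)%E by apply: rint_ge0; nneg.
  have Gge0 : (0 <= G)%E by apply: rint_ge0; nneg.
  apply: (@le_trans _ _ (2%:E * ((s `^ r * D `^ r)%:E * ((2 * Cd)%:E * E) +
     (t * D `^ (- r'))%:E * ((2 * D `^ r')%:E * G)))%E).
    by apply: lee_wpmul2l => //; apply: leeD; apply: lee_wpmul2l => //; rewrite lee_fin; nneg.
  rewrite ge0_muleDr ?mule_ge0 ?lee_fin ?mulr_ge0 ?powR_ge0 ?(ltW t0) ?(ltW Cd0)//.
  rewrite !muleA -!EFinM.
  have -> : 2 * (s `^ r * D `^ r) * (2 * Cd) = s `^ r * D `^ r * (4 * Cd) by ring.
  have -> // : 2 * (t * D `^ (- r')) * (2 * D `^ r') = 4 * t.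
  by rewrite powRN; field; rewrite gt_eqF// powR_gt0.
have Ege0 : (0 <= E)%E by apply: rint_ge0; nneg.
have Gge0 : (0 <= G)%E by apply: rint_ge0; nneg.
have GA : (G <= (2 * r)%:E * (rint nu A1 + rint nu A2))%E.
  rewrite -rintD// -rintZ; side.
  by apply: rint_le; [by mes|by mes|by nneg|].
have Dr0 : 0 < D `^ r by rewrite powR_gt0.
have tE : t = (20 * r)^-1 by [].
suff arith (g' e' : \bar R) a1 a2 : (g' < +oo)%E -> (0 <= g')%E -> (0 <= e')%E ->
    (a1 <= (s `^ r * D `^ r * (2 * Cd))%:E * e' + t%:E * g')%E ->
    (a2 <= (s `^ r * D `^ r * (4 * Cd))%:E * e' + (4 * t)%:E * g')%E ->
    (g' <= (2 * r)%:E * (a1 + a2))%E ->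
    (g' <= (24 * r * Cd * s `^ r * D `^ r)%:E * e')%E.
  exact: arith Gfin Gge0 Ege0 part1 part2 GA.
clear -r1 r0 Cd0 t0 spr Dr0 tE.
case: g' => // g _ g0; case: e' => [e| |]//; last first.
  by move=> _ _ _ _; rewrite gt0_muley ?leey// lte_fin !mulr_gt0.
rewrite !lee_fin => e0; rewrite -!EFinM -!EFinD => h1 h2 h3.
have {h1 h2} := leeD h1 h2; rewrite -EFinD => h1.
have K0 : (0 <= (2 * r)%:E :> \bar R)%E by rewrite lee_fin mulr_ge0// ltW.
have := le_trans h3 (lee_wpmul2l K0 h1); rewrite -EFinM lee_fin => h2.
have rt : r * t = 20^-1 by rewrite tE; field; rewrite gt_eqF.
have E1 : 2 * r * (s `^ r * D `^ r * (2 * Cd) * e + t * g +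
   (s `^ r * D `^ r * (4 * Cd) * e + 4 * t * g)) =
   12 * (r * Cd * s `^ r * D `^ r * e) + 10 * (r * t) * g by ring.
move: h2; rewrite E1 rt => h2.
have -> : 24 * r * Cd * s `^ r * D `^ r * e = 24 * (r * Cd * s `^ r * D `^ r * e) by ring.
by lra.
Qed.

(** * The tree of atoms *)

Section atoms.
Context d (T : measurableType d) (R : realType).
Variables (S L : int -> set (set T)).
Hypothesis af : atomic_filtration S L.

Lemma filtration_mono m n : m <= n -> S m `<=` S n.
Proof.
move=> mn; have -> : n = m + (`|n - m|%N)%:Z by lia.
elim: `|n - m|%N => [|k IH]; first by rewrite addr0.
apply: (subset_trans IH); have := af_increasing af (n := m + k%:Z).
by rewrite -addrA -PoszD addn1.
Qed.

Lemma atom_measurable I : atoms L I -> measurable I.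
Proof. by move=> [n _ /(af_atom af)]; exact: af_measurable af n I. Qed.

Lemma atom_neq0 I : atoms L I -> exists x, I x.
Proof.
move=> [n _ LI]; apply/set0P/negP => /eqP I0.
by apply: (af_nonempty af (n := n)); rewrite -I0.
Qed.

(** A set of [S m] is a union of atoms of every later generation. *)
Lemma atom_split m n I J : m <= n -> S m I -> L n J ->
  J `<=` I \/ (forall x, J x -> ~ I x).
Proof.
move=> mn /(filtration_mono mn)/(af_union af)[C CL ->] LJ.
have [[x [Jx [K CK Kx]]]|H] := pselect (exists x, J x /\ (\bigcup_(I0 in C) I0) x).
  left; suff <- : K = J by move=> y Ky; exists K.
  by apply: (af_disjoint af (CL _ CK) LJ); exists x.
by right => x Jx Ix; apply: H; exists x.
Qed.

Lemma atoms_tree I J : atoms L I -> atoms L J ->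
  [\/ I `<=` J, J `<=` I | forall x, J x -> ~ I x].
Proof.
move=> [m _ LI] [n _ LJ]; have [mn|/ltW nm] := leP m n.
  by have [H|H] := atom_split mn (af_atom af LI) LJ; [apply: Or32|apply: Or33].
have [H|H] := atom_split nm (af_atom af LJ) LI; first exact: Or31.
by apply: Or33 => x Jx Ix; exact: (H x).
Qed.

(** Replaces the supremum defining the rank by a largest generation, or by arbitrarily
    large ones. *)
Lemma rk_dichotomy I : atoms L I ->
  (exists k : int, [/\ rk R L I = (k%:~R)%:E, L k I & forall n, L n I -> n <= k]) \/
  (rk R L I = +oo%E /\ forall k, exists2 n, k <= n & L n I).
Proof.
move=> [m _ LI].
(* The largest generation is found from an upper bound by a descending search. *)
have [[k0 Hk]|H] := pselect (exists k, forall n, L n I -> n <= k).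
  left; have [|j /asboolP Lj minj] := @ex_minnP (fun j => `[< L (k0 - j%:Z) I >]).
    exists `|k0 - m|%N; apply/asboolP; have mk := Hk _ LI.
    by have -> : k0 - (`|k0 - m|%N)%:Z = m by lia.
  have Hmax n : L n I -> n <= k0 - j%:Z.
    move=> Ln; have nk := Hk n Ln.
    have : (j <= `|k0 - n|)%N.
      apply: minj; apply/asboolP.
      by have -> : k0 - (`|k0 - n|%N)%:Z = n by lia.
    by lia.
  exists (k0 - j%:Z); split=> //; apply/eqP; rewrite eq_le; apply/andP; split.
    by apply: ge_ereal_sup => _ /= [n Ln <-]; rewrite lee_fin ler_int Hmax.
  by apply: ereal_sup_ubound; exists (k0 - j%:Z).
right; have Hn k : exists2 n, k <= n & L n I.
  apply: contrapT => nH; apply: H; exists k => n Ln; rewrite leNgt; apply/negP => kn.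
  by apply: nH; exists n => //; exact: ltW.
split => //; apply/eqP; rewrite -leye_eq leNgt; apply/negP => h.
have : rk R L I \is a fin_num.
  rewrite fin_numElt h andbT; apply: (@lt_le_trans _ _ (m%:~R)%:E); first exact: ltNyr.
  by apply: ereal_sup_ubound; exists m.
move=> /fineK E; have [n kn Ln] := Hn (Num.floor (fine (rk R L I)) + 1).
have : ((n%:~R)%:E <= rk R L I)%E by apply: ereal_sup_ubound; exists n.
rewrite -E lee_fin; apply/negP; rewrite -ltNge.
by apply: (lt_le_trans (floorD1_gt _)); rewrite ler_int.
Qed.

Lemma children_atom I I' : atoms L I -> children R L I I' -> atoms L I' /\ I' `<=` I.
Proof.
by move=> aI [[n [_ Ln sub]]|[_ ->]]; split=> //; exists (n + 1).
Qed.

Lemma children_fin I k : rk R L I = (k%:~R)%:E ->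
  children R L I = [set I' | L (k + 1) I' /\ I' `<=` I].
Proof.
move=> rkI; apply/seteqP; split=> [I' [[n [rn Ln sub]]|[ry _]]|I' [Ln sub]] /=.
- suff -> : k = n by [].
  by move: rn; rewrite rkI => -[] /eqP; rewrite eqr_int => /eqP.
- by move: ry; rewrite rkI.
- by left; exists k.
Qed.

Lemma children_inf I : rk R L I = +oo%E -> children R L I = [set I].
Proof.
move=> rkI; apply/seteqP; split=> [I' [[n [rn]]|[_ ->]]|I' ->] //=.
  by move: rn; rewrite rkI.
by right.
Qed.

Lemma children_disjoint I I1 I2 x : children R L I I1 -> children R L I I2 ->
  I1 x -> I2 x -> I1 = I2.
Proof.
move=> [[n [rn Ln _]]|[ry ->]] [[m [rm Lm _]]|[ry' ->]] // I1x I2x.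
- have nm : n = m by move: rn; rewrite rm => -[] /eqP; rewrite eqr_int => /eqP.
  by rewrite nm in Ln; apply: (af_disjoint af Ln Lm); exists x.
- by move: ry'; rewrite rn.
- by move: rm; rewrite ry.
Qed.

Lemma children_cover I x : atoms L I -> I x -> exists2 I', children R L I I' & I' x.
Proof.
move=> aI Ix; have [[k [rkI Lk _]]|[ry _]] := rk_dichotomy aI; last first.
  by exists I => //; right.
have /(af_increasing af)/(af_union af)[C CL E] := af_atom af Lk.
have [K CK Kx] : (\bigcup_(I0 in C) I0) x by rewrite -E.
exists K => //; left; exists k; split=> //; first exact: CL.
by rewrite E => y Ky; exists K.
Qed.

Lemma children_countable I : atoms L I -> countable (children R L I).
Proof.
move=> aI; have [[k [rkI Lk _]]|[ry _]] := rk_dichotomy aI.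
  rewrite (children_fin rkI); apply: sub_countable (af_countable af (k + 1)).
  by apply: subset_card_le => ? [].
by rewrite (children_inf ry).
Qed.

(** If the rank of [J] is infinite, [I] and [J] occur in generations that force
    [J `<=` I]; if it is [k], then [I] can only be of generation [k + 1] or later,
    and hence lies in one child. *)
Lemma strict_subatom_child I J : atoms L I -> atoms L J -> I `<=` J -> I <> J ->
  exists2 J', children R L J J' & I `<=` J'.
Proof.
move=> aI aJ IJ neq; have [n _ LI] := aI.
have [x Ix] := atom_neq0 aI.
have [[k [rkJ Lk _]]|[_ Hy]] := rk_dichotomy aJ; last first.
  have [m nm Lm] := Hy n; exfalso; apply: neq.
  have [sub|dis] := atom_split nm (af_atom af LI) Lm.
    by apply/seteqP.
  by exfalso; apply: (dis x) => //; exact: IJ.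
have kn : k + 1 <= n.
  rewrite lezD1 ltNge; apply/negP => nk; apply: neq.
  have [sub|dis] := atom_split nk (af_atom af LI) Lk.
    by apply/seteqP.
  by exfalso; apply: (dis x) => //; exact: IJ.
have [J' cJ' J'x] := children_cover aJ (IJ x Ix).
exists J' => //; move: cJ'; rewrite (children_fin rkJ) => -[LJ' _].
by have [//|dis] := atom_split kn (af_atom af LJ') LI; exfalso; exact: (dis x).
Qed.

End atoms.

(** * Martingale differences on atoms *)

Section average.
Context d (T : measurableType d) (R : realType).
Variable sigma : {measure set T -> \bar R}.

Lemma integrable_indic_fin (I : set T) : measurable I -> (sigma I < +oo)%E ->
  sigma.-integrable setT (fun x => (\1_I x : R)%:E).
Proof.
move=> mI fI; apply/integrableP; split; first exact/measurable_EFinP/mf_indic.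
rewrite (eq_integral (fun x => (\1_I x)%:E)); last first.
  by move=> x _; rewrite gee0_abs// lee_fin.
by rewrite integral_indic// setIT.
Qed.

Lemma average_mul (f : T -> R) (I : set T) : measurable I -> (sigma I < +oo)%E ->
  sigma.-integrable I (EFin \o f) ->
  ((average sigma f I)%:E * sigma I = \int[sigma]_(x in I) (f x)%:E)%E.
Proof.
move=> mI fI intf; have fin : sigma I \is a fin_num by rewrite ge0_fin_numE.
have fin' := integrable_fin_num mI intf.
have [I0|I0] := eqVneq (sigma I) 0%E.
  rewrite I0 mule0 null_set_integral//.
  exact: measurable_int intf.
rewrite /average /eaverage -(fineK fin').
rewrite -EFinM /= -{2}(fineK fin) -EFinM mulrAC mulVf ?mul1r//.
by rewrite fine_eq0.
Qed.

Lemma average0 (f : T -> R) (I : set T) : sigma I = 0%E -> average sigma f I = 0.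
Proof. by move=> I0; rewrite /average /eaverage I0 /= invr0 mul0e. Qed.
End average.

Section atomic_mdiff.
Context d (T : measurableType d) (R : realType).
Variables (S L : int -> set (set T)) (nu : {measure set T -> \bar R}).
Hypothesis af : atomic_filtration S L.
Hypothesis lf : locally_finite L nu.

(** What both kinds of symbols, functions and families of differences, provide. *)
Record atom_mdiff (I : set T) (D : T -> R) : Prop := AtomMdiff {
  am_integrable : nu.-integrable [set: T] (EFin \o D) ;
  am_supp : forall x, ~ I x -> D x = 0 ;
  am_child : forall I', children R L I I' -> forall x y, I' x -> I' y -> D x = D y ;
  am_mean : (\int[nu]_x (D x)%:E = 0)%E
}.

(** The children as a sequence of disjoint sets, to which countable additivity
    applies. *)
Lemma children_enum I : atoms L I -> exists F : nat -> set T,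
  [/\ trivIset setT F, forall n, F n = set0 \/ children R L I (F n) & \bigcup_n F n = I].
Proof.
move=> aI; have /countable_injP[g ginj] := children_countable R af aI.
exists (fun n => [set x | exists I', [/\ children R L I I', g I' = n & I' x]]); split.
- move=> i j _ _ [x [[I1 [c1 g1 x1]] [I2 [c2 g2 x2]]]].
  by rewrite -g1 -g2 (children_disjoint af c1 c2 x1 x2).
- move=> n; have [[I' [c' g']]|H] := pselect (exists I', children R L I I' /\ g I' = n).
    right; suff -> : [set x | exists I'0, [/\ children R L I I'0, g I'0 = n & I'0 x]] = I' by [].
    apply/seteqP; split=> [x [I1 [c1 g1 x1]]|x xI]; last by exists I'.
    by have <- : I1 = I'; first by apply: ginj; rewrite ?inE// g1.
  left; apply/seteqP; split=> // x [I1 [c1 g1 _]]; apply: H; by exists I1.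
- apply/seteqP; split=> [x [n _ [I1 [c1 _ x1]]]|x Ix].
    by have [_] := children_atom aI c1; exact.
  have [I1 c1 x1] := children_cover R af aI Ix.
  by exists (g I1) => //; exists I1.
Qed.

(** The averages over the children form an integrable function [h] with the same
    integral as [f]: on each child the integrals coincide, and the integral of
    [`|h|] is at most that of [`|f|]. *)
Lemma mdiff_atom_mdiff (f : T -> R) I : atoms L I -> nu.-integrable I (EFin \o f) ->
  atom_mdiff I (mdiff L nu f I).
Proof.
move=> aI intf; have mI := atom_measurable af aI.
pose h x := \sum_(I' \in children R L I) expect nu I' f x.
have exp0 J x : ~ J x -> expect nu J f x = 0.
  by move=> nJ; rewrite /expect indicE memNset// mulr0.
have h_out x : ~ I x -> h x = 0.
  move=> nI; apply: fsbig1 => J cJ; apply: exp0 => Jx; apply: nI.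
  by have [_] := children_atom aI cJ; exact.
have h_in I' x : children R L I I' -> I' x -> h x = average nu f I'.
  move=> c' x'; rewrite /h -(@fsbig_widen _ _ _ _ [set I'])//.
  - by rewrite fsbig_set1 /expect indicE mem_set// mulr1.
  - by move=> ? ->.
  - move=> J [cJ /= JI']; apply: exp0 => Jx; apply: JI'.
    exact: (children_disjoint af cJ c' Jx x').
(* Everything about [h] is verified child by child. *)
have [F [tF cF UF]] := children_enum aI.
have mF n : measurable (F n).
  have [->|/(children_atom aI)[aF _]] := cF n; first exact: measurable0.
  exact: (atom_measurable af aF).
have intF n : nu.-integrable (F n) (EFin \o f).
  by apply: (integrableS mI) => //; rewrite -UF; exact: bigcup_sup.
have finF n : (nu (F n) < +oo)%E.
  have [->|/(children_atom aI)[aF _]] := cF n; first by rewrite measure0.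
  exact: lf.
have hF n : exists c, (forall x, F n x -> h x = c) /\
    ((c%:E * nu (F n)) = \int[nu]_(x in F n) (f x)%:E)%E.
  have [->|c] := cF n; first by exists 0; rewrite measure0 mul0e integral_set0.
  exists (average nu f (F n)); split; first by move=> x; exact: h_in.
  by apply: average_mul.
have mh : measurable_fun I h.
  rewrite -UF; apply/measurable_fun_bigcup => // n.
  have [c [Hc _]] := hF n.
  apply: (eq_measurable_fun (cst c)); last exact: measurable_cst.
  by move=> x; rewrite inE => /Hc ->.
have intFE n : (\int[nu]_(x in F n) (h x)%:E = \int[nu]_(x in F n) (f x)%:E)%E.
  have [c [Hc <-]] := hF n.
  rewrite (eq_integral (cst c%:E)) ?integral_cst//.
  by move=> x; rewrite inE => /Hc ->.
have inth : nu.-integrable I (EFin \o h).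
  apply/integrableP; split; first exact/measurable_EFinP.
  have mfI := measurable_int nu intf.
  rewrite -UF ge0_integral_bigcup//; last first.
    by apply: measurableT_comp => //; rewrite UF; exact/measurable_EFinP.
  apply: (@le_lt_trans _ _ (\sum_(i <oo) \int[nu]_(x in F i) `|(EFin \o f) x|)%E).
    apply: lee_nneseries => n _; first by move=> _; exact: integral_ge0.
    have [c [Hc Hc']] := hF n.
    rewrite (eq_integral (cst `|c|%:E)); last first.
      by move=> x; rewrite inE => /Hc /= ->.
    rewrite integral_cst//.
    have -> : (`|c|%:E * nu (F n) = `|c%:E * nu (F n)|)%E.
      by rewrite abseM/= [X in _ = (_ * X)%E]gee0_abs.
    rewrite Hc'; apply: le_abse_integral => //.
    exact: measurable_int (intF n).
  rewrite -ge0_integral_bigcup//; last by apply: measurableT_comp => //; rewrite UF.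
  by rewrite UF; have /integrableP[] := intf.
have hIE : (\int[nu]_(x in I) (h x)%:E = \int[nu]_(x in I) (f x)%:E)%E.
  rewrite -UF !integral_bigcup// ?UF//; by apply: eq_eseriesr => n _; exact: intFE.
pose a := average nu f I.
have DE x : mdiff L nu f I x = h x - a * \1_I x by [].
have inta : nu.-integrable setT (fun x => (a * \1_I x)%:E).
  rewrite (_ : (fun _ => _) = (fun x => a%:E * (\1_I x)%:E)%E); last first.
    by apply/funext => x; rewrite EFinM.
  by apply: integrableZl => //; apply: integrable_indic_fin => //; exact: lf.
have hpatch : (EFin \o h) \_ I = EFin \o h.
  apply/funext => x; rewrite patchE; case: ifPn => //= /negP nI.
  by rewrite h_out// => Ix; apply: nI; rewrite inE.
have inthT : nu.-integrable setT (EFin \o h).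
  have H := (integrable_mkcond (mu := nu) (EFin \o h) mI).1 inth.
  by move: H; rewrite hpatch.
split.
- rewrite (_ : EFin \o _ = (EFin \o h) \- (fun x => (a * \1_I x)%:E))%E; last first.
    by apply/funext => x; rewrite /= DE EFinB.
  exact: integrableB.
- by move=> x nI; rewrite DE h_out// indicE memNset// mulr0 subrr.
- move=> I' c' x y Ix Iy; have [_ sub] := children_atom aI c'.
  by rewrite !DE (h_in _ _ c' Ix) (h_in _ _ c' Iy) !indicE !mem_set//; exact: sub.
- under eq_integral do rewrite DE EFinB.
  rewrite integralB//.
  have -> : (\int[nu]_x (EFin \o h) x = \int[nu]_(x in I) (h x)%:E)%E.
    by rewrite [RHS]integral_mkcond -[in LHS]hpatch.
  rewrite hIE -(average_mul mI (lf aI) intf) -/a.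
  under eq_integral do rewrite EFinM.
  rewrite integralZl//; last by apply: integrable_indic_fin => //; exact: lf.
  rewrite integral_indic// setIT subee// fin_numM// ge0_fin_numE//; exact: lf.
Qed.

Lemma symbol_diff_atom_mdiff (b : symbol T R) I : is_symbol L nu b -> atoms L I ->
  atom_mdiff I (symbol_diff L nu b I).
Proof.
move=> + aI; case: b => [f|D] /= sb; first exact: mdiff_atom_mdiff (sb I aI).
have [intD supD childD meanD] := sb I aI; split => //.
rewrite -meanD [RHS]integral_mkcond; apply: eq_integral => x _; rewrite patchE.
by case: ifPn => // /negP nI; rewrite supD// => Ix; apply: nI; rewrite inE.
Qed.

(** The martingale property, in the form used by [md_adapted]: a proper subatom lies in
    one child. *)
Lemma atom_mdiff_const I J (D : T -> R) : atoms L I -> atoms L J -> atom_mdiff J D ->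
  (I `<=` J \/ forall x, I x -> ~ J x) -> I <> J -> forall x y, I x -> I y -> D x = D y.
Proof.
move=> aI aJ mD [IJ|dis] neq x y Ix Iy; last first.
  by rewrite !(am_supp mD)//; exact: dis.
have [J' cJ' IJ'] := strict_subatom_child R af aI aJ IJ neq.
by apply: (am_child mD cJ'); exact: IJ'.
Qed.

Lemma atom_mdiffZ I D c : atom_mdiff I D -> atom_mdiff I (fun x => c * D x).
Proof.
move=> mD; have E : EFin \o (fun x => c * D x) = (fun x => c%:E * (EFin \o D) x)%E.
  by apply/funext => x; rewrite /= EFinM.
split.
- by rewrite E; apply: integrableZl => //; exact: am_integrable mD.
- by move=> x nI; rewrite (am_supp mD nI) mulr0.
- by move=> I' cI' x y Ix Iy; rewrite (am_child mD cI' Ix Iy).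
- have -> : (\int[nu]_x (c * D x)%:E = \int[nu]_x (c%:E * (EFin \o D) x))%E.
    by apply: eq_integral => x _; rewrite EFinM.
  by rewrite integralZl ?(am_mean mD) ?mule0//; exact: am_integrable mD.
Qed.

End atomic_mdiff.

(** * Finite families of atoms *)

Lemma fsum_nth (T : Type) (R : realType) (s : seq (set T)) (G : set T -> R) : uniq s ->
  \sum_(I \in [set` s]) G I = \sum_(k < size s) G (nth set0 s k).
Proof. by move=> us; rewrite -fsbig_seq// (big_nth set0) big_mkord. Qed.

(** A finite family is sorted by the number of its members that contain a given
    one. *)
Lemma sort_by_inclusion (T : Type) (K : set (set T)) : finite_set K ->
  exists s : seq (set T), [/\ uniq s, [set` s] = K &
    forall j k, (j < k < size s)%N -> ~ (nth set0 s j `<=` nth set0 s k)].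
Proof.
move=> /finite_seqP[s1 ->]; pose s0 := undup s1.
have us0 : uniq s0 by exact: undup_uniq.
pose depth (I : set T) := count (fun J => `[< I `<=` J >]) s0.
pose le I J := (depth I <= depth J)%N.
have tot : total le by move=> I J; exact: leq_total.
exists (sort le s0); split; first by rewrite sort_uniq.
  by apply/seteqP; split=> x /=; rewrite mem_sort mem_undup.
move=> j k /andP[jk ks] sub.
have js := ltn_trans jk ks.
have srt : sorted le (sort le s0) by exact: sort_sorted.
have : le (nth set0 (sort le s0) j) (nth set0 (sort le s0) k).
  apply: (sorted_leq_nth _ _ _ srt) => //; [|by move=> ?; exact: leqnn|exact: ltnW].
  by move=> ? ? ?; exact: leq_trans.
set I := nth _ _ j in sub *; set J := nth _ _ k in sub *.
have neq : I <> J.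
  move=> /eqP; rewrite nth_uniq// ?sort_uniq// => /eqP e.
  by move: jk; rewrite e ltnn.
have Is : I \in s0 by rewrite -(mem_sort le) mem_nth.
rewrite /le leqNgt => /negP; apply; rewrite /depth.
apply: (@leq_trans (count (fun J0 => `[< J `<=` J0 >]) s0 + count_mem I s0)%N).
  by rewrite -addn1 leq_add2l -has_count has_pred1.
elim: (s0) => //= H t IH; rewrite addnACA leq_add//.
case: asboolP => JH; case: asboolP => IH'; case: eqP => [e|] //.
- by exfalso; apply: neq; apply/seteqP; split => //; rewrite -e.
- by exfalso; apply: IH'; exact: subset_trans JH.
- by exfalso; apply: IH'; exact: subset_trans JH.
- by exfalso; apply: IH'; rewrite e.
Qed.

Section families.
Context d (T : measurableType d) (R : realType).
Variables (S L : int -> set (set T)) (nu : {measure set T -> \bar R}) (p : R).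
Hypothesis af : atomic_filtration S L.
Hypothesis lf : locally_finite L nu.

Lemma tree_ordered_atoms (s : seq (set T)) : [set` s] `<=` atoms L ->
  (forall j k, (j < k < size s)%N -> ~ (nth set0 s j `<=` nth set0 s k)) ->
  tree_ordered (nth set0 s).
Proof.
move=> sL sinc j k jk; have [sk|ks] := leqP (size s) k.
  by left; rewrite nth_default.
have at_ i : (i < size s)%N -> atoms L (nth set0 s i).
  by move=> ?; apply: sL; rewrite /= mem_nth.
have [|jk'|?] := atoms_tree af (at_ _ (ltn_trans jk ks)) (at_ _ ks).
- by move=> sub; exfalso; apply: (sinc j k) => //; rewrite jk.
- by left.
- by right.
Qed.

(** A family of martingale differences in [L^p], one for each atom in [D]. The
    symbol and the terms of a paraproduct are both of this form. *)
Record md_family (D : set (set T)) (F : set T -> T -> R) : Prop := MdFamily {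
  mdf_atoms : D `<=` atoms L ;
  mdf_mdiff : forall I, D I -> atom_mdiff L nu I (F I) ;
  mdf_Lp : forall I, D I -> (\rint[nu]_x (`|F I x| `^ p) < +oo)%E
}.

Lemma md_family_sub D D' F : D' `<=` D -> md_family D F -> md_family D' F.
Proof.
by move=> sub [aD mD LD]; split=> I /sub; [exact: aD|exact: mD|exact: LD].
Qed.

Definition truncated_nth (s : seq (set T)) (F : set T -> T -> R) k x :=
  if (k < size s)%N then F (nth set0 s k) x else 0.

(** Beyond the end of the list the sets are empty and the differences zero. *)
Lemma md_family_seq (s : seq (set T)) F : 0 < p -> uniq s -> md_family [set` s] F ->
  (forall j k, (j < k < size s)%N -> ~ (nth set0 s j `<=` nth set0 s k)) ->
  martingale_diffs nu p (nth set0 s) (truncated_nth s F).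
Proof.
move=> p0 us mF sinc.
have at_ i : (i < size s)%N -> [set` s] (nth set0 s i) by move=> ?; rewrite /= mem_nth.
have TE k : (k < size s)%N -> truncated_nth s F k = F (nth set0 s k).
  by move=> ks; apply/funext => x; rewrite /truncated_nth ks.
have T0 k : (size s <= k)%N -> truncated_nth s F k = cst 0.
  by move=> ks; apply/funext => x; rewrite /truncated_nth ltnNge ks.
split.
- exact: (tree_ordered_atoms (mdf_atoms mF)).
- move=> k; have [ks|ks] := ltnP k (size s); last by rewrite nth_default.
  exact: (atom_measurable af (mdf_atoms mF (at_ _ ks))).
- move=> k; have [ks|ks] := ltnP k (size s); last by rewrite nth_default// measure0.
  exact: (lf (mdf_atoms mF (at_ _ ks))).
- move=> k x nI; have [ks|ks] := ltnP k (size s); last by rewrite T0.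
  by rewrite TE// (am_supp (mdf_mdiff mF (at_ _ ks))).
- move=> j k x y jk Ix Iy; have [ks|ks] := ltnP k (size s); last first.
    by move: Ix; rewrite nth_default.
  have js := ltn_trans jk ks.
  rewrite TE//; apply: (atom_mdiff_const af (mdf_atoms mF (at_ _ ks))
    (mdf_atoms mF (at_ _ js)) (mdf_mdiff mF (at_ _ js))) Ix Iy.
    exact: (tree_ordered_atoms (mdf_atoms mF) sinc).
  move=> /eqP; rewrite nth_uniq// => /eqP e; by move: jk; rewrite e ltnn.
- move=> k; have [ks|ks] := ltnP k (size s).
    by rewrite TE//; exact: am_integrable (mdf_mdiff mF (at_ _ ks)).
  by rewrite T0//; exact: integrable0.
- move=> k; have [ks|ks] := ltnP k (size s).
    by rewrite TE//; exact: am_mean (mdf_mdiff mF (at_ _ ks)).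
  by rewrite T0//; exact: integral0.
- move=> k; have [ks|ks] := ltnP k (size s).
    by rewrite TE//; exact: (mdf_Lp mF (at_ _ ks)).
  rewrite T0// (@eq_rint _ _ _ _ _ (fun=> 0)); first by rewrite /rint integral0.
  by move=> x; rewrite normr0 powR0// gt_eqF.
Qed.

Lemma psum_truncated_nth s F (g : R -> R) x : uniq s -> g 0 = 0 ->
  psum (fun k x => g (truncated_nth s F k x)) (size s) x = \sum_(I \in [set` s]) g (F I x).
Proof.
move=> us g0; rewrite (fsum_nth (fun I => g (F I x)))//.
by apply: eq_bigr => k _; rewrite /truncated_nth ltn_ord.
Qed.

Lemma mf_fsum D F (g : R -> R) K : md_family D F -> fsets D K ->
  (forall h : T -> R, measurable_fun setT h -> measurable_fun setT (fun x => g (h x))) ->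
  measurable_fun [set: T] (fun x => \sum_(I \in K) g (F I x)).
Proof.
move=> mF [/sort_by_inclusion[s [us <- _]] KD] mg.
rewrite (_ : (fun _ => _) = fun x => \sum_(k < size s) g (F (nth set0 s k) x)); last first.
  by apply/funext => x; rewrite (fsum_nth (fun I => g (F I x))).
apply: mf_sum => k; apply: mg.
have DI : D (nth set0 s k) by apply: KD; rewrite /= mem_nth.
by have /integrableP[/measurable_EFinP] := am_integrable (mdf_mdiff mF DI).
Qed.

End families.

(** The square function inequality for finite sums of martingale differences over
    atoms, in an order-free form. It removes the signs, and with them the
    cancellation, from the problem. *)
Lemma square_function (R : realType) (p : R) : 2 < p -> exists2 C : R, 0 < C &
  forall d (T : measurableType d) (S L : int -> set (set T))
    (nu : {measure set T -> \bar R}) (F : set T -> T -> R) (K : set (set T)),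
  atomic_filtration S L -> locally_finite L nu -> finite_set K ->
  md_family L nu p K F ->
  (\rint[nu]_x (`|\sum_(I \in K) F I x| `^ p) <=
     C%:E * \rint[nu]_x ((\sum_(I \in K) F I x ^+ 2) `^ (p / 2)))%E /\
  (\rint[nu]_x ((\sum_(I \in K) F I x ^+ 2) `^ (p / 2)) <=
     C%:E * \rint[nu]_x (`|\sum_(I \in K) F I x| `^ p))%E.
Proof.
move=> p2; have [C1 C10 H1] := burkholder_upper p2; have [C2 C20 H2] := burkholder_lower p2.
exists (C1 + C2); first exact: addr_gt0.
move=> d T S L nu F K af lf /sort_by_inclusion[s [us <- sinc]] mF.
have p0 : 0 < p by lra.
have M := md_family_seq af lf p0 us mF sinc.
have {}H1 := H1 _ _ _ _ _ (size s) M; have {}H2 := H2 _ _ _ _ _ (size s) M.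
have E1 : \rint[nu]_x (`|psum (truncated_nth s F) (size s) x| `^ p) =
    \rint[nu]_x (`|\sum_(I \in [set` s]) F I x| `^ p).
  by apply: eq_rint => x; rewrite (@psum_truncated_nth _ _ _ _ _ id).
have E2 : \rint[nu]_x (psum (fun k x => truncated_nth s F k x ^+ 2) (size s) x `^ (p / 2)) =
    \rint[nu]_x ((\sum_(I \in [set` s]) F I x ^+ 2) `^ (p / 2)).
  apply: eq_rint => x; congr (_ `^ _).
  by apply: (psum_truncated_nth F (g := fun z => z ^+ 2) x us); rewrite expr0n.
rewrite E1 E2 in H1 H2; split.
  apply: (le_trans H1); apply: lee_wpmul2r; first by apply: rint_ge0 => x; exact: powR_ge0.
  by rewrite lee_fin lerDl ltW.
apply: (le_trans H2); apply: lee_wpmul2r; first by apply: rint_ge0 => x; exact: powR_ge0.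
by rewrite lee_fin lerDr ltW.
Qed.

(** * Completeness and unconditional sums *)

Section Lp_integrals.
Context d (T : measurableType d) (R : realType).
Variables (nu : {measure set T -> \bar R}) (p : R).
Hypothesis p0 : 0 < p.

Lemma powR_Lnorm_rint (f : T -> R) :
  ('N[nu]_(p%:E)[EFin \o f] `^ p)%E = \rint[nu]_x (`|f x| `^ p).
Proof. by rewrite powR_Lnorm ?gt_eqF. Qed.

Lemma Lnorm_lt (f : T -> R) (e : R) : 0 < e ->
  (('N[nu]_(p%:E)[EFin \o f] < e%:E)%E <-> (\rint[nu]_x (`|f x| `^ p) < (e `^ p)%:E)%E).
Proof.
move=> e0; rewrite -powR_Lnorm_rint -poweR_EFin.
have : (0 <= 'N[nu]_(p%:E)[EFin \o f])%E by exact: Lnorm_ge0.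
move: ('N[nu]_(p%:E)[EFin \o f])%E => N N0.
have I1 : N \in `[0%E, +oo%E] by rewrite in_itv /= N0 leey.
have I2 : e%:E \in `[0%E, +oo%E] by rewrite in_itv /= lee_fin (ltW e0) leey.
split=> [|H].
  move: N0 {I1}; case: N => [x| |]//.
  rewrite !poweR_EFin !lte_fin lee_fin => x0 xe.
  by apply: gt0_ltr_powR; rewrite ?nnegrE// ltW.
rewrite ltNge; apply/negP => /(gt0_ler_poweR (ltW p0) I2 I1).
by rewrite leNgt H.
Qed.

Lemma Lfun_rintP (f : T -> R) : f \in Lfun nu p%:E <->
  measurable_fun setT f /\ (\rint[nu]_x (`|f x| `^ p) < +oo)%E.
Proof.
rewrite -powR_Lnorm_rint; split=> [/andP[]|[mf ff]].
  rewrite !inE /= => mf; rewrite /finite_norm => ff; split=> //.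
  exact: poweR_lty.
apply/andP; split; rewrite inE//=.
by apply: lty_poweRy ff; rewrite gt_eqF.
Qed.

End Lp_integrals.

(** The limit together with the rate of convergence: the intervals around [a n], with
    the bound of the remaining total variation as radius, are nested. *)
Lemma geometric_limit (R : realType) (a : nat -> R) (c : R) : 0 <= c ->
  (forall n, `|a n.+1 - a n| <= c * 2^-1 ^+ n) ->
  exists l, forall m, `|a m - l| <= c * (2 * 2^-1 ^+ m).
Proof.
move=> c0 H; pose t n := c * (2 * 2^-1 ^+ n).
have tS n : t n = t n.+1 + c * 2^-1 ^+ n by rewrite /t exprS; field.
have t0 n : 0 <= t n by rewrite /t !mulr_ge0// exprn_ge0.
have lo n : a n - t n <= a n.+1 - t n.+1.
  by have := H n; rewrite ler_norml tS; lra.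
have hi n : a n.+1 + t n.+1 <= a n + t n.
  by have := H n; rewrite ler_norml (tS n); lra.
have loM n m : (n <= m)%N -> a n - t n <= a m - t m.
  move=> nm; rewrite -(subnKC nm); elim: (m - n)%N => [|k IH]; first by rewrite addn0.
  by rewrite addnS; exact: le_trans IH (lo _).
have hiM n m : (n <= m)%N -> a m + t m <= a n + t n.
  move=> nm; rewrite -(subnKC nm); elim: (m - n)%N => [|k IH]; first by rewrite addn0.
  by rewrite addnS; exact: le_trans (hi _) IH.
have lohi n m : a n - t n <= a m + t m.
  have h1 := loM _ _ (leq_maxl n m); have h2 := hiM _ _ (leq_maxr n m).
  by have := t0 (maxn n m); lra.
pose A := range (fun n => a n - t n).
have A0 : A !=set0 by exists (a 0%N - t 0%N), 0%N.
have Aub m : ubound A (a m + t m) by move=> _ [n _ <-]; exact: lohi.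
exists (sup A) => m; rewrite ler_norml -/(t m); apply/andP; split.
  by have : sup A <= a m + t m; [exact: ge_sup|lra].
have : a m - t m <= sup A; last lra.
by apply: ub_le_sup; [exists (a m + t m); exact: Aub|exists m].
Qed.

(** The completeness of [L^p] for a sequence with geometrically small steps. The
    function [W] adds up the [p]-th powers of the steps, each divided by the [p]-th
    power of its expected size, and is integrable. Where it is finite, the sequence
    converges geometrically with a constant given by [W], and the same [W]
    dominates the error. The null set on which [W] is infinite causes no harm,
    because the bound is [+oo] there. *)
Lemma Lp_limit d (T : measurableType d) (R : realType) (nu : {measure set T -> \bar R})
    (p : R) (u : nat -> T -> R) : 0 < p -> (forall n, measurable_fun setT (u n)) ->
  (forall n, (\rint[nu]_x (`|u n.+1 x - u n x| `^ p) <=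
     ((2^-1 ^+ n) `^ p * (1 / (2 ^ n.+1)%:R))%:E)%E) ->
  exists2 g : T -> R, measurable_fun setT g &
    forall m, (\rint[nu]_x (`|u m x - g x| `^ p) <= ((2 * 2^-1 ^+ m) `^ p)%:E)%E.
Proof.
move=> p0 mu_ Hu.
(* The [n]-th step has expected size [th n]. *)
pose th n : R := 2^-1 ^+ n.
have th0 n : 0 < th n by rewrite /th exprn_gt0.
pose v n x := (th n)^-1 * `|u n.+1 x - u n x|.
have v0 n x : 0 <= v n x by rewrite /v mulr_ge0// invr_ge0 ltW.
have mv n : measurable_fun setT (v n) by rewrite /v; mes.
pose W x : \bar R := (\sum_(n <oo) (v n x `^ p)%:E)%E.
have mvE n : measurable_fun setT (fun x => (v n x `^ p)%:E).
  by apply/measurable_EFinP; mes.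
have W0 x : (0 <= W x)%E by apply: nneseries_ge0 => n _ _; rewrite lee_fin powR_ge0.
have mW : measurable_fun setT W.
  by apply: ge0_emeasurable_sum => // n x _ _; rewrite lee_fin powR_ge0.
have intW : (\int[nu]_x W x <= 1)%E.
  rewrite integral_nneseries//; last by move=> n x _; rewrite lee_fin powR_ge0.
  apply: le_trans (@epsilon_trick0 R 1 xpredT ler01).
  apply: lee_nneseries => n _; first by move=> _; apply: integral_ge0 => x _; rewrite lee_fin powR_ge0.
  rewrite (eq_integral (fun x => ((th n)^-1 `^ p)%:E * (`|u n.+1 x - u n x| `^ p)%:E)%E); last first.
    by move=> x _; rewrite /v powRM ?invr_ge0 ?(ltW (th0 n))// EFinM.
  rewrite ge0_integralZl_EFin ?powR_ge0//; last by apply/measurable_EFinP; mes.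
  have c0 : (0 <= ((th n)^-1 `^ p)%:E)%E by rewrite lee_fin powR_ge0.
  apply: (le_trans (lee_wpmul2l c0 (Hu n))).
  rewrite -EFinM mulrA -powRM ?invr_ge0 ?(ltW (th0 n))//.
  rewrite -/(th n) mulVf ?gt_eqF//.
  have -> : 1 `^ p = 1 :> R by rewrite powR1.
  by rewrite !mul1r.
have vW n x : ((v n x `^ p)%:E <= W x)%E.
  apply: le_trans (nneseries_lim_ge (m := 0) n.+1 _); last first.
    by move=> k _ _; rewrite lee_fin powR_ge0.
  rewrite big_nat_recr//= leeDr//.
  by apply: sume_ge0 => k _; rewrite lee_fin powR_ge0.
have Hg x : exists l, (W x = +oo%E -> l = 0) /\
   ((W x < +oo)%E -> forall m, `|u m x - l| <= fine (W x) `^ p^-1 * (2 * th m)).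
  have [Wy|] := ltP (W x) +oo%E; last first.
    by rewrite leye_eq => /eqP ->; exists 0; split => //; rewrite ltxx.
  have fW : W x \is a fin_num by rewrite ge0_fin_numE.
  have [|n|l Hl] := @geometric_limit R (u ^~ x) (fine (W x) `^ p^-1).
  - exact: powR_ge0.
  - have := vW n x; rewrite -(fineK fW) lee_fin => h.
    have : v n x <= fine (W x) `^ p^-1.
      have -> : v n x = (v n x `^ p) `^ p^-1 by rewrite -powRrM mulfV ?gt_eqF// powRr1.
      by apply: ge0_ler_powR; rewrite ?invr_ge0 ?nnegrE ?powR_ge0 ?fine_ge0// ltW.
    by rewrite /v ler_pdivrMl// mulrC.
  by exists l; split => // E; move: Wy; rewrite E ltxx.
have [g {}Hg] := choice Hg.
have mg : measurable_fun setT g.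
  pose E := [set x | (W x < +oo)%E].
  have mE : measurable E.
    by rewrite -[E]setTI; apply: measurable_lte => //; exact: measurable_cst.
  apply: (@measurable_fun_cvg _ _ _ _ (fun m x => u m x * \1_E x)); first by move=> m; mes.
  move=> x _; have [g0 gl] := Hg x.
  have [Wy|] := ltP (W x) +oo%E; last first.
    rewrite leye_eq => /eqP Wy; rewrite g0//.
    have nE : ~ E x by rewrite /E /= Wy ltxx.
    rewrite (_ : (fun _ => _) = cst 0); first exact: cvg_cst.
    by apply/funext => m; rewrite indicE memNset// mulr0.
  rewrite (_ : (fun _ => _) = (u ^~ x)); last first.
    by apply/funext => m; rewrite indicE mem_set// mulr1.
  set c := fine (W x) `^ p^-1 in gl.
  have c0 : 0 <= c by exact: powR_ge0.
  have cv : (fun m => c * 2 * th m) @ \oo --> (0 : R).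
    rewrite -(mulr0 (c * 2)); apply: cvgM; first exact: cvg_cst.
    by apply: cvg_expr; rewrite ger0_norm//; lra.
  apply/cvgrPdist_lt => e e0; move/cvgrPdist_lt: cv => /(_ e e0).
  apply: filterS => m; rewrite sub0r normrN; apply: le_lt_trans.
  by rewrite distrC (le_trans (gl Wy m))// mulrA ler_norm.
exists g => // m.
apply: (@le_trans _ _ (((2 * th m) `^ p)%:E * \int[nu]_x W x)%E); last first.
  by rewrite -[leRHS]mule1; apply: lee_wpmul2l => //; rewrite lee_fin powR_ge0.
rewrite -ge0_integralZl_EFin ?powR_ge0//.
apply: ge0_le_integral => //; [by apply/measurable_EFinP; mes|exact: measurable_funeM|].
move=> x _; have [_ gl] := Hg x.
have [Wy|] := ltP (W x) +oo%E; last first.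
  rewrite leye_eq => /eqP ->; rewrite gt0_muley ?leey// lte_fin powR_gt0//.
  exact: mulr_gt0.
have fW : W x \is a fin_num by rewrite ge0_fin_numE.
rewrite -(fineK fW) -EFinM lee_fin.
have -> : fine (W x) = (fine (W x) `^ p^-1) `^ p.
  by rewrite -powRrM mulVf ?gt_eqF// powRr1// fine_ge0.
rewrite -powRM ?powR_ge0//; last by rewrite mulr_ge0// ltW.
apply: ge0_ler_powR; rewrite ?nnegrE ?(ltW p0)// ?mulr_ge0 ?powR_ge0 ?(ltW (th0 m))//.
by rewrite mulrC; exact: gl.
Qed.

(** What can be added to a nearly optimal [y] is small. *)
Lemma ereal_slack (R : realType) (x y s : \bar R) (e : R) : x \is a fin_num ->
  y \is a fin_num -> s \is a fin_num -> (x + y <= s)%E -> (s - e%:E < y)%E ->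
  (x <= e%:E)%E.
Proof.
case: x y s => [x| |] [y| |] [s| |]// _ _ _.
by rewrite -EFinD -EFinB lte_fin !lee_fin; lra.
Qed.

Lemma half_expr_small (R : realType) (e : R) : 0 < e -> exists n, 2^-1 ^+ n < e.
Proof.
move=> e0; have : (fun n => 2^-1 ^+ n : R) @ \oo --> (0 : R).
  by apply: cvg_expr; rewrite ger0_norm//; lra.
move=> /cvgrPdist_lt/(_ e e0)[n _ Hn]; exists n.
have := Hn n (leqnn n); rewrite /= sub0r normrN ger0_norm//.
Qed.

Lemma fsum_diff (T : Type) (R : realType) (K K' : set (set T)) (G : set T -> R) :
  finite_set K -> K' `<=` K ->
  \sum_(I \in K) G I = \sum_(I \in K') G I + \sum_(I \in K `\` K') G I.
Proof.
move=> fK sub; rewrite -{1}(setDUK sub) fsbigU0//.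
- exact: sub_finite_set fK.
- exact: finite_setD.
- by move=> I [K'I [_ /(_ K'I)]].
Qed.

Lemma fsum_ge0 (T : Type) (R : realType) (K : set (set T)) (G : set T -> R) :
  finite_set K -> (forall I, 0 <= G I) -> 0 <= \sum_(I \in K) G I.
Proof.
by move=> /sort_by_inclusion[s [us <- _]] G0; rewrite fsum_nth// sumr_ge0.
Qed.

Lemma fsum_subset (T : Type) (R : realType) (K K' : set (set T)) (G : set T -> R) :
  finite_set K -> K' `<=` K -> (forall I, 0 <= G I) ->
  \sum_(I \in K') G I <= \sum_(I \in K) G I.
Proof.
move=> fK sub G0; rewrite (fsum_diff _ fK sub) lerDl fsum_ge0//; exact: finite_setD.
Qed.

Lemma rint_pow_triangle d (T : measurableType d) (R : realType)
    (nu : {measure set T -> \bar R}) (p : R) (f g : T -> R) : 0 < p ->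
  measurable_fun setT f -> measurable_fun setT g ->
  (\rint[nu]_x (`|f x + g x| `^ p) <=
   (2 `^ p)%:E * (\rint[nu]_x (`|f x| `^ p) + \rint[nu]_x (`|g x| `^ p)))%E.
Proof.
move=> p0 mf mg; rewrite -rintD; side. rewrite -rintZ; side.
apply: rint_le; [by mes|by mes|by nneg|] => x.
apply: le_trans (powRD_le (ltW p0) (normr_ge0 _) (normr_ge0 _)).
by apply: ge0_ler_powR; rewrite ?nnegrE ?(ltW p0) ?addr_ge0// ler_normD.
Qed.

(** A family with bounded square functions is summable. By superadditivity, a finite set
    [K0] whose square function has a nearly maximal integral leaves little for any
    finite set disjoint from it, and the square function inequality turns this into
    the Cauchy property of the net of partial sums. *)
Lemma Lp_sum_exists (R : realType) (p : R) : 2 < p -> exists2 C : R, 0 < C &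
  forall d (T : measurableType d) (S L : int -> set (set T))
    (nu : {measure set T -> \bar R}) (F : set T -> T -> R) (D : set (set T)) (M : R),
  atomic_filtration S L -> locally_finite L nu -> 0 <= M -> md_family L nu p D F ->
  (forall K, fsets D K ->
     (\rint[nu]_x ((\sum_(I \in K) F I x ^+ 2) `^ (p / 2)) <= M%:E)%E) ->
  exists2 g : T -> R, Lp_sum nu p D F g &
    (\rint[nu]_x (`|g x| `^ p) <= (C * M)%:E)%E.
Proof.
move=> p2; have [C C0 HC] := square_function p2.
have p0 : 0 < p by lra.
have r1 : 1 <= p / 2 by lra.
have tp0 : 0 < 2 `^ p :> R by rewrite powR_gt0.
exists (2 `^ p * C); first exact: mulr_gt0.
move=> d T S L nu F D M af lf M0 mF HM.
pose Q K := \rint[nu]_x ((\sum_(I \in K) F I x ^+ 2) `^ (p / 2)).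
have mS K : fsets D K -> measurable_fun setT (fun x => \sum_(I \in K) F I x).
  by move=> DK; apply: (@mf_fsum _ _ _ _ _ _ _ _ id K mF DK).
have mSq K : fsets D K -> measurable_fun setT (fun x => \sum_(I \in K) F I x ^+ 2).
  move=> DK; apply: (@mf_fsum _ _ _ _ _ _ _ _ (fun z => z ^+ 2) K mF DK) => h mh.
  by mes.
have Sq0 K x : fsets D K -> 0 <= \sum_(I \in K) F I x ^+ 2.
  by move=> [fK _]; apply: fsum_ge0 => // I; rewrite sqr_ge0.
have Q0 K : fsets D K -> (0 <= Q K)%E by move=> DK; apply: rint_ge0 => x; exact: powR_ge0.
have HS K : fsets D K -> (\rint[nu]_x (`|\sum_(I \in K) F I x| `^ p) <= C%:E * Q K)%E.
  by move=> [fK KD]; exact: (HC _ _ _ _ _ _ _ af lf fK (md_family_sub KD mF)).1.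
have fsU K K' : fsets D K -> fsets D K' -> fsets D (K `|` K').
  move=> [fK KD] [fK' KD']; split; first by rewrite finite_setU.
  by move=> I [/KD|/KD'].
have Qadd K K' : fsets D K -> fsets D K' -> K `&` K' `<=` set0 ->
    (Q K + Q K' <= Q (K `|` K'))%E.
  move=> DK DK' dis; have m1 := mSq _ DK; have m2 := mSq _ DK'; have m3 := mSq _ (fsU _ _ DK DK').
  rewrite /Q -rintD; side.
  apply: rint_le; [by mes|by mes|by nneg|] => x.
  have [fK _] := DK; have [fK' _] := DK'.
  rewrite fsbigU0//; apply: powR_superadd => //; exact: Sq0.
pose s := ereal_sup [set Q K | K in fsets D].
have sM : (s <= M%:E)%E by apply: ge_ereal_sup => _ [K DK <-]; exact: HM.
have s0 : (0 <= s)%E.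
  apply: (le_trans (Q0 _ (fsets_set0 D))); apply: ereal_sup_ubound.
  by exists set0 => //; exact: fsets_set0.
have sfin : s \is a fin_num by rewrite ge0_fin_numE//; apply: (le_lt_trans sM); exact: ltry.
have Qfin K : fsets D K -> Q K \is a fin_num.
  move=> DK; rewrite ge0_fin_numE ?Q0//; apply: le_lt_trans (HM _ DK) _; exact: ltry.
have small e : 0 < e -> exists K0, fsets D K0 /\
    forall K, fsets D K -> K `&` K0 `<=` set0 ->
      (\rint[nu]_x (`|\sum_(I \in K) F I x| `^ p) <= e%:E)%E.
  move=> e0; have eC : 0 < e / C by rewrite divr_gt0.
  have [_ [K0 DK0 <-] lt] := ub_ereal_sup_adherent eC sfin.
  exists K0; split=> // K DK dis.
  have h : (Q K + Q K0 <= s)%E.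
    apply: (le_trans (Qadd _ _ DK DK0 dis)); apply: ereal_sup_ubound.
    by exists (K `|` K0) => //; exact: fsU.
  have QK : (Q K <= (e / C)%:E)%E.
    exact: (ereal_slack (Qfin _ DK) (Qfin _ DK0) sfin h lt).
  apply: (le_trans (HS _ DK)).
  have -> : e = C * (e / C) by field; rewrite gt_eqF.
  by rewrite EFinM; apply: lee_wpmul2l => //; rewrite lee_fin ltW.
pose th n : R := 2^-1 ^+ n.
have th0 n : 0 < th n by rewrite /th exprn_gt0.
pose eps n := th n `^ p * (1 / (2 ^ n.+1)%:R).
have eps0 n : 0 < eps n by rewrite /eps mulr_gt0 ?powR_gt0// divr_gt0// ltr0n expn_gt0.
have epsle n : eps n <= th n `^ p.
  rewrite /eps ler_piMr ?powR_ge0// ler_pdivrMr ?ltr0n ?expn_gt0// mul1r.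
  by rewrite ler1n expn_gt0.
have [K0 HK0] := choice (fun n => small _ (eps0 n)).
(* The sets are made increasing, so that the steps of [u] are sums over differences. *)
pose Kc := fix Kc n := if n is n'.+1 then Kc n' `|` K0 n else K0 0%N.
have DKc n : fsets D (Kc n).
  by elim: n => [|n IH] /=; [exact: (HK0 0%N).1|apply: fsU => //; exact: (HK0 _).1].
have K0Kc n : K0 n `<=` Kc n by case: n => //= n I; right.
have smallc n K : fsets D K -> K `&` Kc n `<=` set0 ->
    (\rint[nu]_x (`|\sum_(I \in K) F I x| `^ p) <= (eps n)%:E)%E.
  move=> DK dis; apply: (HK0 n).2 => // I [KI K0I]; apply: (dis I); split => //.
  exact: K0Kc.
pose u n x := \sum_(I \in Kc n) F I x.
have mu_ n : measurable_fun setT (u n) by exact: mS.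
have fsD K K' : fsets D K -> fsets D (K `\` K').
  by move=> [fK KD]; split; [exact: finite_setD|move=> I [/KD]].
have diff n K : fsets D K -> Kc n `<=` K ->
    (\rint[nu]_x (`|\sum_(I \in K) F I x - u n x| `^ p) <= (eps n)%:E)%E.
  move=> DK sub; have [fK _] := DK.
  rewrite (@eq_rint _ _ _ _ _ (fun x => `|\sum_(I \in K `\` Kc n) F I x| `^ p)).
    by apply: smallc; [exact: fsD|move=> I [[_ nI] /nI]].
  by move=> x; rewrite (fsum_diff (fun I => F I x) fK sub) addrAC subrr add0r.
have [|g mg Hg] := Lp_limit p0 mu_ (nu := nu).
  by move=> n; apply: diff; [exact: DKc|move=> I KI; left].
have gap n K : fsets D K -> Kc n `<=` K ->
    (\rint[nu]_x (`|\sum_(I \in K) F I x - g x| `^ p) <=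
     (2 `^ p * (1 + 2 `^ p) * th n `^ p)%:E)%E.
  move=> DK sub; have mSK := mS _ DK.
  rewrite (@eq_rint _ _ _ _ _
    (fun x => `|(\sum_(I \in K) F I x - u n x) + (u n x - g x)| `^ p)); last first.
    by move=> x; rewrite addrA subrK.
  apply: (le_trans (rint_pow_triangle nu p0 _ _)); [by mes|by mes|].
  rewrite -mulrA EFinM; apply: lee_wpmul2l; first by rewrite lee_fin ltW.
  apply: (le_trans (leeD (diff _ _ DK sub) (Hg n))).
  by rewrite -EFinD lee_fin -/(th n) powRM ?(ltW (th0 n))// mulrDl mul1r lerD2r.
have gb : (\rint[nu]_x (`|g x| `^ p) <= (2 `^ p * C * M)%:E)%E.
  apply/lee_addgt0Pr => e e0.
  have cpos : 0 < 2 `^ p * 2 `^ p :> R by exact: mulr_gt0.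
  have [n Hn] := half_expr_small (powR_gt0 p^-1 (divr_gt0 e0 cpos)).
  have thn : th n `^ p <= e / (2 `^ p * 2 `^ p).
    have -> : e / (2 `^ p * 2 `^ p) = ((e / (2 `^ p * 2 `^ p)) `^ p^-1) `^ p.
      by rewrite -powRrM mulVf ?gt_eqF// powRr1// ltW// divr_gt0.
    by apply: ge0_ler_powR; rewrite ?nnegrE ?powR_ge0 ?(ltW p0) ?(ltW (th0 n))// ltW.
  rewrite (@eq_rint _ _ _ _ _ (fun x => `|u n x + - (u n x - g x)| `^ p)); last first.
    by move=> x; rewrite opprB addrC subrK.
  apply: (le_trans (rint_pow_triangle nu p0 _ _)); [by mes|by mes|].
  rewrite [X in (_ + X)%E](@eq_rint _ _ _ _ _ (fun x => `|u n x - g x| `^ p)); last first.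
    by move=> x; rewrite normrN.
  apply: (@le_trans _ _ ((2 `^ p)%:E * ((C * M)%:E + ((2 * th n) `^ p)%:E))%E).
    apply: lee_wpmul2l; first by rewrite lee_fin ltW.
    apply: leeD (Hg n); apply: (le_trans (HS _ (DKc n))).
    by rewrite EFinM; apply: lee_wpmul2l; [rewrite lee_fin ltW|exact: HM].
  rewrite -!EFinD -EFinM lee_fin mulrDr mulrA lerD2l powRM ?(ltW (th0 n))// mulrA.
  by rewrite mulrC -ler_pdivlMr.
exists g => //; split.
- move=> I DI; apply/(Lfun_rintP nu p0); split; last exact: (mdf_Lp mF DI).
  by have /integrableP[/measurable_EFinP] := am_integrable (mdf_mdiff mF DI).
- apply/(Lfun_rintP nu p0); split=> //; apply: (le_lt_trans gb); exact: ltry.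
move=> e e0.
have cpos : 0 < 2 `^ p * (1 + 2 `^ p) :> R by rewrite mulr_gt0// addr_gt0.
have [n Hn] := half_expr_small (powR_gt0 p^-1 (divr_gt0 (powR_gt0 p e0) cpos)).
exists (Kc n) => // K DK sub; apply/(Lnorm_lt nu p0 _ e0).
apply: (le_lt_trans (gap n K DK sub)); rewrite lte_fin.
rewrite mulrC -ltr_pdivlMr//.
have -> : e `^ p / (2 `^ p * (1 + 2 `^ p)) = ((e `^ p / (2 `^ p * (1 + 2 `^ p))) `^ p^-1) `^ p.
  by rewrite -powRrM mulVf ?gt_eqF// powRr1// ltW// divr_gt0// powR_gt0.
by apply: gt0_ltr_powR; rewrite ?nnegrE ?powR_ge0// ltW.
Qed.

(** Square functions of finite subfamilies are bounded by the sum. They grow with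
    the subfamily, which may therefore be enlarged until its sum is close to [g]. All
    the terms live in [A], so that only the part of [g] in [A] matters. *)
Lemma Lp_sum_square (R : realType) (p : R) : 2 < p -> exists2 C : R, 0 < C &
  forall d (T : measurableType d) (S L : int -> set (set T))
    (nu : {measure set T -> \bar R}) (F : set T -> T -> R) (D : set (set T))
    (g : T -> R) (A : set T) (K : set (set T)),
  atomic_filtration S L -> locally_finite L nu -> md_family L nu p D F ->
  Lp_sum nu p D F g -> measurable A -> (forall I, D I -> I `<=` A) -> fsets D K ->
  (\rint[nu]_x ((\sum_(I \in K) F I x ^+ 2) `^ (p / 2)) <=
     C%:E * \int[nu]_(x in A) (`|g x| `^ p)%:E)%E.
Proof.
move=> p2; have [C C0 HC] := square_function p2.
have p0 : 0 < p by lra.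
have r0 : 0 <= p / 2 by lra.
have tp0 : 0 < 2 `^ p :> R by rewrite powR_gt0.
have Ct0 : 0 < C * 2 `^ p by exact: mulr_gt0.
exists (C * 2 `^ p); first by [].
move=> d T S L nu F D g A K af lf mF [_ gL HS] mA DA DK.
have /(Lfun_rintP nu p0)[mg _] := gL.
rewrite -rint_restrict//; apply/lee_addgt0Pr => e e0.
pose e' := (e / (C * 2 `^ p)) `^ p^-1.
have e'0 : 0 < e' by rewrite powR_gt0// divr_gt0.
have e'E : e' `^ p = e / (C * 2 `^ p).
  by rewrite -powRrM mulVf ?gt_eqF// powRr1// ltW// divr_gt0.
have [K0 DK0 HK0] := HS e' e'0.
(* [K0] makes the sum close to [g]; adding [K] costs nothing. *)
pose K1 := K `|` K0.
have DK1 : fsets D K1.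
  move: DK DK0 => [fK KD] [fK' KD']; split; first by rewrite finite_setU.
  by move=> I [/KD|/KD'].
have [fK1 K1D] := DK1.
have /(Lnorm_lt nu p0 _ e'0) Hlt := HK0 K1 DK1 (@subsetUr _ K K0).
have mF1 := md_family_sub K1D mF.
have [_ low] := HC _ _ _ _ _ _ _ af lf fK1 mF1.
have mS : measurable_fun setT (fun x => \sum_(I \in K1) F I x).
  by apply: (@mf_fsum _ _ _ _ _ _ _ _ id K1 mF DK1).
have mSq K2 : fsets D K2 -> measurable_fun setT (fun x => \sum_(I \in K2) F I x ^+ 2).
  move=> DK2; apply: (@mf_fsum _ _ _ _ _ _ _ _ (fun z => z ^+ 2) K2 mF DK2) => h mh.
  by mes.
have m1 := mSq _ DK; have m2 := mSq _ DK1; have [fK _] := DK.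
apply: (@le_trans _ _ (\rint[nu]_x ((\sum_(I \in K1) F I x ^+ 2) `^ (p / 2)))).
  apply: rint_le; [by mes|by mes|by nneg|] => x.
  apply: ge0_ler_powR; rewrite ?nnegrE//.
  - by apply: fsum_ge0 => // I; rewrite sqr_ge0.
  - by apply: fsum_ge0 => // I; rewrite sqr_ge0.
  - by apply: fsum_subset => //; [exact: subsetUl|move=> I; rewrite sqr_ge0].
apply: (le_trans low).
have outA x : ~ A x -> \sum_(I \in K1) F I x = 0.
  move=> nA; apply: fsbig1 => I /K1D DI; apply: (am_supp (mdf_mdiff mF DI)) => Ix.
  by apply: nA; exact: DA DI _ Ix.
have mgA : measurable_fun setT (fun x => g x * \1_A x) by mes.
have loc : (\rint[nu]_x (`|\sum_(I \in K1) F I x| `^ p) <=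
   (2 `^ p)%:E * (\rint[nu]_x (`|\sum_(I \in K1) F I x - g x| `^ p) +
                  \rint[nu]_x (`|g x| `^ p * \1_A x)))%E.
  rewrite -rintD; side. rewrite -rintZ; side.
  apply: rint_le; [by mes|by mes|by nneg|] => x.
  have [Ax|nA] := pselect (A x); last first.
    by rewrite outA// normr0 powR0 ?gt_eqF//; nneg.
  rewrite indicE mem_set// mulr1.
  apply: le_trans (powRD_le (ltW p0) (normr_ge0 _) (normr_ge0 _)).
  apply: ge0_ler_powR; rewrite ?nnegrE ?(ltW p0) ?addr_ge0//.
  by apply: le_trans (ler_normD _ _); rewrite subrK.
apply: (@le_trans _ _ (C%:E * ((2 `^ p)%:E * ((e' `^ p)%:E + \rint[nu]_x (`|g x| `^ p * \1_A x))))%E).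
  apply: lee_wpmul2l; first by rewrite lee_fin ltW.
  apply: (le_trans loc); apply: lee_wpmul2l; first by rewrite lee_fin ltW.
  by apply: leeD => //; exact: ltW.
have I0 : (0 <= \rint[nu]_x (`|g x| `^ p * \1_A x))%E by apply: rint_ge0; nneg.
rewrite muleA -EFinM ge0_muleDr ?lee_fin ?powR_ge0//.
rewrite -EFinM e'E addeC; apply: leeD => //.
rewrite lee_fin le_eqVlt; apply/orP; left; apply/eqP.
by field; rewrite !gt_eqF.
Qed.

(** * Necessity of the first condition *)

Section setting.
Context d (T : measurableType d) (R : realType).
Variables (S L : int -> set (set T)) (mu nu : {measure set T -> \bar R}) (p : R)
  (b : symbol T R).
Hypotheses (af : atomic_filtration S L) (lmu : locally_finite L mu)
  (lnu : locally_finite L nu) (sb : is_symbol L nu b) (p2 : 2 < p).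

Definition paraproduct_term (f : T -> R) (I : set T) (x : T) :=
  expect mu I f x * symbol_diff L nu b I x.

(** Follows from boundedness as well as from the first testing condition, and provides the
    a priori finiteness needed by the estimates for finite sums. *)
Definition symbol_in_Lp := forall I, atoms L I -> mu I != 0%E ->
  (\rint[nu]_x (`|symbol_diff L nu b I x| `^ p) < +oo)%E.

Let p0 : 0 < p. Proof. by move: p2; lra. Qed.

Lemma mf_symbol_diff I : atoms L I -> measurable_fun setT (symbol_diff L nu b I).
Proof.
move=> aI.
by have /integrableP[/measurable_EFinP] := am_integrable (symbol_diff_atom_mdiff af lnu sb aI).
Qed.

Lemma paraproduct_termE f I : atoms L I ->
  paraproduct_term f I = (fun x => average mu f I * symbol_diff L nu b I x).
Proof.
move=> aI; apply/funext => x; rewrite /paraproduct_term /expect.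
have [Ix|nI] := pselect (I x); first by rewrite indicE mem_set// mulr1.
by rewrite (am_supp (symbol_diff_atom_mdiff af lnu sb aI) nI) !mulr0.
Qed.

Lemma paraproduct_term_md_family f : symbol_in_Lp -> md_family L nu p (atoms L) (paraproduct_term f).
Proof.
move=> sLp; split=> // I aI; rewrite (paraproduct_termE f aI).
  exact: atom_mdiffZ (symbol_diff_atom_mdiff af lnu sb aI).
have md := mf_symbol_diff aI.
have [I0|I0] := eqVneq (mu I) 0%E.
  rewrite (@eq_rint _ _ _ _ _ (fun=> 0)); first by rewrite /rint integral0.
  by move=> x; rewrite average0// mul0r normr0 powR0// gt_eqF.
rewrite (@eq_rint _ _ _ _ _ (fun x => `|average mu f I| `^ p * `|symbol_diff L nu b I x| `^ p)).
  rewrite rintZ; side.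
  by rewrite lte_mul_pinfty ?lee_fin ?powR_ge0//; exact: sLp.
by move=> x; rewrite normrM powRM.
Qed.

Lemma symbol_md_family D : symbol_in_Lp -> (forall I, D I -> atoms L I /\ mu I != 0%E) ->
  md_family L nu p D (symbol_diff L nu b).
Proof.
move=> sLp DL; split.
- by move=> I /DL[].
- by move=> I /DL[aI _]; exact: (symbol_diff_atom_mdiff af lnu sb aI).
- by move=> I /DL[]; exact: sLp.
Qed.

Lemma average_indic_sub I J : atoms L I -> measurable J -> I `<=` J -> mu I != 0%E ->
  average mu (\1_J) I = 1.
Proof.
move=> aI mJ IJ I0; have mI := atom_measurable af aI.
have fin : mu I \is a fin_num by rewrite ge0_fin_numE//; exact: lmu.
rewrite /average /eaverage.
have -> : (\int[mu]_(x in I) (EFin \o \1_J) x = mu I)%E.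
  by rewrite /= integral_indic//; congr (mu _); apply/setIidPr.
by rewrite -{2}(fineK fin) -EFinM /= mulVf// fine_eq0.
Qed.

Lemma rint_indic_powR (s : R) (J : set T) (m : {measure set T -> \bar R}) : 0 < s ->
  measurable J -> \rint[m]_x (`|\1_J x| `^ s) = m J.
Proof.
move=> s0 mJ; rewrite (@eq_rint _ _ _ _ _ (fun x => 1 * \1_J x)); last first.
  move=> x; rewrite mul1r indicE; case: (x \in J); first by rewrite normr1 powR1.
  by rewrite normr0 powR0// gt_eqF.
by rewrite rint_indic// mul1e.
Qed.

Lemma indic_Lfun J : atoms L J -> (\1_J : T -> R) \in Lfun mu p%:E.
Proof.
move=> aJ; have mJ := atom_measurable af aJ.
apply/(Lfun_rintP mu p0); split; first by mes.
by rewrite rint_indic_powR//; exact: lmu.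
Qed.

(** The term of the paraproduct of [\1_I] with index [I] is the difference of the symbol
    itself. *)
Lemma symbol_in_Lp_bound a : paraproduct_bound L mu nu p b a -> symbol_in_Lp.
Proof.
move=> bd I aI I0; have [g [/(_ I aI) + _ _] _] := bd _ (indic_Lfun aI).
have E x : expect mu I \1_I x * symbol_diff L nu b I x = symbol_diff L nu b I x.
  have := congr1 (fun h : T -> R => h x) (paraproduct_termE \1_I aI).
  by rewrite average_indic_sub// ?mul1r//; exact: (atom_measurable af aI).
move=> /(Lfun_rintP nu p0)[_].
by under eq_rint do rewrite E.
Qed.

Lemma symbol_in_Lp_testing B : symbol_testing L mu nu p b B -> symbol_in_Lp.
Proof.
move=> ts I aI I0; have [g [/(_ I) + _ _] _] := ts I aI.
by move=> /(_ _)/(Lfun_rintP nu p0)[] //; split => //; split.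
Qed.

Lemma paraproduct_term0 f I x : mu I = 0%E -> paraproduct_term f I x = 0.
Proof. by move=> I0; rewrite /paraproduct_term /expect average0// !mul0r. Qed.

End setting.

(** Boundedness of the paraproduct without signs. *)
Lemma square_of_bound (R : realType) (p : R) : 2 < p -> exists2 C : R, 0 < C &
  forall d (T : measurableType d) (S L : int -> set (set T))
    (mu nu : {measure set T -> \bar R}) (b : symbol T R) (a : R) (f : T -> R) K,
  atomic_filtration S L -> locally_finite L mu -> locally_finite L nu ->
  is_symbol L nu b -> paraproduct_bound L mu nu p b a ->
  f \in Lfun mu p%:E -> fsets (atoms L) K ->
  (\rint[nu]_x ((\sum_(I \in K) paraproduct_term L mu nu b f I x ^+ 2) `^ (p / 2)) <=
     (C * a `^ p)%:E * \rint[mu]_x (`|f x| `^ p))%E.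
Proof.
move=> p2; have [C C0 HC] := Lp_sum_square p2.
have p0 : 0 < p by lra.
exists C => // d T S L mu nu b a f K af lmu lnu sb bd fL aK.
have [g Hg gf] := bd f fL.
have sLp := symbol_in_Lp_bound af lmu lnu sb p2 bd.
have mF := paraproduct_term_md_family af lnu sb p2 f sLp.
have /le_trans := HC _ _ _ _ _ _ _ g setT K af lnu mF Hg measurableT (fun I _ => @subsetT _ _) aK.
apply; rewrite EFinM -muleA; apply: lee_wpmul2l; first by rewrite lee_fin ltW.
by rewrite !(powR_Lnorm_rint _ p0) in gf.
Qed.

(** The paraproduct is applied to [\1_J], whose average is [1] on every subatom of [J]
    that is not null. The terms with larger atoms do not disturb, because square
    functions over subfamilies are controlled. *)
Lemma symbol_testing_of_bound (R : realType) (p : R) : 2 < p -> exists2 C : R, 0 < C &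
  forall d (T : measurableType d) (S L : int -> set (set T))
    (mu nu : {measure set T -> \bar R}) (b : symbol T R) (a : R),
  atomic_filtration S L -> locally_finite L mu -> locally_finite L nu ->
  is_symbol L nu b -> 0 <= a -> paraproduct_bound L mu nu p b a ->
  symbol_testing L mu nu p b (C * a).
Proof.
move=> p2; have [C1 C10 H1] := square_of_bound p2; have [C2 C20 H2] := Lp_sum_exists p2.
have p0 : 0 < p by lra.
have C0 : 0 < C2 * C1 by exact: mulr_gt0.
exists ((C2 * C1) `^ p^-1); first by rewrite powR_gt0.
move=> d T S L mu nu b a af lmu lnu sb a0 bd J aJ.
have mJ := atom_measurable af aJ.
have sLp := symbol_in_Lp_bound af lmu lnu sb p2 bd.
have finJ : mu J \is a fin_num by rewrite ge0_fin_numE//; exact: lmu.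
have aD I : (subatoms L J `&` [set I | mu I != 0%E]) I -> atoms L I /\ mu I != 0%E.
  by move=> [[]].
have mF := symbol_md_family af lnu sb sLp aD.
have M0 : 0 <= C1 * a `^ p * fine (mu J).
  by rewrite !mulr_ge0 ?powR_ge0 ?fine_ge0// ltW.
have [|g Hg gM] := H2 _ _ _ _ _ _ _ _ af lnu M0 mF.
  move=> K [fK KD]; rewrite EFinM fineK// -(rint_indic_powR mu p0 mJ).
  apply: le_trans (H1 _ _ _ _ _ _ _ _ _ K af lmu lnu sb bd (indic_Lfun af lmu p2 aJ) _); last first.
    by split => // I /KD[[]].
  rewrite le_eqVlt; apply/orP; left; apply/eqP; apply: eq_rint => x; congr (_ `^ _).
  apply: eq_fsbigr => I; rewrite inE => /KD[[aI IJ] I0].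
  by rewrite (paraproduct_termE mu af lnu sb _ aI) (average_indic_sub af lmu aI)// mul1r.
exists g => //.
have [_ /(Lfun_rintP nu p0)[mg _] _] := Hg.
rewrite -rint_restrict//.
apply: (@le_trans _ _ (\rint[nu]_x (`|g x| `^ p))).
  apply: rint_le; [by mes|by mes|by nneg|] => x.
  by rewrite ler_piMr ?powR_ge0// indicE; case: (_ \in _).
apply: (le_trans gM); rewrite -{2}(fineK finJ) -EFinM lee_fin.
rewrite powRM ?powR_ge0// -powRrM mulVf ?gt_eqF// powRr1 ?(ltW C0)//.
by rewrite !mulrA.
Qed.

(** * Necessity of the condition on squares *)

(** The unordered sum over a countable set becomes the limit of an increasing
    sequence of finite sums. *)
Lemma countable_exhaustion (T : Type) (A : set (set T)) : countable A ->
  exists Kn : nat -> set (set T),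
    [/\ forall n, fsets A (Kn n), forall n m, (n <= m)%N -> Kn n `<=` Kn m &
        forall K, fsets A K -> exists n, K `<=` Kn n].
Proof.
move=> /countable_injP[g ginj].
pose Kn n := [set I | A I /\ (g I < n)%N].
exists Kn; split.
- move=> n; split; last by move=> I [].
  pose e m := xget set0 [set I | A I /\ g I = m].
  apply: (sub_finite_set _ (finite_image e (finite_II n))) => I [AI gI].
  exists (g I) => //; rewrite /e; case: xgetP => [I' _ [AI' gE]|/(_ I)[]//].
  by apply: ginj; rewrite ?inE.
- by move=> n m nm I [AI gI]; split=> //; exact: leq_trans nm.
- move=> K [/finite_seqP[s ->] sA]; exists (\max_(I <- s) g I).+1 => I sI.
  by split; [exact: sA|rewrite ltnS leq_bigmax_seq].
Qed.

Section esum_power.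
Context d (T : measurableType d) (R : realType) (mu : {measure set T -> \bar R}).
Variables (A : set (set T)) (t : set T -> T -> R) (s : R) (J : set T).
Hypotheses (cA : countable A) (t0 : forall I x, 0 <= t I x)
  (mt : forall I, A I -> measurable_fun setT (t I)) (s0 : 0 < s) (mJ : measurable J).

Lemma mf_fsum_in K : fsets A K -> measurable_fun setT (fun x => \sum_(I \in K) t I x).
Proof.
move=> [/sort_by_inclusion[l [ul <- _]] KA].
rewrite (_ : (fun _ => _) = fun x => \sum_(k < size l) t (nth set0 l k) x); last first.
  by apply/funext => x; rewrite (fsum_nth (fun I => t I x)).
by apply: mf_sum => k; apply: mt; apply: KA; rewrite /= mem_nth.
Qed.

(** An integral of a power of an unordered sum can be reached by finite sums through
    monotone convergence. *)
Lemma esum_power_lim : exists g : nat -> T -> \bar R,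
  [/\ forall n, exists2 K, fsets A K & g n = fun x => ((\sum_(I \in K) t I x) `^ s)%:E,
      forall x, nondecreasing_seq (g ^~ x) &
      forall x, ((\esum_(I in A) (t I x)%:E) `^ s)%E = limn (g ^~ x)].
Proof.
have [Kn [fKn monoKn exhKn]] := countable_exhaustion cA.
pose g n x := ((\sum_(I \in Kn n) t I x) `^ s)%:E.
have gnd x : nondecreasing_seq (g ^~ x).
  move=> n m nm; rewrite lee_fin; have [fm _] := fKn m; have [fn _] := fKn n.
  apply: ge0_ler_powR; rewrite ?nnegrE ?(ltW s0) ?fsum_ge0//.
  by apply: fsum_subset => //; exact: monoKn.
exists g; split => //; first by move=> n; exists (Kn n).
move=> x; have cv : cvgn (g ^~ x) by exact: ereal_nondecreasing_is_cvgn.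
have e0 : (0 <= \esum_(I in A) (t I x)%:E)%E.
  by apply: esum_ge0 => I _; rewrite lee_fin.
have g0 n : (0 <= g n x)%E by rewrite lee_fin powR_ge0.
have gle n : (g n x <= limn (g ^~ x))%E.
  apply: lime_ge => //; exists n => // m /= nm; exact: gnd.
have lim0 : (0 <= limn (g ^~ x))%E := le_trans (g0 0%N) (gle 0%N).
have inI y : (0 <= y)%E -> y \in `[(0 : \bar R)%E, +oo%E] by move=> y0; rewrite in_itv /= y0 ?leey.
apply/eqP; rewrite eq_le; apply/andP; split.
  have -> : (limn (g ^~ x) = (limn (g ^~ x) `^ s^-1) `^ s)%E.
    by rewrite -poweRrM mulVf ?gt_eqF// poweRe1.
  apply: gt0_ler_poweR; rewrite ?(ltW s0) ?inI ?poweR_ge0//.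
  apply: ge_ereal_sup => _ [K AK <-]; have [n Kn_] := exhKn K AK.
  have [fK _] := AK; have [fn _] := fKn n.
  rewrite fsumEFin//; apply: (@le_trans _ _ ((g n x) `^ s^-1)%E); last first.
    by apply: gt0_ler_poweR; rewrite ?invr_ge0 ?(ltW s0) ?inI.
  rewrite /g poweR_EFin -powRrM mulfV ?gt_eqF// powRr1 ?fsum_ge0// lee_fin.
  exact: fsum_subset.
apply: lime_le => //; apply: nearW => n; rewrite /g -poweR_EFin.
have [fn _] := fKn n.
apply: gt0_ler_poweR; rewrite ?(ltW s0) ?inI ?lee_fin ?fsum_ge0//.
by rewrite -fsumEFin//; apply: ereal_sup_ubound; exists (Kn n).
Qed.

Lemma int_esum_pow_le (M : \bar R) :
  (forall K, fsets A K -> (\rint[mu]_x ((\sum_(I \in K) t I x) `^ s) <= M)%E) ->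
  (\int[mu]_(x in J) ((\esum_(I in A) (t I x)%:E) `^ s) <= M)%E.
Proof.
move=> H; have [g [gK gnd gl]] := esum_power_lim.
under eq_integral do rewrite gl.
have mg n : measurable_fun setT (g n).
  have [K AK ->] := gK n; apply/measurable_EFinP; have := mf_fsum_in AK => ?.
  by mes.
have mgJ n : measurable_fun J (g n) by apply: measurable_funTS.
have g0 n x : (0 <= g n x)%E by have [K AK ->] := gK n; rewrite lee_fin powR_ge0.
rewrite monotone_convergence//; apply: lime_le.
  apply: ereal_nondecreasing_is_cvgn => n m nm; apply: ge0_le_integral => //.
  by move=> x _; exact: gnd.
apply: nearW => n; have [K AK E] := gK n; apply: le_trans (H K AK).
rewrite /rint -(_ : g n = fun x => ((\sum_(I \in K) t I x) `^ s)%:E)//.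
exact: ge0_subset_integral.
Qed.

Lemma le_int_esum_pow K : fsets A K ->
  (\rint[mu]_x ((\sum_(I \in K) t I x) `^ s * \1_J x) <=
   \int[mu]_(x in J) ((\esum_(I in A) (t I x)%:E) `^ s))%E.
Proof.
move=> AK; rewrite rint_restrict//.
have [g [gK gnd gl]] := esum_power_lim.
have mS := mf_fsum_in AK.
have mg n : measurable_fun setT (g n).
  by have [K' AK' ->] := gK n; apply/measurable_EFinP; have := mf_fsum_in AK' => ?; mes.
have [fK _] := AK.
apply: ge0_le_integral => //.
- by move=> x _; rewrite lee_fin powR_ge0.
- by apply: measurable_funTS; apply/measurable_EFinP; mes.
- apply: measurable_funTS.
  rewrite (_ : (fun _ => _) = fun x => limn (g ^~ x)); last by apply/funext.
  apply: (@emeasurable_fun_cvg _ _ _ setT g) => // x _; exact: ereal_nondecreasing_is_cvgn.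
move=> x _; rewrite -poweR_EFin; apply: gt0_ler_poweR; first exact: ltW.
- by rewrite in_itv /= lee_fin leey fsum_ge0.
- by rewrite in_itv /= leey esum_ge0// => I _; rewrite lee_fin.
by rewrite -fsumEFin//; apply: ereal_sup_ubound; exists K.
Qed.

End esum_power.

Section square_terms.
Context d (T : measurableType d) (R : realType).
Variables (S L : int -> set (set T)) (mu nu : {measure set T -> \bar R}) (p : R)
  (b : symbol T R).
Hypotheses (af : atomic_filtration S L) (lmu : locally_finite L mu)
  (lnu : locally_finite L nu) (sb : is_symbol L nu b) (p2 : 2 < p)
  (sLp : symbol_in_Lp L mu nu p b).

Definition energy (I : set T) : R := fine (\rint[nu]_x (symbol_diff L nu b I x ^+ 2)).

(** The coefficient [al k] of the positive operator: [nu I / mu I] times the average of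
    the squared difference. *)
Definition density (I : set T) : R := energy I / fine (mu I).

Lemma energy_ge0 I : 0 <= energy I.
Proof. by apply: fine_ge0; apply: rint_ge0 => x; exact: sqr_ge0. Qed.

Lemma density_ge0 I : 0 <= density I.
Proof. by rewrite divr_ge0 ?energy_ge0// fine_ge0. Qed.

(** Squares are integrable because [t ^+ 2 <= `|t| `^ p + 1] and the atom has finite
    measure. *)
Lemma energyE I : atoms L I -> mu I != 0%E ->
  \rint[nu]_x (symbol_diff L nu b I x ^+ 2) = (energy I)%:E.
Proof.
move=> aI I0; rewrite fineK// ge0_fin_numE; last by apply: rint_ge0 => x; exact: sqr_ge0.
have md := mf_symbol_diff af lnu sb aI.
have mI := atom_measurable af aI.
have supp := am_supp (symbol_diff_atom_mdiff af lnu sb aI).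
apply: (@le_lt_trans _ _ (\rint[nu]_x (`|symbol_diff L nu b I x| `^ p + 1 * \1_I x))).
  apply: rint_le; [by mes|by mes|by nneg|] => x.
  have [Ix|nI] := pselect (I x); last first.
    by rewrite supp// normr0 powR0 ?gt_eqF ?expr2 ?mul0r ?mulr_ge0//; move: p2; lra.
  rewrite indicE mem_set// mulr1 -real_normK ?num_real//.
  set y := `|_|; have y0 : 0 <= y by exact: normr_ge0.
  have [y1|/ltW y1] := leP y 1.
    by have := powR_ge0 y p; have := exprn_ile1 2 y0 y1; lra.
  rewrite -powR2// (le_trans (ler_powR y1 (ltW p2)))//; lra.
rewrite rintD; side. rewrite rint_indic// mul1e lte_add_pinfty//; first exact: sLp.
exact: lnu.
Qed.

Lemma square_termE I x : atoms L I ->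
  ((fine (nu I) / fine (mu I))%:E *
     eexpect nu I (fun y => (`|symbol_diff L nu b I y| ^+ 2)%:E) x =
   (density I * \1_I x)%:E)%E.
Proof.
move=> aI; rewrite /eexpect /eaverage /density.
have [I0|I0] := eqVneq (mu I) 0%E; first by rewrite I0 /= invr0 !mulr0 mul0r mul0e.
have mI := atom_measurable af aI.
have supp := am_supp (symbol_diff_atom_mdiff af lnu sb aI).
have -> : (\int[nu]_(x0 in I) (`|symbol_diff L nu b I x0| ^+ 2)%:E = (energy I)%:E)%E.
  rewrite -(energyE aI I0) -rint_restrict//; apply: eq_rint => y.
  rewrite real_normK ?num_real//; have [Iy|nI] := pselect (I y).
    by rewrite indicE mem_set// mulr1.
  by rewrite supp// expr2 !mul0r.
rewrite -!EFinM; congr EFin.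
have [n0|n0] := eqVneq (nu I) 0%E; last first.
  field; apply/andP; split; rewrite fine_eq0// ge0_fin_numE//; [exact: lmu|exact: lnu].
have -> : energy I = 0.
  rewrite /energy.
  rewrite (@eq_rint _ _ _ _ _ (fun x => symbol_diff L nu b I x ^+ 2 * \1_I x)); last first.
    move=> y; have [Iy|nI] := pselect (I y); first by rewrite indicE mem_set// mulr1.
    by rewrite supp// expr2 !mul0r.
  rewrite rint_restrict// null_set_integral//.
  have md := mf_symbol_diff af lnu sb aI.
  by apply: measurable_funTS; apply/measurable_EFinP; mes.
by rewrite !(mul0r, mulr0).
Qed.

End square_terms.

Lemma Lp_integrable_on d (T : measurableType d) (R : realType)
    (m : {measure set T -> \bar R}) (p : R) (g : T -> R) (I : set T) : 1 <= p ->
  measurable_fun setT g -> (\rint[m]_x (`|g x| `^ p) < +oo)%E -> measurable I ->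
  (m I < +oo)%E -> m.-integrable I (EFin \o g).
Proof.
move=> p1 mg fing mI fI; apply/integrableP; split.
  by apply: measurable_funTS; exact/measurable_EFinP.
rewrite (eq_integral (fun x => (`|g x|)%:E))// -rint_restrict//.
apply: (@le_lt_trans _ _ (\rint[m]_x (`|g x| `^ p + 1 * \1_I x))).
  apply: rint_le; [by mes|by mes|by nneg|] => x.
  have [Ix|nI] := pselect (I x); last first.
    by rewrite indicE memNset// !mulr0 addr0 powR_ge0.
  rewrite indicE mem_set// !mulr1; have y0 := normr_ge0 (g x).
  have [y1|/ltW y1] := leP `|g x| 1; first by have := powR_ge0 `|g x| p; lra.
  by rewrite (le_trans (le1r_powR y1 p1))// lerDl.
by rewrite rintD; side; rewrite rint_indic// mul1e lte_add_pinfty.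
Qed.

(** Let [Y] be the sum of the densities over finitely many subatoms of [J]. By the chain
    rule, the integral of [Y `^ r'] is at most [r'] times the sum of
    [energy I * y I `^ (r' - 1)], where [y I] is the value on [I] of the partial sum
    over the atoms containing [I]. The paraproduct is tested on the function
    [f = Y `^ ((r' - 1) / 2)]: its average over [I] has a square of at least
    [y I `^ (r' - 1)], so that the sum is dominated by the integral of the square
    function of the paraproduct of [f] over [J]; and [`|f| `^ p = Y `^ r']. Young's
    inequality on [J] and the bound of the paraproduct allow to absorb. *)
Lemma square_testing_of_bound (R : realType) (p r r' : R) : 2 < p -> r = p / 2 ->
  r^-1 + r'^-1 = 1 -> exists2 C : R, 0 < C &
  forall d (T : measurableType d) (S L : int -> set (set T))
    (mu nu : {measure set T -> \bar R}) (b : symbol T R) (a : R),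
  atomic_filtration S L -> locally_finite L mu -> locally_finite L nu ->
  is_symbol L nu b -> 0 < a -> paraproduct_bound L mu nu p b a ->
  square_testing L mu nu r' b (C * a ^+ 2).
Proof.
move=> p2 rE rr; have p0 : 0 < p by lra.
have r1 : 1 < r by rewrite rE; lra.
have r0 : 0 < r by lra.
have [r'1 e1 e2] := conj_exponent r1 rr.
have r'0 : 0 < r' by lra.
have [C1 C10 H1] := square_of_bound p2.
have B0 : 0 < 2 * r' * C1 by rewrite !mulr_gt0.
exists ((2 * r') `^ r'^-1 * (2 * r' * C1) `^ r^-1).
  by rewrite mulr_gt0 ?powR_gt0// mulr_gt0.
move=> d T S L mu nu b a af lmu lnu sb a0 bd J aJ.
have mJ := atom_measurable af aJ.
have sLp := symbol_in_Lp_bound af lmu lnu sb p2 bd.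
set C := _ * _.
rewrite (eq_integral (fun x => (\esum_(I in subatoms L J) (density L mu nu b I * \1_I x)%:E) `^ r')%E); last first.
  by move=> x _; congr (_ `^ _)%E; apply: eq_esum => I [aI _]; exact: (square_termE af lmu lnu sb p2 sLp).
apply: int_esum_pow_le => //.
- apply: (@sub_countable _ _ _ (atoms L)).
    by apply: subset_card_le => I [].
  by apply: bigcup_countable => // n _; exact: af_countable af n.
- by move=> I x; rewrite mulr_ge0// density_ge0.
- by move=> I [aI _]; have := atom_measurable af aI => mI; mes.
move=> K [fK KJ].
have [s [us KE sinc]] := sort_by_inclusion fK.
have sL : [set` s] `<=` atoms L by rewrite KE => I /KJ[].
pose I k := nth set0 s k; pose N := size s.
have tI : tree_ordered I by exact: (tree_ordered_atoms af).
have aI k : (k < N)%N -> atoms L (I k) by move=> kN; apply: sL; rewrite /= mem_nth.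
have mI k : measurable (I k).
  by have [kN|kN] := ltnP k N; [exact: (atom_measurable af (aI k kN))|rewrite /I nth_default].
have IJ k : (k < N)%N -> I k `<=` J.
  by move=> kN; have : K (I k); [rewrite -KE /= mem_nth|move=> /KJ[]].
pose al k := density L mu nu b (I k).
have al0 k : 0 <= al k by exact: density_ge0.
pose X k x := al k * \1_(I k) x.
have X0 k x : 0 <= X k x by rewrite mulr_ge0.
have mX k : measurable_fun setT (X k) by rewrite /X; have := mI k => ?; mes.
pose Y n := psum X n.
have mY n : measurable_fun setT (Y n) by exact: mf_psum.
have Y0 n x : 0 <= Y n x by exact: psum_ge0.
pose G := \rint[mu]_x (Y N x `^ r').
have -> : \rint[mu]_x ((\sum_(I \in K) density L mu nu b I * \1_I x) `^ r') = G.
  apply: eq_rint => x; rewrite -KE.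
  by rewrite (fsum_nth (fun I => density L mu nu b I * \1_I x) us).
have Gfin : (G < +oo)%E.
  rewrite /G (@eq_rint _ _ _ _ _ (fun x => `|Y N x| `^ r')); last by move=> x; rewrite ger0_norm.
  apply: psum_Lp_fin; [exact: r'0|exact: mX|] => k.
  rewrite (@eq_rint _ _ _ _ _ (fun x => al k `^ r' * \1_(I k) x)); last first.
    move=> x; rewrite ger0_norm// powRM//; congr (_ * _).
    by rewrite indicE; case: (_ \in _); rewrite ?powR1// powR0// gt_eqF.
  rewrite rint_indic ?powR_ge0//.
  have [kN|kN] := ltnP k N; last by rewrite /I nth_default// measure0 mule0 ltry.
  by rewrite lte_mul_pinfty ?lee_fin ?powR_ge0//; apply: lmu; exact: aI.
have G0 : (0 <= G)%E by apply: rint_ge0 => x; exact: powR_ge0.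
have [y y0 Hy] : exists2 y : nat -> R, (forall k, 0 <= y k) & forall k x, I k x -> Y k.+1 x = y k.
  have H k : exists c, forall x, I k x -> Y k.+1 x = c.
    apply: (const_on 0) => x z Ix Iz; rewrite /Y !psumS; congr (_ + _); last first.
      by rewrite /X !indicE !mem_set.
    apply: eq_bigr => j _; rewrite /X; congr (_ * _).
    exact: (tree_ordered_indic _ tI (ltn_ord j) Ix Iz).
  have [c Hc] := choice H; exists (fun k => `|c k|) => [k|k x Ix]; first exact: normr_ge0.
  by rewrite -(Hc k x Ix) ger0_norm.
pose f x := Y N x `^ ((r' - 1) / 2).
have f0 x : 0 <= f x by exact: powR_ge0.
have mf : measurable_fun setT f by rewrite /f; mes.
have fp x : `|f x| `^ p = Y N x `^ r'.
  rewrite ger0_norm// /f -powRrM; congr (_ `^ _).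
  by rewrite -[RHS]e2 rE; field.
have ffin : (\rint[mu]_x (`|f x| `^ p) < +oo)%E by rewrite (eq_rint _ fp).
have favg k : (k < N)%N -> mu (I k) != 0%E ->
    y k `^ (r' - 1) <= average mu f (I k) ^+ 2.
  move=> kN m0.
  have lt : (mu (I k) < +oo)%E by apply: lmu; exact: aI.
  have ge0m : (0 < mu (I k))%E by rewrite lt0e m0 /=.
  have intf : mu.-integrable (I k) (EFin \o f).
    by apply: (@Lp_integrable_on _ _ _ _ p) => //; lra.
  have : ((y k `^ ((r' - 1) / 2))%:E * mu (I k) <= (average mu f (I k))%:E * mu (I k))%E.
    rewrite (average_mul (mI k) lt intf) -(rint_restrict _ _ (mI k)).
    rewrite -rint_indic; [|exact: mI|exact: powR_ge0].
    apply: rint_le; [by mes|by mes|by nneg|] => x.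
    have [Ix|nI] := pselect (I k x); last by rewrite indicE memNset// !mulr0.
    rewrite ler_wpM2r// -(Hy k x Ix); apply: ge0_ler_powR; rewrite ?nnegrE//.
      by rewrite divr_ge0//; lra.
    exact: psum_mono.
  have fm : mu (I k) \is a fin_num by rewrite ge0_fin_numE.
  rewrite lee_pmul2r// lee_fin => h.
  have -> : y k `^ (r' - 1) = (y k `^ ((r' - 1) / 2)) ^+ 2.
    by rewrite -powR2 ?powR_ge0// -powRrM; congr (_ `^ _); field.
  by rewrite ler_sqr ?nnegrE ?powR_ge0// (le_trans _ h)// powR_ge0.
pose Q x := \sum_(k < N) paraproduct_term L mu nu b f (I k) x ^+ 2.
have QE x : Q x = \sum_(I \in K) paraproduct_term L mu nu b f I x ^+ 2.
  by rewrite -KE (fsum_nth (fun I => paraproduct_term L mu nu b f I x ^+ 2) us).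
have mpar k : measurable_fun setT (fun x => if (k < N)%N then paraproduct_term L mu nu b f (I k) x else 0).
  case: (boolP (k < N)%N) => kN; last exact: mf_cst.
  rewrite (paraproduct_termE mu af lnu sb f (aI k kN)).
  by have := mf_symbol_diff af lnu sb (aI k kN) => ?; mes.
have mpar' (k : 'I_N) : measurable_fun setT (paraproduct_term L mu nu b f (I k)).
  by have := mpar k; rewrite ltn_ord.
have mQ : measurable_fun setT Q by apply: mf_sum => k; have := mpar' k => ?; mes.
have Q0 x : 0 <= Q x by apply: sumr_ge0 => k _; exact: sqr_ge0.
have step1 : (G <= r'%:E * rint nu Q)%E.
  apply: (@le_trans _ _ (\rint[mu]_x (r' * \sum_(k < N) (al k * y k `^ (r' - 1)) * \1_(I k) x))).
    apply: rint_le; [by mes|by mes|by nneg|] => x.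
    apply: le_trans (psum_powR_le N r'1 (fun k => X0 k x)) _.
    rewrite ler_wpM2l ?(ltW r'0)//; apply: ler_sum => k _; rewrite /X.
    have [Ix|nI] := pselect (I k x); last by rewrite indicE memNset// !mulr0 mul0r.
    by rewrite -(Hy k x Ix) indicE mem_set// !mulr1.
  rewrite rintZ; side. rewrite rint_sum; side.
  apply: lee_wpmul2l; first by rewrite lee_fin ltW.
  have -> : rint nu Q = (\sum_(k < N) \rint[nu]_x (paraproduct_term L mu nu b f (I k) x ^+ 2))%E.
    rewrite /Q rint_sum; [by []| |by move=> k x; exact: sqr_ge0].
    by move=> k; have := mpar' k => ?; mes.
  apply: lee_sum => k _; rewrite rint_indic; [|exact: mI|by rewrite mulr_ge0 ?powR_ge0].
  have [m0|m0] := eqVneq (mu (I k)) 0%E.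
    by rewrite m0 mule0; apply: rint_ge0 => x; exact: sqr_ge0.
  have aIk := aI k (ltn_ord k).
  have fm : mu (I k) \is a fin_num by rewrite ge0_fin_numE; [exact: lmu|exact: measure_ge0].
  have ms := mf_symbol_diff af lnu sb aIk.
  rewrite (@eq_rint _ _ _ _ _ (fun x => average mu f (I k) ^+ 2 * symbol_diff L nu b (I k) x ^+ 2)); last first.
    by move=> x; rewrite (paraproduct_termE mu af lnu sb f aIk) exprMn.
  rewrite rintZ; [|by mes|by nneg|exact: sqr_ge0].
  rewrite (energyE af lnu sb p2 sLp aIk m0) -(fineK fm) -!EFinM lee_fin.
  have -> : al k * y k `^ (r' - 1) * fine (mu (I k)) = y k `^ (r' - 1) * energy L nu b (I k).
    by rewrite /al /density; field; rewrite fine_eq0.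
  apply: ler_wpM2r; first exact: energy_ge0.
  by apply: favg; [exact: ltn_ord|exact: m0].
(* The parameter of Young's inequality for which the term in [G] gets the factor [2^-1]. *)
pose sg := (2 * r' * C1 * a `^ p) `^ (- r^-1).
have BA : 0 < 2 * r' * C1 * a `^ p by rewrite mulr_gt0 ?powR_gt0.
have sg0 : 0 < sg by rewrite powR_gt0.
have sgr : sg `^ r = (2 * r' * C1 * a `^ p)^-1.
  by rewrite /sg -powRrM mulNr mulVf ?gt_eqF// powRN powRr1// ltW.
have sgr' : sg `^ (- r') = ((2 * r' * C1) `^ r^-1 * a ^+ 2) `^ r'.
  have -> : a ^+ 2 = (a `^ p) `^ r^-1.
    rewrite -powRrM -powR2 ?(ltW a0)//; congr (_ `^ _).
    by rewrite rE; field; rewrite gt_eqF.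
  rewrite -(powRM r^-1 (ltW B0) (powR_ge0 a p)) /sg. rewrite -!powRrM.
  by rewrite mulrNN.
have step2 : (rint nu Q <= (sg `^ r)%:E * \rint[nu]_x (Q x `^ r) + (sg `^ (- r'))%:E * nu J)%E.
  rewrite -rintZ; side. rewrite -rint_indic ?powR_ge0// -rintD; side.
  apply: rint_le; [by mes|by mes|by nneg|] => x.
  have [Jx|nJ] := pselect (J x).
    have := young_scaled r1 rr sg0 (Q0 x) ler01.
    by rewrite mulr1 indicE mem_set// powR1.
  have -> : Q x = 0.
    rewrite /Q big1// => k _; have aIk := aI k (ltn_ord k).
    rewrite (paraproduct_termE mu af lnu sb f aIk) (am_supp (symbol_diff_atom_mdiff af lnu sb aIk)).
      by rewrite mulr0 expr0n.
    by move=> Ix; apply: nJ; exact: (IJ k (ltn_ord k)).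
  by nneg.
have step3 : (\rint[nu]_x (Q x `^ r) <= (C1 * a `^ p)%:E * G)%E.
  have fL : f \in Lfun mu p%:E by apply/(Lfun_rintP mu p0).
  have <- : \rint[mu]_x (`|f x| `^ p) = G by apply: eq_rint.
  apply: le_trans (H1 _ _ _ _ _ _ _ a f K af lmu lnu sb bd fL _); last first.
    by split=> // I0 /KJ[].
  by rewrite le_eqVlt; apply/orP; left; apply/eqP; apply: eq_rint => x; rewrite QE rE.
have J0 : (0 <= nu J)%E by exact: measure_ge0.
have step4 : (G <= 2^-1%:E * G + (r' * sg `^ (- r'))%:E * nu J)%E.
  apply: (le_trans step1).
  apply: (@le_trans _ _ (r'%:E * ((sg `^ r)%:E * ((C1 * a `^ p)%:E * G) + (sg `^ (- r'))%:E * nu J))%E).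
    apply: lee_wpmul2l; first by rewrite lee_fin ltW.
    apply: (le_trans step2); apply: leeD => //.
    by apply: lee_wpmul2l => //; rewrite lee_fin powR_ge0.
  rewrite ge0_muleDr; last 2 first.
  - by rewrite !mule_ge0// lee_fin ?powR_ge0// mulr_ge0 ?powR_ge0// ltW.
  - by rewrite mule_ge0// lee_fin powR_ge0.
  rewrite !muleA -!EFinM sgr.
  have E : r' * (2 * r' * C1 * a `^ p)^-1 * (C1 * a `^ p) = 2^-1.
    by field; rewrite !gt_eqF// powR_gt0.
  by rewrite E; exact: lexx.
have := ereal_absorb Gfin G0 step4; rewrite muleA -EFinM => /le_trans; apply.
apply: lee_wpmul2r => //; rewrite lee_fin sgr'.
have -> : C = (2 * r') `^ r'^-1 * ((2 * r' * C1) `^ r^-1 * a ^+ 2) by rewrite /C mulrA.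
rewrite [leRHS]powRM ?mulr_ge0 ?powR_ge0 ?sqr_ge0 ?(ltW a0)//.
have -> : ((2 * r') `^ r'^-1) `^ r' = 2 * r'.
  by rewrite -powRrM mulVf ?gt_eqF// powRr1// mulr_ge0// ltW.
by rewrite mulrA.
Qed.

(** * Sufficiency *)

Lemma fsum_nth_cond (T : Type) (R : realType) (s : seq (set T)) (P : pred (set T))
    (G : set T -> R) : uniq s ->
  \sum_(k < size s | P (nth set0 s k)) G (nth set0 s k) =
  \sum_(I \in [set I | [set` s] I /\ P I]) G I.
Proof.
move=> us; have -> : [set I | [set` s] I /\ P I] = [set` seq.filter P s].
  apply/seteqP; split=> I /=; rewrite mem_filter.
    by move=> [sI PI]; rewrite PI.
  by move=> /andP[].
by rewrite -fsbig_seq ?filter_uniq// big_filter (big_nth set0) big_mkord.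
Qed.

(** Jensen's inequality for the square, from [f ^+ 2 >= 2 * l * f - l ^+ 2]. *)
Lemma average_sqr_le d (T : measurableType d) (R : realType)
    (m : {measure set T -> \bar R}) (f : T -> R) (I : set T) :
  measurable I -> (m I < +oo)%E -> measurable_fun setT f ->
  m.-integrable I (EFin \o f) ->
  ((average m f I ^+ 2)%:E * m I <= \rint[m]_x (f x ^+ 2 * \1_I x))%E.
Proof.
move=> mI fI mf intf; set l := average m f I.
pose e1 x := 2 * l * (f x * \1_I x); pose e2 x := 2 * l ^+ 2 * \1_I x.
have E1 : EFin \o e1 = (fun x => (2 * l)%:E * ((EFin \o f) \_ I) x)%E.
  apply/funext => x; rewrite /= /e1 patchE indicE; case: (x \in I).
    by rewrite mulr1 EFinM.
  by rewrite mulr0 mulr0 mule0.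
have E2 : EFin \o e2 = (fun x => (2 * l ^+ 2)%:E * (\1_I x)%:E)%E.
  by apply/funext => x; rewrite /= /e2 EFinM.
have i0 : m.-integrable setT ((EFin \o f) \_ I) by exact/(integrable_mkcond _ mI).
have i1 : m.-integrable setT (EFin \o e1) by rewrite E1; exact: integrableZl.
have j0 := integrable_indic_fin mI fI.
have i2 : m.-integrable setT (EFin \o e2) by rewrite E2; exact: integrableZl.
have Ie1 : (\int[m]_x (EFin \o e1) x = (2 * l)%:E * (l%:E * m I))%E.
  by rewrite E1 integralZl// -integral_mkcond -average_mul.
have Ie2 : (\int[m]_x (EFin \o e2) x = (2 * l ^+ 2)%:E * m I)%E.
  by rewrite E2 integralZl// integral_indic// setIT.
rewrite -rint_indic ?sqr_ge0//.
have fm : m I \is a fin_num by rewrite ge0_fin_numE.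
apply: (@le_rint_mean0 _ _ _ m _ _ (fun x => e1 x - e2 x)); [by mes|by mes|by nneg|by nneg| | |].
- have -> : EFin \o (fun x => e1 x - e2 x) = (fun x => (EFin \o e1) x - (EFin \o e2) x)%E by [].
  exact: integrableB.
- have -> : (\int[m]_x (e1 x - e2 x)%:E = \int[m]_x ((EFin \o e1) x - (EFin \o e2) x))%E.
    by apply: eq_integral => x _; rewrite EFinB.
  rewrite integralB// Ie1 Ie2 muleA -EFinM.
  have -> : 2 * l * l = 2 * l ^+ 2 by ring.
  by rewrite subee// fin_numM.
move=> x; rewrite /e1 /e2 indicE; case: (x \in I); last by rewrite !mulr0; lra.
by rewrite !mulr1; have := sqr_ge0 (f x - l); rewrite sqrrB; lra.
Qed.

(** The square function of the paraproduct is the positive operator with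
    [q = average f ^+ 2] and [w = symbol_diff ^+ 2], which is compared with the
    function [f ^+ 2]. The first testing condition for it is that of the symbol,
    read through the square function inequality; the second one is literally the
    condition on squares. Atoms that are null for [mu] contribute nothing and are
    discarded. *)
Lemma bound_of_testing (R : realType) (p r r' : R) : 2 < p -> r = p / 2 ->
  r^-1 + r'^-1 = 1 -> exists2 C : R, 0 < C &
  forall d (T : measurableType d) (S L : int -> set (set T))
    (mu nu : {measure set T -> \bar R}) (b : symbol T R) (B0 B1 B : R),
  atomic_filtration S L -> locally_finite L mu -> locally_finite L nu ->
  is_symbol L nu b -> 0 < B -> 0 <= B0 -> B0 <= B -> 0 <= B1 -> B1 <= B ^+ 2 ->
  symbol_testing L mu nu p b B0 -> square_testing L mu nu r' b B1 ->
  paraproduct_bound L mu nu p b (C * B).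
Proof.
move=> p2 rE rr; have p0 : 0 < p by lra.
have r1 : 1 < r by rewrite rE; lra.
have r0 : 0 < r by lra.
have [r'1 _ _] := conj_exponent r1 rr.
have r'0 : 0 < r' by lra.
have [C1 C10 H1] := Lp_sum_square p2.
have [C2 C20 H2] := positive_testing r1 rr.
have [C3 C30 H3] := Lp_sum_exists p2.
have C11 : 0 < C1 + 1 by lra.
have CC : 0 < C3 * (C2 * (C1 + 1)) by rewrite !mulr_gt0.
exists ((C3 * (C2 * (C1 + 1))) `^ p^-1); first by rewrite powR_gt0.
move=> d T S L mu nu b B0 B1 B af lmu lnu sb Bp B00 B0B B10 B1B ts qs f fL.
have sLp := symbol_in_Lp_testing p2 ts.
have /(Lfun_rintP mu p0)[mf fp] := fL.
have fp0 : (0 <= \rint[mu]_x (`|f x| `^ p))%E by apply: rint_ge0 => x; exact: powR_ge0.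
have ffin : \rint[mu]_x (`|f x| `^ p) \is a fin_num by rewrite ge0_fin_numE.
(* A common constant: [D `^ r >= C1 * B `^ p] and [D >= B ^+ 2]. *)
pose D := (C1 + 1) `^ r^-1 * B ^+ 2.
have D0 : 0 < D by rewrite mulr_gt0 ?powR_gt0// exprn_gt0.
have Dr : D `^ r = (C1 + 1) * B `^ p.
  rewrite /D powRM ?powR_ge0 ?sqr_ge0// -powRrM mulVf ?gt_eqF// powRr1 ?(ltW C11)//.
  by rewrite rE powR_half gtr0_norm.
have B1D : B1 <= D.
  apply: (le_trans B1B); rewrite /D ler_peMl ?sqr_ge0//.
  rewrite -[leLHS](powRr0 (C1 + 1)); apply: ler_powR; first by lra.
  by rewrite invr_ge0 ltW.
pose M := C2 * D `^ r * fine (\rint[mu]_x (`|f x| `^ p)).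
have M0 : 0 <= M by rewrite !mulr_ge0 ?powR_ge0 ?fine_ge0// ltW.
have mF := paraproduct_term_md_family af lnu sb p2 f sLp.
have [|g Hg gM] := H3 _ _ _ _ _ _ _ _ af lnu M0 mF; last first.
  exists g => //; rewrite !(powR_Lnorm_rint _ p0); apply: (le_trans gM).
  rewrite -[X in (_ <= _ * X)%E](fineK ffin) -EFinM lee_fin.
  rewrite /M Dr powRM ?powR_ge0 ?(ltW Bp)// -powRrM mulVf ?gt_eqF// powRr1 ?(ltW CC)//.
  by rewrite !mulrA.
clear fL; move=> K [fK KL].
(* Only here is the division by [mu I] meaningful. *)
pose K' := K `&` [set I | mu I != 0%E].
have K'K : K' `<=` K by move=> I [].
have fK' : finite_set K' by exact: sub_finite_set fK.
have [s [us sE sinc]] := sort_by_inclusion fK'.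
have sD J : [set` s] J -> atoms L J /\ mu J != 0%E by rewrite sE => -[/KL].
have mS := symbol_md_family af lnu sb sLp sD.
have X := md_family_seq af lnu p0 us mS sinc.
pose I k := nth set0 s k; pose N := size s.
pose w k x := truncated_nth s (symbol_diff L nu b) k x ^+ 2.
pose q k := average mu f (I k) ^+ 2.
pose al k := density L mu nu b (I k).
have Iin k : (k < N)%N -> [set` s] (I k) by move=> kN; rewrite /= mem_nth.
have I0 k : (N <= k)%N -> I k = set0 by move=> ?; rewrite /I nth_default.
have aI k (kN : (k < N)%N) : atoms L (I k) := (sD _ (Iin k kN)).1.
have nI k (kN : (k < N)%N) : mu (I k) != 0%E := (sD _ (Iin k kN)).2.
have fmu k : (mu (I k) < +oo)%E.
  by have [kN|kN] := ltnP k N; [apply: lmu; exact: aI|rewrite I0// measure0].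
have wE k : (k < N)%N -> w k = fun x => symbol_diff L nu b (I k) x ^+ 2.
  by move=> kN; apply/funext => x; rewrite /w /truncated_nth kN.
have mI := md_measurable X; have md := md_mf X.
have intf k : mu.-integrable (I k) (EFin \o f).
  by apply: (@Lp_integrable_on _ _ _ _ p _ _ _ mf fp (mI k) (fmu k)); lra.
have wal k : rint nu (w k) = ((al k)%:E * mu (I k))%E.
  have [kN|kN] := ltnP k N; last first.
    rewrite I0// measure0 mule0 (@eq_rint _ _ _ _ _ (fun=> 0)) ?/rint ?integral0// => x.
    by rewrite /w /truncated_nth ltnNge kN expr0n.
  have fm : mu (I k) \is a fin_num by rewrite ge0_fin_numE.
  rewrite wE// (energyE af lnu sb p2 sLp (aI k kN) (nI k kN)) -(fineK fm) -EFinM.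
  by rewrite /al /density /= divfK// fine_eq0// nI.
have sumK (G : set T -> T -> R) x : \sum_(k < N) G (I k) x = \sum_(J \in K') G J x.
  by rewrite -sE (fsum_nth (fun J => G J x) us).
have sub_sum i (G : set T -> T -> R) x :
    \sum_(k < N | `[< I k `<=` I i >]) G (I k) x =
    \sum_(J \in [set J | K' J /\ `[< J `<=` I i >]]) G J x.
  by rewrite -sE (fsum_nth_cond (fun J => `[< J `<=` I i >]) (fun J => G J x) us).
have fsK i : fsets (subatoms L (I i) `&` [set I | mu I != 0%E])
     [set J | K' J /\ `[< J `<=` I i >]].
  split; first by apply: (sub_finite_set _ fK') => J [].
  by move=> J [[KJ J0] /asboolP sub]; split => //; split => //; exact: KL.
have T1 i : (i < N)%N ->
    (\rint[nu]_x ((\sum_(k < N | `[< I k `<=` I i >]) w k x) `^ r) <= (D `^ r)%:E * mu (I i))%E.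
  move=> iN; have [g Lg gB] := ts (I i) (aI i iN).
  have DJ J : (subatoms L (I i) `&` [set I | mu I != 0%E]) J -> atoms L J /\ mu J != 0%E.
    by move=> [[]].
  have mFi := symbol_md_family af lnu sb sLp DJ.
  have DA J : (subatoms L (I i) `&` [set I | mu I != 0%E]) J -> J `<=` I i by move=> [[]].
  have := H1 _ _ _ _ _ _ _ g (I i) _ af lnu mFi Lg (mI i) DA (fsK i).
  rewrite -rE (@eq_rint _ _ _ _ _ (fun x => (\sum_(k < N | `[< I k `<=` I i >]) w k x) `^ r)).
    move=> /le_trans; apply.
    apply: (@le_trans _ _ (C1%:E * ((B0 `^ p)%:E * mu (I i)))%E).
      by apply: lee_wpmul2l => //; rewrite lee_fin ltW.
    rewrite muleA -EFinM; apply: lee_wpmul2r => //; rewrite lee_fin Dr.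
    apply: ler_pM; [exact: ltW|exact: powR_ge0|by lra|].
    by apply: ge0_ler_powR; rewrite ?nnegrE// ltW.
  move=> x; rewrite -(sub_sum i (fun J x => symbol_diff L nu b J x ^+ 2)).
  by congr (_ `^ _); apply: eq_bigr => k _; rewrite wE.
have T2 i : (i < N)%N ->
    (\rint[mu]_x ((\sum_(k < N | `[< I k `<=` I i >]) al k * \1_(I k) x) `^ r') <=
      (D `^ r')%:E * nu (I i))%E.
  move=> iN; have := qs (I i) (aI i iN).
  rewrite (eq_integral (fun x => (\esum_(J in subatoms L (I i)) (density L mu nu b J * \1_J x)%:E) `^ r')%E); last first.
    move=> x _; congr (_ `^ _)%E; apply: eq_esum => J [aJ _].
    exact: (square_termE af lmu lnu sb p2 sLp).
  move=> Hq.
  apply: (@le_trans _ _ ((B1 `^ r')%:E * nu (I i))%E); last first.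
    apply: lee_wpmul2r => //; rewrite lee_fin.
    by apply: ge0_ler_powR; rewrite ?nnegrE// ltW.
  apply: le_trans Hq.
  have fs' : fsets (subatoms L (I i)) [set J | K' J /\ `[< J `<=` I i >]].
    by have [f1 f2] := fsK i; split => // J /f2[].
  have cs : countable (subatoms L (I i)).
    apply: (@sub_countable _ _ _ (atoms L)); first by apply: subset_card_le => J [].
    by apply: bigcup_countable => // n _; exact: af_countable af n.
  have t0 J x : 0 <= density L mu nu b J * \1_J x :> R by rewrite mulr_ge0// density_ge0.
  have mt J : subatoms L (I i) J -> measurable_fun setT (fun x => density L mu nu b J * \1_J x).
    by move=> [aJ _]; have := atom_measurable af aJ => mJ; mes.
  apply: le_trans (le_int_esum_pow mu cs t0 mt r'0 (mI i) fs').
  rewrite le_eqVlt; apply/orP; left; apply/eqP; apply: eq_rint => x.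
  rewrite (sub_sum i (fun J x => density L mu nu b J * \1_J x)).
  have [Ix|nIx] := pselect (I i x); first by rewrite indicE mem_set// mulr1.
  rewrite [X in X `^ _]fsbig1 ?powR0 ?gt_eqF ?mul0r// => J [_ /asboolP sub].
  by rewrite indicE memNset ?mulr0// => Jx; apply: nIx; exact: sub.
have eS x : psum (fun k x => q k * w k x) N x = \sum_(J \in K) paraproduct_term L mu nu b f J x ^+ 2.
  transitivity (\sum_(J \in K') paraproduct_term L mu nu b f J x ^+ 2).
    rewrite -(sumK (fun J x => paraproduct_term L mu nu b f J x ^+ 2)); apply: eq_bigr => k _.
    by rewrite (paraproduct_termE mu af lnu sb f (aI k (ltn_ord k))) wE// exprMn.
  apply: fsbig_widen => // J [KJ nK'] /=; rewrite paraproduct_term0 ?expr0n//.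
  by apply/eqP/negP => /negP J0; apply: nK'.
rewrite (@eq_rint _ _ _ _ _ (fun x => psum (fun k x => q k * w k x) N x `^ r)); last first.
  by move=> x; rewrite eS rE.
have -> : M%:E = ((C2 * D `^ r)%:E * \rint[mu]_x ((f x ^+ 2) `^ r))%E.
  rewrite /M (EFinM (C2 * D `^ r)) (fineK ffin).
  rewrite (@eq_rint _ _ _ _ _ (fun x => (f x ^+ 2) `^ r)); first exact: erefl.
  by move=> x; rewrite rE powR_half.
apply: (H2 d T mu nu I w (fun x => f x ^+ 2) q al D N (md_tree X) mI fmu (md_finite X)
  _ _ _ _ _ _ _ _ _ _ wal D0 T1 T2).
- by move=> k; rewrite /w; have := md k => ?; mes.
- by move=> k x; exact: sqr_ge0.
- by move=> k x nIx; rewrite /w (md_supp X nIx) expr0n.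
- by move=> j k x y jk Ix Iy; rewrite /w (md_adapted X jk Ix Iy).
- move=> k; rewrite (@eq_rint _ _ _ _ _ (fun x => `|truncated_nth s (symbol_diff L nu b) k x| `^ p)).
    exact: (md_Lp X k).
  by move=> x; rewrite /w rE powR_half.
- by mes.
- by move=> x; exact: sqr_ge0.
- by move=> k; exact: sqr_ge0.
- by move=> k kN; exact: average_sqr_le.
- by move=> k; exact: density_ge0.
Qed.

(** * Best constants *)

Lemma paraproduct_bound_le d (T : measurableType d) (R : realType)
    (L : int -> set (set T)) (mu nu : {measure set T -> \bar R}) (p : R)
    (b : symbol T R) (a a' : R) : 0 < p -> 0 <= a -> a <= a' ->
  paraproduct_bound L mu nu p b a -> paraproduct_bound L mu nu p b a'.
Proof.
move=> p0 a0 aa' Ha f fL; have [g Hg gA] := Ha f fL; exists g => //.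
apply: (le_trans gA); apply: lee_wpmul2r; first exact: poweR_ge0.
rewrite lee_fin; apply: ge0_ler_powR => //; [exact: ltW|].
by rewrite nnegrE (le_trans a0).
Qed.

Lemma best_constant_ge0 (R : realType) (P : R -> Prop) : (0 <= best_constant P)%E.
Proof. by apply: le_ereal_inf_tmp => _ [c [c0 _] <-]; rewrite lee_fin. Qed.

Lemma best_constant_le (R : realType) (P : R -> Prop) (c : R) :
  0 <= c -> P c -> (best_constant P <= c%:E)%E.
Proof. by move=> c0 Pc; apply: ereal_inf_lbound; exists c. Qed.

Lemma best_constant_lt (R : realType) (P : R -> Prop) (y : R) :
  (best_constant P < y%:E)%E -> exists2 c, 0 <= c & P c /\ c < y.
Proof.
by move=> /ereal_inf_lt[_ [c [c0 Pc] <-]]; rewrite lte_fin => cy; exists c.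
Qed.

Lemma poweR_half_sqr (R : realType) (y : R) : 0 <= y -> ((y ^+ 2)%:E `^ 2^-1 = y%:E)%E.
Proof. by move=> y0; rewrite poweR_EFin powR12_sqrt ?sqr_ge0// sqrtr_sqr ger0_norm. Qed.

Lemma poweR_half_le (R : realType) (x y : \bar R) :
  (0 <= x)%E -> (x <= y)%E -> (x `^ 2^-1 <= y `^ 2^-1)%E.
Proof.
move=> x0 xy; apply: gt0_ler_poweR; last exact: xy.
- by rewrite invr_ge0.
- by rewrite in_itv/= x0 leey.
- by rewrite in_itv/= (le_trans x0 xy) leey.
Qed.

Theorem theorem1p4 (R : realType) (p r r' : R) (hp : 2 < p) (hr : r = p / 2)
    (hr' : r^-1 + r'^-1 = 1) :
  exists c C : R, [/\ 0 < c, c <= C &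
    forall (d : measure_display) (T : measurableType d)
      (S L : int -> set (set T)) (mu nu : {measure set T -> \bar R})
      (b : symbol T R),
    atomic_filtration S L ->
    locally_finite L mu -> locally_finite L nu ->
    is_symbol L nu b ->
    let A := best_constant (paraproduct_bound L mu nu p b) in
    let B := best_constant (symbol_testing L mu nu p b) in
    let Bstar := best_constant (square_testing L mu nu r' b) in
    ((exists2 a : R, 0 <= a & paraproduct_bound L mu nu p b a) <->
     (exists B0 B1 : R, [/\ 0 <= B0, 0 <= B1,
        symbol_testing L mu nu p b B0 & square_testing L mu nu r' b B1])) /\
    (c%:E * maxe B (Bstar `^ 2^-1) <= A)%E /\
    (A <= C%:E * maxe B (Bstar `^ 2^-1))%E].
Proof.
have p0 : 0 < p by lra.
have [Ca Ca0 Ha] := symbol_testing_of_bound hp.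
have [Cb Cb0 Hb] := square_testing_of_bound hp hr hr'.
have [Cc Cc0 Hc] := bound_of_testing hp hr hr'.
(* [k * a] bounds both [Ca * a] and the square root of [Cb * a ^+ 2]. *)
pose k := Ca + Num.sqrt Cb.
have k0 : 0 < k by rewrite ltr_pwDl// sqrtr_ge0.
have kV : 0 < k^-1 by rewrite invr_gt0.
have C0 : 0 < Cc + k^-1 by rewrite addr_gt0.
exists k^-1, (Cc + k^-1); split => //; first by rewrite lerDr ltW.
move=> d T S L mu nu b af lmu lnu sb A B Bstar.
have Bs0 : (0 <= Bstar)%E := best_constant_ge0 _.
have testing a : 0 < a -> paraproduct_bound L mu nu p b a ->
    symbol_testing L mu nu p b (Ca * a) /\ square_testing L mu nu r' b (Cb * a ^+ 2).
  by move=> a0 Hbd; split; [apply: (Ha _ _ _ _ _ _ _ a af) => //; exact: ltW|apply: (Hb _ _ _ _ _ _ _ a af)].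
split; [split|split].
- move=> [a a0 Hbd]; have a1 : 0 < a + 1 by lra.
  have aa1 : a <= a + 1 by lra.
  have Hbd' := paraproduct_bound_le p0 a0 aa1 Hbd.
  have [t1 t2] := testing _ a1 Hbd'.
  exists (Ca * (a + 1)), (Cb * (a + 1) ^+ 2); split => //.
    by rewrite mulr_ge0// ltW.
  by rewrite mulr_ge0 ?sqr_ge0// ltW.
- move=> [B0 [B1 [B00 B10 t1 t2]]].
  have y0 : 0 < B0 + B1 + 1 by lra.
  exists (Cc * (B0 + B1 + 1)); first by rewrite mulr_ge0// ltW.
  apply: (Hc _ _ _ _ _ _ _ _ _ _ af lmu lnu sb y0 B00 _ B10 _ t1 t2); first by lra.
  by rewrite expr2; have := mulr_ge0 B00 B10; have := mulr_ge0 B00 B00;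
    have := mulr_ge0 B10 B10; lra.
- apply: le_ereal_inf_tmp => _ [a [a0 Hbd] <-].
  (* The bound of the squares is available for positive constants only, hence the
     detour through [a + e]. *)
  apply/lee_addgt0Pr => e e0; rewrite -EFinD.
  have ae : 0 < a + e by lra.
  have [t1 t2] := testing _ ae (paraproduct_bound_le p0 a0 (ler_wpDr (ltW e0) (lexx a)) Hbd).
  rewrite -[X in (_ <= X)%E](_ : (k^-1)%:E * (k * (a + e))%:E = (a + e)%:E)%E; last first.
    by rewrite -EFinM mulKf// gt_eqF.
  apply: lee_wpmul2l; first by rewrite lee_fin ltW.
  rewrite ge_max; apply/andP; split.
    apply: (le_trans (best_constant_le _ t1)); first by rewrite mulr_ge0// ltW.
    by rewrite lee_fin ler_pM2r// lerDl sqrtr_ge0.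
  have CE : Cb * (a + e) ^+ 2 = (Num.sqrt Cb * (a + e)) ^+ 2.
    by rewrite exprMn sqr_sqrtr// ltW.
  rewrite CE in t2; have := best_constant_le (sqr_ge0 _) t2.
  have y0 : 0 <= Num.sqrt Cb * (a + e) by rewrite mulr_ge0 ?sqrtr_ge0// ltW.
  move=> /(poweR_half_le Bs0); rewrite poweR_half_sqr// => /le_trans; apply.
  by rewrite lee_fin ler_pM2r// lerDr ltW.
set m := maxe _ _.
have : (0 <= m)%E by rewrite le_max poweR_ge0 orbT.
case Em : m => [v| |] // v0; last by rewrite gt0_muley ?lte_fin// leey.
(* The infimum need not be attained; every larger [y] dominates admissible constants. *)
have upper y : v < y -> (A <= (Cc * y)%:E)%E.
  move=> vy; have y0 : 0 < y by apply: le_lt_trans vy; rewrite -lee_fin.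
  have : (m < y%:E)%E by rewrite Em lte_fin.
  rewrite gt_max => /andP[/best_constant_lt[B0 B00 [t1 B0y]] By].
  have /best_constant_lt[B1 B10 [t2 B1y]] : (Bstar < (y ^+ 2)%:E)%E.
    rewrite ltNge; apply/negP => yB; move: By; rewrite ltNge => /negP; apply.
    rewrite -(poweR_half_sqr (ltW y0)); apply: poweR_half_le => //.
    by rewrite lee_fin sqr_ge0.
  apply: best_constant_le; first by rewrite mulr_ge0// ltW.
  exact: (Hc _ _ _ _ _ _ _ _ _ _ af lmu lnu sb y0 B00 (ltW B0y) B10 (ltW B1y) t1 t2).
have vC : ((Cc * v)%:E <= ((Cc + k^-1) * v)%:E)%E.
  by rewrite lee_fin ler_wpM2r// lerDl ltW.
rewrite -EFinM; apply: le_trans vC; apply/lee_addgt0Pr => e e0.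
have ev : v < v + e / Cc by rewrite ltrDl divr_gt0.
apply: (le_trans (upper _ ev)); rewrite -EFinD lee_fin mulrDr mulrCA divff ?mulr1//.
by rewrite gt_eqF.
Qed.
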